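(* Let $G$ be a graph that has a touching triangles representation, and let $u$ and $v$ be any two distinct vertices of $G$. Then $|N_{uv}|\le 4$ and $|E_{uv}|\le 2$.
   Context: A touching triangles representation of a graph $G=(V,E)$ is a set of triangles in the plane with pairwise disjoint interiors, in bijection with $V$, such that two triangles touch non-trivially (their boundaries share a segment of positive length; sharing only a point does not count) if and only if the corresponding vertices are adjacent. For a vertex $u$, $N_u$ denotes the set of vertices adjacent to $u$. For vertices $u,v$, $N_{uv}=N_u\cap N_v$ is the set of common neighbors, and $E_{uv}$ is the set of edges of $G$ with both endpoints in $N_{uv}$ (the edge set of the subgraph induced by $N_{uv}$). *)

(* Defs.v *)
From HB Require Import structures.
From mathcomp Require Import all_boot all_order all_algebra.
From mathcomp Require Import all_classical all_reals all_analysis.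

Set Implicit Arguments.
Unset Strict Implicit.
Unset Printing Implicit Defensive.

Import Order.TTheory GRing.Theory Num.Theory.
Import numFieldNormedType.Exports.

Local Open Scope classical_set_scope.
Local Open Scope ring_scope.

Definition boundary (T : topologicalType) (A : set T) : set T :=
  closure A `\` A°.

Section Plane.
Variable R : realType.
Implicit Types (a b c p : 'rV[R]_2) (A B : set 'rV[R]_2).

Definition segment a b : set 'rV[R]_2 :=
  [set p | exists2 t : R, 0 <= t <= 1 & p = (1 - t) *: a + t *: b].

Definition conv3 a b c : set 'rV[R]_2 :=
  [set p | exists r s t : R,
     [/\ 0 <= r, 0 <= s, 0 <= t, r + s + t = 1
       & p = r *: a + s *: b + t *: c]].

(* A triangle is a closed, filled region; the rank condition says that its
   three corners are not collinear. *)
Definition is_triangle A : Prop :=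
  exists a b c, row_free (col_mx (b - a) (c - a)) /\ A = conv3 a b c.

Definition touch A B : Prop :=
  exists p q : 'rV[R]_2, p != q /\ segment p q `<=` boundary A `&` boundary B.

(* The set of triangles of the representation is the range of [tri]; it is in
   bijection with the vertices because [tri] is injective. *)
Definition touching_triangles_rep (V : finType) (e : rel V)
    (tri : V -> set 'rV[R]_2) : Prop :=
  [/\ injective tri,
      forall x, is_triangle (tri x),
      forall x y, x != y -> (tri x)° `&` (tri y)° = set0
    & forall x y, x != y -> (touch (tri x) (tri y) <-> e x y)].

Definition has_touching_triangles_rep (V : finType) (e : rel V) : Prop :=
  exists tri : V -> set 'rV[R]_2, touching_triangles_rep e tri.

End Plane.

Section Graph.
Variables (V : finType) (e : rel V).

Definition neighbors (u : V) : {set V} := [set x | e u x]%SET.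

Definition common_neighbors (u v : V) : {set V} :=
  (neighbors u :&: neighbors v)%SET.

(* Edges are unordered, so each is counted once. *)
Definition edges : {set {set V}} :=
  [set [set x; y] | x in V, y in V & e x y]%SET.

Definition common_edges (u v : V) : {set {set V}} :=
  [set f in edges | f \subset common_neighbors u v]%SET.

End Graph.

(* Main.v *)
(* A line separates the triangles of [u] and [v]; take it as the horizontal axis,
   with [v] above and [u] below. Every common neighbor leans on a side of each of
   them, and the segment joining its two contact points crosses the axis. These
   segments do not cross each other, so from left to right the touched sides of
   [v] and of [u] move monotonically around the two triangles, and no two common
   neighbors use the same pair of sides. This allows at most five pairs of sides,
   and five would force the normals to turn by more than a full angle.
   For the edges, follow the angles of the normals: if two common neighbors touch
   each other along a line, either one of them does so with its third side, or the
   line supports a side of [u] for one and a side of [v] for the other. This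
   excludes three mutually adjacent common neighbors as well as, when there are
   four, adjacency between a neighbor whose third side faces left and one whose
   third side faces right. When there are four, both kinds occur, so the graph on
   them is triangle-free and splits into two nonempty parts without edges across;
   such a graph has at most two edges, and so has a triangle-free graph on three
   vertices. *)

Require Import Defs.
From mathcomp Require Import all_boot all_order all_algebra.
From mathcomp Require Import all_classical all_reals all_analysis.
From mathcomp Require Import ring lra zify.

Set Implicit Arguments.
Unset Strict Implicit.
Unset Printing Implicit Defensive.

Import Order.TTheory GRing.Theory Num.Theory.
Import numFieldNormedType.Exports.

Local Open Scope ring_scope.

(** * Triangles and their sides *)

(** The delicate case is a flat common neighbor, one whose single side meets both triangles. Its
    contact segment runs along its boundary, so the crossing argument says nothing about two flat
    neighbors, and it fills no wedge. Two of them cannot coexist, since the triangles of [u] and [v]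
    would overlap at a common corner; a single one is treated apart in the angle arguments. A
    contact is represented by one point interior to a side of both triangles, the midpoint of a
    shared segment; at such a point the two sides lie on one line, with the triangles on opposite
    sides of it. Angles are real numbers rather than directions, kept in [0, 2 pi] for [v] and in
    [pi, 3 pi] for [u], so that most case distinctions end in linear inequalities. *)

Inductive idx := I0 | I1 | I2.

Definition nxt i := match i with I0 => I1 | I1 => I2 | I2 => I0 end.

Definition rk i : nat := match i with I0 => 0 | I1 => 1 | I2 => 2 end.

Lemma idx_dec (i j : idx) : i = j \/ i <> j.
Proof. by case: i; case: j; (left; reflexivity) || (right; discriminate). Qed.

Lemma nxt_neq (i j : idx) : i <> j -> j = nxt i \/ i = nxt j.
Proof. by case: i; case: j => // _; (left; reflexivity) || (right; reflexivity). Qed.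

Section Triangle.
Variable R : realFieldType.
Implicit Types (p q u v g x w z : R * R) (s t e : R) (i j : idx).

Definition cr u v := u.1 * v.2 - u.2 * v.1.
Definition dt u v := u.1 * v.1 + u.2 * v.2.
Definition dif p q : R * R := (p.1 - q.1, p.2 - q.2).
Definition mv p u e : R * R := (p.1 + e * u.1, p.2 + e * u.2).

Definition tri := idx -> R * R.
Implicit Types T X Y A B C : tri.

(* Outer normal of the side from [T i] to [T (nxt i)] of a counterclockwise
   triangle; [sd T i] is negative on the inner side of that line. *)
Definition nrm T i : R * R :=
  ((T (nxt i)).2 - (T i).2, (T i).1 - (T (nxt i)).1).
Definition sd T i p := dt (nrm T i) (dif p (T i)).
Definition ar T := cr (dif (T I1) (T I0)) (dif (T I2) (T I0)).

Definition inn T p := forall i, sd T i p <= 0.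
Definition inner T p := forall i, sd T i p < 0.
Definition relint T i p := sd T i p = 0 /\ forall k, k <> i -> sd T k p < 0.
Definition disj X Y := forall p, inner X p -> inner Y p -> False.
(** As an equality of affine functions it says that the two lines coincide; the sign of [k] tells
    whether the triangles lie on the same side of that line. *)
Definition prp k X i Y j := forall q, sd Y j q = k * sd X i q.

Lemma sd_mv T i p u e : sd T i (mv p u e) = sd T i p + e * dt (nrm T i) u.
Proof. rewrite /sd /dt /dif /mv /=; ring. Qed.

Lemma dt_dif T i p q : dt (nrm T i) (dif q p) = sd T i q - sd T i p.
Proof. rewrite /sd /dt /dif /=; ring. Qed.

Lemma sd_seg T i p q s :
  sd T i (mv p (dif q p) s) = (1 - s) * sd T i p + s * sd T i q.
Proof. rewrite sd_mv dt_dif; ring. Qed.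

Lemma sd_sum T p : sd T I0 p + sd T I1 p + sd T I2 p = - ar T.
Proof. rewrite /sd /ar /cr /dt /dif /nrm /=; ring. Qed.

Lemma cr_nrm T i : cr (nrm T i) (nrm T (nxt i)) = ar T.
Proof. by case: i; rewrite /ar /cr /dif /nrm /=; ring. Qed.

Lemma nrm2_gt0 T i : 0 < ar T -> 0 < dt (nrm T i) (nrm T i).
Proof.
rewrite -(cr_nrm T i) /cr /dt; set m := nrm T i => h.
have := sqr_ge0 m.1; have := sqr_ge0 m.2; rewrite !expr2 => h1 h2.
case: (ltrgtP 0 (m.1 * m.1 + m.2 * m.2)) => // e; first lra.
have /eqP : m.1 * m.1 = 0 by lra.
have /eqP : m.2 * m.2 = 0 by lra.
rewrite !mulf_eq0 !orbb => /eqP e2 /eqP e1.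
by move: h; rewrite e1 e2 !mul0r subrr ltxx.
Qed.

(** Collects the facts about the remaining side, so that later arguments need no case split on the
    numbering. *)
Lemma third T i j : i <> j -> exists k, [/\ k <> i, k <> j,
  forall p, sd T i p + sd T j p + sd T k p = - ar T,
  (forall l, [\/ l = i, l = j | l = k])
  & (nrm T k).1 = - (nrm T i).1 - (nrm T j).1 /\
    (nrm T k).2 = - (nrm T i).2 - (nrm T j).2].
Proof.
have H p := sd_sum T p.
have all3 l : [\/ l = I0, l = I1 | l = I2]
  by case: l; [constructor 1|constructor 2|constructor 3].
have hn : (nrm T I2).1 = - (nrm T I0).1 - (nrm T I1).1 /\
    (nrm T I2).2 = - (nrm T I0).2 - (nrm T I1).2 by rewrite /nrm /=; split; ring.
case: hn => hn1 hn2.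
case: i; case: j => // _;
  [exists I2|exists I1|exists I2|exists I0|exists I1|exists I0];
  (split; [by []|by []|by move=> p; have := H p; lra| |by split; lra]);
  move=> l; case: (all3 l) => ->; by [constructor 1|constructor 2|constructor 3].
Qed.

Lemma dt_cr (n1 n2 u v : R * R) :
  cr u v * cr n1 n2 = dt n1 u * dt n2 v - dt n2 u * dt n1 v.
Proof. rewrite /cr /dt; ring. Qed.

Lemma int_inn T p : inner T p -> inn T p.
Proof. by move=> H i; apply: ltW. Qed.

Lemma rel_inn T i p : relint T i p -> inn T p.
Proof.
by move=> [h0 h] k; case: (idx_dec k i) => [->|/h/ltW //]; rewrite h0.
Qed.

Lemma inn_seg T p q s : 0 <= s <= 1 -> inn T p -> inn T q ->
  inn T (mv p (dif q p) s).
Proof. by move=> /andP[s0 s1] hp hq i; rewrite sd_seg; have := hp i; have := hq i; nra. Qed.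

Lemma inn_has_int T : 0 < ar T -> exists g, inner T g.
Proof.
move=> aT; exists (mv (T I0) (mv (dif (T I1) (T I0)) (dif (T I2) (T I0)) 1) (1/3)) => i.
suff -> : sd T i (mv (T I0) (mv (dif (T I1) (T I0)) (dif (T I2) (T I0)) 1) (1/3))
  = - (ar T / 3) by lra.
by case: i; rewrite /sd /dt /ar /cr /dif /mv /nrm /=; field.
Qed.

(* Moving from [p] a little in direction [u] leads into the interior. *)
Definition enters T p u :=
  forall i, sd T i p < 0 \/ (sd T i p = 0 /\ dt (nrm T i) u < 0).

Lemma enter1 s t : s < 0 \/ (s = 0 /\ t < 0) ->
  exists2 e0, 0 < e0 & forall e, 0 < e <= e0 -> s + e * t < 0.
Proof.
move=> [s0|[-> t0]]; last by exists 1 => // e /andP[e0 _]; nra.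
exists (- s / (1 + `|t|)).
  by rewrite divr_gt0 ?oppr_gt0 // ltr_pwDl.
move=> e /andP[e0]; rewrite ler_pdivlMr ?ltr_pwDl // => h.
have ht : t <= `|t| by apply: ler_norm.
nra.
Qed.

Lemma enterP T p u : enters T p u ->
  exists2 e0, 0 < e0 & forall e, 0 < e <= e0 -> inner T (mv p u e).
Proof.
move=> h.
have [a a0 ha] := enter1 (h I0); have [b b0 hb] := enter1 (h I1).
have [c c0 hc] := enter1 (h I2).
exists (Num.min a (Num.min b c)); first by rewrite !lt_min a0 b0 c0.
move=> e /andP[e0]; rewrite !le_min => /and3P[ea eb ec].
by move=> i; rewrite sd_mv; case: i; [apply: ha|apply: hb|apply: hc]; apply/andP.
Qed.

Lemma enters_disj X Y p u : disj X Y -> enters X p u -> enters Y p u -> False.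
Proof.
move=> d /enterP[a a0 ha] /enterP[b b0 hb].
have m0 : 0 < Num.min a b by rewrite lt_min a0 b0.
apply: (d (mv p u (Num.min a b))); [apply: ha|apply: hb];
  by rewrite m0 ge_min lexx ?orbT.
Qed.

Lemma int_enters T p u : inner T p -> enters T p u.
Proof. by move=> h i; left. Qed.

Lemma inn_enters T p g : inn T p -> inner T g -> enters T p (dif g p).
Proof.
move=> hp hg i; rewrite dt_dif; have := hp i; have := hg i.
by rewrite le_eqVlt => gi /orP[/eqP->|]; [right; split=> //; lra|left].
Qed.

Lemma rel_enters T i p u : relint T i p -> dt (nrm T i) u < 0 -> enters T p u.
Proof.
by move=> [h0 h] hu k; case: (idx_dec k i) => [->|/h]; [right|left].
Qed.

Lemma int_inn_disj X Y p : 0 < ar Y -> disj X Y -> inner X p -> inn Y p -> False.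
Proof.
move=> /inn_has_int[g hg] d hX hY.
exact: (enters_disj d (int_enters (dif g p) hX) (inn_enters hY hg)).
Qed.

(** Around a point interior to a side a triangle fills a half-disk. Unless the two normals are
    opposite, some direction leads into both half-disks. *)
Lemma rel_opp X Y i j p : 0 < ar X -> 0 < ar Y -> disj X Y ->
  relint X i p -> relint Y j p -> exists2 k, k < 0 & prp k X i Y j.
Proof.
move=> aX aY d hX hY.
have no u : dt (nrm X i) u < 0 -> dt (nrm Y j) u < 0 -> False.
  by move=> h1 h2; apply: (enters_disj d (rel_enters hX h1) (rel_enters hY h2)).
have [sX0 _] := hX; have [sY0 _] := hY.
set m := nrm X i in no *; set n := nrm Y j in no *.
have m0 : 0 < dt m m := nrm2_gt0 i aX.
have n0 : 0 < dt n n := nrm2_gt0 j aY.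
have c0 : cr m n = 0.
  apply/eqP; apply/negPn/negP => c0; set D := cr m n in c0.
  (* Cramer's rule gives a direction whose scalar product with both normals is -1. *)
  have E1 : m.1 * ((m.2 - n.2) / D) + m.2 * ((n.1 - m.1) / D) = - (D / D).
    by rewrite !mulrA -mulrDl -mulNr; congr (_ / _); rewrite /D /cr; ring.
  have E2 : n.1 * ((m.2 - n.2) / D) + n.2 * ((n.1 - m.1) / D) = - (D / D).
    by rewrite !mulrA -mulrDl -mulNr; congr (_ / _); rewrite /D /cr; ring.
  rewrite divff // in E1 E2.
  by apply: (no ((m.2 - n.2) / D, (n.1 - m.1) / D)); rewrite /dt /= ?E1 ?E2; lra.
have dn : dt m n < 0.
  have [h|h|h] := ltrgtP (dt m n) 0 => //.
  - exfalso; apply: (no (- m.1, - m.2)); first by move: m0; rewrite /dt /=; lra.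
    by move: h; rewrite /dt /=; lra.
  - exfalso; move: c0 h n0 m0; rewrite /cr /dt => c0 h n0 m0.
    have : (m.1 * n.2-m.2 * n.1)^+2 + (m.1 * n.1+m.2 * n.2)^+2 =
        (m.1 * m.1+m.2 * m.2) * (n.1 * n.1+n.2 * n.2) by ring.
    rewrite c0 h expr0n /= addr0 => /esym /eqP.
    by rewrite mulf_eq0 !gt_eqF.
exists (dt m n / dt m m); first by rewrite pmulr_llt0 ?invr_gt0.
have hl : dt m n / dt m m * dt m m = dt m n by rewrite divfK ?lt0r_neq0.
set l := dt m n / dt m m in hl *.
have e1 : n.1 = l * m.1.
  apply: (mulfI (lt0r_neq0 m0)).
  have -> : dt m m * (l * m.1) = dt m n * m.1 by rewrite -hl; ring.
  by move: c0; rewrite /cr /dt => c0; have : m.2 * (m.1 * n.2 - m.2 * n.1) = 0 by [rewrite c0 mulr0]; lra.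
have e2 : n.2 = l * m.2.
  apply: (mulfI (lt0r_neq0 m0)).
  have -> : dt m m * (l * m.2) = dt m n * m.2 by rewrite -hl; ring.
  by move: c0; rewrite /cr /dt => c0; have : m.1 * (m.1 * n.2 - m.2 * n.1) = 0 by [rewrite c0 mulr0]; lra.
move=> q.
have -> : sd Y j q = dt n (dif q p) by rewrite dt_dif sY0 subr0.
have -> : sd X i q = dt m (dif q p) by rewrite dt_dif sX0 subr0.
rewrite {1}/dt e1 e2 /dt /=; ring.
Qed.

Lemma prp_nrm k X i Y j : prp k X i Y j ->
  (nrm Y j).1 = k * (nrm X i).1 /\ (nrm Y j).2 = k * (nrm X i).2.
Proof.
move=> h; have h0 := h (0,0); have h1 := h (1,0); have h2 := h (0,1).
move: h0 h1 h2; rewrite /sd /dt /dif /= => h0 h1 h2; split; lra.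
Qed.

Lemma prp_sym k X i Y j : k != 0 -> prp k X i Y j -> prp k^-1 Y j X i.
Proof. by move=> k0 h q; rewrite h mulrA mulVf // mul1r. Qed.

Lemma prp_trans k l X i Y j T m : prp k X i Y j -> prp l Y j T m ->
  prp (l * k) X i T m.
Proof. by move=> h1 h2 q; rewrite h2 h1 mulrA. Qed.

(** [X] and [Y] fill the two half-disks around [p], so the interior of [Z] would have to lie on
    their common line; but an interior point can be moved along the normal. *)
Lemma rel2_nin X Y Z i j p : 0 < ar X -> 0 < ar Y -> 0 < ar Z ->
  disj X Y -> disj X Z -> disj Y Z ->
  relint X i p -> relint Y j p -> inn Z p -> False.
Proof.
move=> aX aY aZ dXY dXZ dYZ hX hY hZ.
have [k k0 hk] := rel_opp aX aY dXY hX hY.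
have [g hg] := inn_has_int aZ.
have H g' : inner Z g' -> sd X i g' = 0.
  move=> hg'; have [sX0 _] := hX; have [sY0 _] := hY.
  have [h|h|//] := ltrgtP (sd X i g') 0.
    exfalso; apply: (enters_disj dXZ (rel_enters hX _) (inn_enters hZ hg')).
    by rewrite dt_dif; lra.
  exfalso; apply: (enters_disj dYZ (rel_enters hY _) (inn_enters hZ hg')).
  by rewrite dt_dif sY0 hk; nra.
have [e0 e00 he] := enterP (int_enters (nrm X i) hg).
have := H _ (he e0 _); rewrite e00 lexx => /(_ isT).
rewrite sd_mv H // add0r => /eqP; rewrite mulf_eq0 gt_eqF //= => /eqP h0.
by have := nrm2_gt0 i aX; rewrite h0 ltxx.
Qed.

Lemma corner T i j : 0 < ar T -> i <> j -> exists p,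
  [/\ sd T i p = 0, sd T j p = 0 & forall k, k <> i -> k <> j -> sd T k p < 0].
Proof.
move=> aT ij.
have [k [ki kj hs all3 _]] := third T ij.
have [p h1 h2] : exists2 p, sd T i p = 0 & sd T j p = 0.
  by case: (nxt_neq ij) => ->; [exists (T (nxt i))|exists (T (nxt j))];
    rewrite /sd /dt /dif /nrm /=; ring.
exists p; split=> // l li lj; have := hs p; rewrite h1 h2.
by case: (all3 l) => // ->; lra.
Qed.

Lemma cr_neq T i j : 0 < ar T -> i <> j -> cr (nrm T i) (nrm T j) != 0.
Proof.
move=> aT /nxt_neq [->|->]; first by rewrite cr_nrm gt_eqF.
have -> : cr (nrm T (nxt j)) (nrm T j) = - cr (nrm T j) (nrm T (nxt j))
  by rewrite /cr; ring.
by rewrite cr_nrm oppr_eq0 gt_eqF.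
Qed.

Lemma prp_same_idx k T i j : 0 < ar T -> prp k T i T j -> i = j.
Proof.
move=> aT /prp_nrm [h1 h2]; case: (idx_dec i j) => // /(cr_neq aT) /eqP[].
by rewrite /cr h1 h2; ring.
Qed.

End Triangle.

(** * Contacts *)

Section Contact.
Variable R : realFieldType.
Implicit Types (p q u v g x w z : R * R) (s t e : R) (i j a b l : idx).
Implicit Types T X Y A B C : tri R.

(* [x] is a point of contact of the sides [i] of [X] and [a] of [C], interior
   to both of them. *)
Definition nbr X i C a x :=
  [/\ relint X i x, relint C a x & exists2 k, k < 0 & prp k X i C a].

Definition cn X Y C i j a b x w := nbr X i C a x /\ nbr Y j C b w.

Lemma nbrI X Y i j p : 0 < ar X -> 0 < ar Y -> disj X Y ->
  relint X i p -> relint Y j p -> nbr X i Y j p.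
Proof. by move=> *; split=> //; apply: rel_opp; eauto. Qed.

Lemma nbr_sym X i C a x : nbr X i C a x -> nbr C a X i x.
Proof.
move=> [h1 h2 [k k0 h]]; split=> //; exists k^-1; first by rewrite invr_lt0.
by apply: prp_sym => //; rewrite lt_eqF.
Qed.

Lemma nbr_out X i C a x q : nbr X i C a x -> sd C a q <= 0 -> 0 <= sd X i q.
Proof. by move=> [_ _ [k k0 h]]; rewrite h nmulr_rle0. Qed.

Lemma nbr_pos X i C a x q : nbr X i C a x -> sd C a q < 0 -> 0 < sd X i q.
Proof. by move=> [_ _ [k k0 h]]; rewrite h nmulr_rlt0. Qed.

Lemma nbr_same X Y i j C D a b x w m : nbr X i C a x -> nbr Y j D b w ->
  0 < m -> prp m X i Y j -> exists2 k, 0 < k & prp k C a D b.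
Proof.
move=> [_ _ [k k0 h]] [_ _ [l l0 h']] m0 hm.
exists (l * m * k^-1); first by rewrite nmulr_lgt0 ?invr_lt0 // nmulr_rlt0.
move=> q; rewrite h h' hm mulrA -!mulrA; congr (_ * (_ * _)).
by rewrite mulrA mulVf ?mul1r // lt_eqF.
Qed.

Lemma prp_refl T i : prp 1 T i T i.
Proof. by move=> q; rewrite mul1r. Qed.

Lemma flat_same X Y C i j a x w : nbr X i C a x -> nbr Y j C a w ->
  exists2 m, 0 < m & prp m X i Y j.
Proof.
move=> h1 h2; apply: (nbr_same (nbr_sym h1) (nbr_sym h2) ltr01).
exact: prp_refl.
Qed.

Lemma same_side T T' i i' p m : 0 < ar T -> disj T T' -> 0 < m ->
  prp m T i T' i' -> relint T i p -> relint T' i' p -> False.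
Proof.
move=> aT d m0 hm h h'; have [g hg] := inn_has_int aT.
have [h0 _] := h; have [h0' _] := h'.
apply: (enters_disj d (rel_enters (u := dif g p) h _) (rel_enters h' _)).
  by rewrite dt_dif h0; have := hg i; lra.
by rewrite dt_dif h0' hm; have := hg i; nra.
Qed.

(** [cr (nrm T i)] serves as a coordinate along the line of the side. *)
Lemma line_between T i p q r : 0 < ar T ->
  sd T i p = 0 -> sd T i q = 0 -> sd T i r = 0 ->
  cr (nrm T i) p <= cr (nrm T i) q <= cr (nrm T i) r ->
  exists2 s, 0 <= s <= 1 & q = mv p (dif r p) s.
Proof.
move=> aT hp hq hr /andP[h1 h2]; have n0 := nrm2_gt0 i aT.
have eq0 (u : R * R) : dt (nrm T i) u = 0 -> cr (nrm T i) u = 0 -> u.1 = 0 /\ u.2 = 0.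
  move: n0; rewrite /dt /cr; set n := nrm T i => n0 e1 e2; split; apply: (mulfI (lt0r_neq0 n0)).
    have -> : (n.1 * n.1 + n.2 * n.2) * u.1 =
      n.1 * (n.1 * u.1 + n.2 * u.2) - n.2 * (n.1 * u.2 - n.2 * u.1) by ring.
    by rewrite e1 e2 !mulr0 subrr.
  have -> : (n.1 * n.1 + n.2 * n.2) * u.2 =
    n.2 * (n.1 * u.1 + n.2 * u.2) + n.1 * (n.1 * u.2 - n.2 * u.1) by ring.
  by rewrite e1 e2 !mulr0 addr0.
have key s : cr (nrm T i) q = (1 - s) * cr (nrm T i) p + s * cr (nrm T i) r ->
    q = mv p (dif r p) s.
  move=> e; have [] := eq0 (dif q (mv p (dif r p) s)).
  - by rewrite dt_dif sd_seg hp hq hr; ring.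
  - have -> : cr (nrm T i) (dif q (mv p (dif r p) s)) =
      cr (nrm T i) q - ((1 - s) * cr (nrm T i) p + s * cr (nrm T i) r)
      by rewrite /cr /dif /mv /=; ring.
    by rewrite e subrr.
  rewrite /dif /= => e1 e2; rewrite [LHS]surjective_pairing [RHS]surjective_pairing.
  by congr (_, _); apply/eqP; rewrite -subr_eq0 ?e1 ?e2.
have [e|e] := eqVneq (cr (nrm T i) p) (cr (nrm T i) r).
  exists 0; first by rewrite lexx ler01.
  by apply: key; lra.
have d0 : 0 < cr (nrm T i) r - cr (nrm T i) p.
  by rewrite subr_gt0 lt_neqAle e (le_trans h1 h2).
exists ((cr (nrm T i) q - cr (nrm T i) p) / (cr (nrm T i) r - cr (nrm T i) p)).
  apply/andP; split; first by apply: divr_ge0; lra.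
  by rewrite ler_pdivrMr //; lra.
by apply: key; field; rewrite gt_eqF.
Qed.

Lemma rel_seg T i p r s : 0 <= s <= 1 -> relint T i p -> relint T i r ->
  relint T i (mv p (dif r p) s).
Proof.
move=> /andP[s0 s1] [hp hp'] [hr hr']; split; first by rewrite sd_seg hp hr; ring.
by move=> k hk; rewrite sd_seg; have := hp' k hk; have := hr' k hk; nra.
Qed.

Lemma rel_between T i X j p q r : 0 < ar X ->
  (forall y, sd T i y = 0 -> sd X j y = 0) -> sd X j q = 0 ->
  relint T i p -> relint T i r ->
  cr (nrm X j) p <= cr (nrm X j) q <= cr (nrm X j) r -> relint T i q.
Proof.
move=> aX hT hq hp hr h; have [h1 _] := hp; have [h2 _] := hr.
have [s hs ->] := line_between aX (hT _ h1) hq (hT _ h2) h.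
exact: rel_seg.
Qed.

(** The four contact points lie on one line, [X] and [Y] on one side of it, [C] and [C'] on the
    other. The sides of [X] and [Y] are disjoint intervals there, and the sides of [C] and of [C']
    would both span the gap between them. The order of the points always yields one that is interior
    to two sides that should be disjoint. *)
Lemma flat_uniq X Y C C' i j a a' x w x' w' :
  0 < ar X -> 0 < ar Y -> 0 < ar C -> disj X Y -> disj C C' ->
  cn X Y C i j a a x w -> cn X Y C' i j a' a' x' w' -> False.
Proof.
move=> aX aY aC dXY dC [h1 h2] [h3 h4].
have [m m0 hm] := flat_same h1 h2.
have [k k0 hk] := nbr_same h1 h3 ltr01 (@prp_refl X i).
have [x0 cx _] := h1; have [w0 cw _] := h2; have [x0' cx' _] := h3; have [w0' cw' _] := h4.
have lC y : sd C a y = 0 -> sd X i y = 0.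
  by have [_ _ [c c0 hc]] := h1; rewrite hc => /eqP; rewrite mulf_eq0 lt_eqF //= => /eqP.
have lC' y : sd C' a' y = 0 -> sd X i y = 0.
  by have [_ _ [c c0 hc]] := h3; rewrite hc => /eqP; rewrite mulf_eq0 lt_eqF //= => /eqP.
have lY y : sd Y j y = 0 -> sd X i y = 0.
  by rewrite hm => /eqP; rewrite mulf_eq0 gt_eqF //= => /eqP.
have noXY p : relint X i p -> relint Y j p -> False := same_side aX dXY m0 hm.
have noCC p : relint C a p -> relint C' a' p -> False := same_side aC dC k0 hk.
have b1 := rel_between aX lC; have b2 := rel_between aX lC'.
have b3 := rel_between aX lY; have b4 := rel_between aX (fun y (e : sd X i y = 0) => e).
have zx : sd X i x = 0 by case: x0.
have zx' : sd X i x' = 0 by case: x0'.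
have zw : sd X i w = 0 by apply: lY; case: w0.
have zw' : sd X i w' = 0 by apply: lY; case: w0'.
set f := cr (nrm X i) in b1 b2 b3 b4.
have [A1|A1] := lerP (f x) (f w).
  have [A2|A2] := lerP (f x') (f x).
    have [A3|A3] := lerP (f x) (f w').
      by apply: (noCC x) => //; apply: (b2 x' _ w') => //; rewrite A2.
    by apply: (noXY x) => //; apply: (b3 w' _ w) => //; rewrite (ltW A3).
  have [A3|A3] := lerP (f x') (f w).
    by apply: (noCC x') => //; apply: (b1 x _ w) => //; rewrite (ltW A2).
  by apply: (noXY w) => //; apply: (b4 x _ x') => //; rewrite A1 ltW.
have [A2|A2] := lerP (f x) (f x').
  have [A3|A3] := lerP (f w') (f x).
    by apply: (noCC x) => //; apply: (b2 w' _ x') => //; rewrite A3.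
  by apply: (noXY x) => //; apply: (b3 w _ w') => //; rewrite !ltW.
have [A3|A3] := lerP (f w) (f x').
  by apply: (noCC x') => //; apply: (b1 w _ x) => //; rewrite A3 ltW.
by apply: (noXY w) => //; apply: (b4 x' _ x) => //; rewrite !ltW.
Qed.

(** Being flat depends only on the sides [i] and [j]: they lie on one line, with [X] and [Y] on the
    same side of it. *)
Lemma nbr_flat X Y C C' i j a a' b b' x w x' w' : 0 < ar C' ->
  cn X Y C i j a b x w -> cn X Y C' i j a' b' x' w' -> a = b -> a' = b'.
Proof.
move=> aC' [h1 h2] [h3 h4] ab; rewrite -ab in h2.
have [m m0 hm] := flat_same h1 h2.
have [k k0 hk] := nbr_same h3 h4 m0 hm.
exact: prp_same_idx aC' hk.
Qed.

(** Outside the flat case the lines of the sides [i] and [j] meet in a point that is a corner of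
    both [C] and [C'], and both triangles fill the same wedge there. *)
Lemma side_uniq X Y C C' i j a b a' b' x w x' w' :
  0 < ar X -> 0 < ar Y -> 0 < ar C -> 0 < ar C' -> disj X Y -> disj C C' ->
  cn X Y C i j a b x w -> cn X Y C' i j a' b' x' w' -> False.
Proof.
move=> aX aY aC aC' dXY dC h h'.
case: (idx_dec a b) => [ab|ab].
  have ab' := nbr_flat aC' h h' ab; rewrite -ab -ab' in h h'.
  exact: (flat_uniq aX aY aC dXY dC h h').
have ab' : a' <> b' by move=> e; apply: ab; apply: (nbr_flat aC h' h e).
have [h1 h2] := h; have [h3 h4] := h'.
have [k k0 hk] := nbr_same h1 h3 ltr01 (@prp_refl X i).
have [l l0 hl] := nbr_same h2 h4 ltr01 (@prp_refl Y j).
have [P [Pa Pb Pc]] := corner aC ab.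
have [_ [xa xo] _] := h1; have [_ [wb wo] _] := h2.
have Pa' : sd C' a' P = 0 by rewrite hk Pa mulr0.
have Pb' : sd C' b' P = 0 by rewrite hl Pb mulr0.
have [n1 n2] := prp_nrm hk; have [n3 n4] := prp_nrm hl.
(* The sum of the directions from the corner to the two contact points leads into the wedge. *)
pose u := mv (dif x P) (dif w P) 1.
have du i0 : dt (nrm C i0) u = (sd C i0 x - sd C i0 P) + (sd C i0 w - sd C i0 P).
  by rewrite -!dt_dif /dt /u /mv /dif /=; ring.
have ua : dt (nrm C a) u < 0 by rewrite du xa Pa; have := wo a ab; lra.
have ub : dt (nrm C b) u < 0.
  by rewrite du wb Pb; have := xo b (fun E => ab (esym E)); lra.
have ua' : dt (nrm C' a') u < 0.
  have -> : dt (nrm C' a') u = k * dt (nrm C a) u by rewrite /dt n1 n2; ring.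
  by rewrite pmulr_rlt0.
have ub' : dt (nrm C' b') u < 0.
  have -> : dt (nrm C' b') u = l * dt (nrm C b) u by rewrite /dt n3 n4; ring.
  by rewrite pmulr_rlt0.
apply: (enters_disj (u := u) (p := P) dC) => c.
  case: (idx_dec c a) => [->|ca]; first by right.
  by case: (idx_dec c b) => [->|cb]; [right|left; apply: Pc].
case: (idx_dec c a') => [->|ca]; first by right.
case: (idx_dec c b') => [->|cb]; first by right.
left; have [c' [_ _ hs all3 _]] := third C' ab'.
by have := hs P; rewrite Pa' Pb'; case: (all3 c) => // ->; lra.
Qed.

Lemma seg_int C a b x w s : a <> b -> relint C a x -> relint C b w -> 0 < s < 1 ->
  inner C (mv x (dif w x) s).
Proof.
move=> ab [xa xo] [wb wo] /andP[s0 s1] k; rewrite sd_seg.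
case: (idx_dec k a) => [->|ka]; first by rewrite xa; have := wo a ab; nra.
case: (idx_dec k b) => [->|kb]; first by rewrite wb; have := xo b (fun E => ab (esym E)); nra.
by have := xo k ka; have := wo k kb; nra.
Qed.

(** Near the end points [C] and the touched triangle leave no room for [C']; the rest of the segment
    is interior to [C], because [a] and [b] differ. *)
Lemma noncross X Y C C' i j a b x w s :
  0 < ar X -> 0 < ar Y -> 0 < ar C -> 0 < ar C' ->
  disj X C -> disj Y C -> disj X C' -> disj Y C' -> disj C C' ->
  cn X Y C i j a b x w -> a <> b -> 0 <= s <= 1 ->
  inn C' (mv x (dif w x) s) -> False.
Proof.
move=> aX aY aC aC' dXC dYC dXC' dYC' dC [[x0 xa _] [w0 wb _]] ab /andP[s0 s1].
have e0 : mv x (dif w x) 0 = x by rewrite /mv /= !mul0r !addr0; case: x {x0 xa}.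
have e1 : mv x (dif w x) 1 = w.
  by rewrite /mv /dif /= !mul1r !(addrC x.1, addrC x.2) !subrK; case: w {w0 wb e0}.
case: (ltrgtP 0 s) s0 => // [s0|<-] _; last first.
  by rewrite e0; apply: rel2_nin x0 xa.
case: (ltrgtP s 1) s1 => // [s1|->] _; last first.
  by rewrite e1; apply: rel2_nin w0 wb.
by apply: (int_inn_disj aC' dC); apply: (seg_int ab xa wb); rewrite s0.
Qed.

End Contact.

(** * The order of the contacts *)

Section Order.
Variable R : realFieldType.
Implicit Types (p q u v g x w z : R * R) (s t e : R) (i j a b l : idx).
Implicit Types T X Y A B C : tri R.

(* Two segments issued from the points [c < c'] of the axis must cross when the
   first one ends on the second side of a corner and the other on the first. *)
Lemma cross_scalar (p0 q0 d0 p1 q1 d1 c c' wx wy vx vy : R) :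
  p0 < 0 -> 0 < p0 * q1 - q0 * p1 -> c < c' ->
  0 <= p0 * c' - d0 -> 0 <= p1 * c - d1 ->
  p0 * vx + q0 * vy - d0 = 0 -> p1 * vx + q1 * vy - d1 < 0 ->
  p1 * wx + q1 * wy - d1 = 0 -> p0 * wx + q0 * wy - d0 < 0 ->
  0 < vy -> 0 <= wy ->
  exists s t, [/\ 0 <= s <= 1, 0 <= t <= 1,
    c + s * (wx - c) = c' + t * (vx - c') & s * wy = t * vy].
Proof.
set D := p0 * q1 - q0 * p1.
move=> p0n D0 cc fc' fc fv gv gw fw vy0 wy0.
set h := c' - c; have h0 : 0 < h by rewrite subr_gt0.
pose al := - (p0 * wx + q0 * wy - d0); pose be := - (p1 * vx + q1 * vy - d1).
have al0 : 0 < al by rewrite oppr_gt0.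
have be0 : 0 < be by rewrite oppr_gt0.
pose u0 := p0 * c - d0; pose u1 := p1 * c - d1.
pose u0' := p0 * c' - d0; pose u1' := p1 * c' - d1.
have u0E : u0 = u0' - p0 * h by rewrite /u0 /u0' /h; ring.
have u1E : u1' = u1 + p1 * h by rewrite /u1 /u1' /h; ring.
have u00 : 0 < u0 by rewrite u0E; rewrite -/u0' in fc'; nra.
have u10 : 0 <= u1 by [].
have u00' : 0 <= u0' by [].
have Dwy : D * wy = - p0 * u1 + p1 * (u0 + al).
  rewrite /D /u0 /u1 /al.
  have -> : d1 = p1 * wx + q1 * wy by lra.
  by ring.
have u10' : 0 <= u1'.
  have k1 : 0 <= p1 * (u0 + al) - p0 * u1 by have := mulr_ge0 (ltW D0) wy0; rewrite Dwy; lra.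
  have k2 : 0 < u0 + al by lra.
  rewrite -(pmulr_rge0 _ k2) u1E.
  have -> : (u0 + al) * (u1 + p1 * h) =
    h * (p1 * (u0 + al) - p0 * u1) + u1 * (u0' + al) by rewrite u0E; ring.
  by rewrite addr_ge0 // mulr_ge0 //; lra.
(* [De] is the determinant of the two directions, and Cramer's rule gives the parameters
   [h * vy / De] and [h * wy / De]. They are at most 1 by [o1] and [o2], which write the excess of
   [De], times [D], as a sum of nonnegative products. *)
pose De := (wx - c) * vy - wy * (vx - c').
have o1 : D * (De - h * wy) = al * be + al * u1 + u0 * be.
  rewrite /De /D /h /al /be /u1 /u0.
  have -> : d1 = p1 * wx + q1 * wy by lra.
  have -> : d0 = p0 * vx + q0 * vy by lra.
  by ring.
have o2 : D * (De - h * vy) = al * be + be * u0' + al * u1'.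
  rewrite /De /D /h /al /be /u1' /u0'.
  have -> : d1 = p1 * wx + q1 * wy by lra.
  have -> : d0 = p0 * vx + q0 * vy by lra.
  by ring.
have k1 : 0 < al * be by rewrite mulr_gt0.
have k2 : 0 <= al * u1 by rewrite mulr_ge0 // ltW.
have k3 : 0 <= u0 * be by rewrite mulr_ge0 // ltW.
have k4 : 0 <= be * u0' by rewrite mulr_ge0 // ltW.
have k5 : 0 <= al * u1' by rewrite mulr_ge0 // ltW.
have l1 : 0 < De - h * wy by rewrite -(pmulr_rgt0 _ D0) o1; lra.
have l2 : 0 < De - h * vy by rewrite -(pmulr_rgt0 _ D0) o2; lra.
have hv : 0 < h * vy by rewrite mulr_gt0.
have hw : 0 <= h * wy by rewrite mulr_ge0 // ltW.
have De0 : 0 < De by lra.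
exists (h * vy / De), (h * wy / De); split.
- by rewrite divr_ge0 ?(ltW hv) ?(ltW De0) //= ler_pdivrMr // mul1r; lra.
- by rewrite divr_ge0 ?(ltW De0) //= ler_pdivrMr // mul1r; lra.
- have e1 : h * vy / De * (wx - c) - h * wy / De * (vx - c') = h * (De / De).
    by rewrite {3}/De; ring.
  by move: e1; rewrite divff ?gt_eqF // {3}/h; lra.
- by ring.
Qed.

(** With [T I0] highest, the counterclockwise numbering lists the left side, the bottom side and the
    right side, so [rk] is the order of the sides as seen from the axis below. *)
Definition topped T := (T I1).2 <= (T I0).2 /\ (T I2).2 <= (T I0).2.
Definition above T := forall i, 0 <= (T i).2.

(** The values [- sd T i p / ar T] are barycentric coordinates; the side [i] is opposite to the
    corner [nxt (nxt i)]. *)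
Lemma bary T p : ar T * p.2 =
  - (sd T I1 p * (T I0).2 + sd T I2 p * (T I1).2 + sd T I0 p * (T I2).2).
Proof. rewrite /ar /sd /cr /dt /dif /nrm /=; ring. Qed.

Lemma above_inn T p : 0 < ar T -> above T -> inn T p -> 0 <= p.2.
Proof.
move=> aT hT hp; rewrite -(pmulr_rge0 _ aT) bary oppr_ge0.
have h i i' : sd T i p * (T i').2 <= 0 by rewrite mulr_le0_ge0.
by have := h I1 I0; have := h I2 I1; have := h I0 I2; lra.
Qed.

Lemma top_gt0 T : 0 < ar T -> above T -> topped T -> 0 < (T I0).2.
Proof.
move=> aT hT [h1 h2]; rewrite lt_def hT andbT; apply/eqP => e.
have := hT I1; have := hT I2; move: aT; rewrite /ar /cr /dif /=.
rewrite e in h1 h2 *; move=> aT k2 k1.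
have e1 : (T I1).2 = 0 by lra.
have e2 : (T I2).2 = 0 by lra.
by move: aT; rewrite e1 e2; lra.
Qed.

Lemma rel_side_gt0 T i p : 0 < ar T -> above T -> topped T -> i <> I1 ->
  relint T i p -> 0 < p.2.
Proof.
move=> aT hT tT i1 hr; have [h0 h] := hr; have t0 := top_gt0 aT hT tT.
rewrite -(pmulr_rgt0 _ aT) bary oppr_gt0.
have k1 : sd T I1 p < 0 by apply: h => E; apply: i1.
have k2 : sd T I1 p * (T I0).2 < 0 by rewrite nmulr_rlt0.
have hi := rel_inn hr.
have k3 : sd T I2 p * (T I1).2 <= 0 by rewrite mulr_le0_ge0.
have k4 : sd T I0 p * (T I2).2 <= 0 by rewrite mulr_le0_ge0.
lra.
Qed.

(** A horizontal side at the apex would bound the triangle from above and have the axis strictly on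
    its inner side, so a side visible from the axis faces strictly sideways. *)
Lemma top_sees T c : 0 < ar T -> above T -> topped T ->
  (0 <= sd T I0 (c, 0) -> (nrm T I0).1 < 0) /\
  (0 <= sd T I2 (c, 0) -> 0 < (nrm T I2).1).
Proof.
move=> aT hT tT; have t0 := top_gt0 aT hT tT; case: tT => t1 t2.
split=> h.
  rewrite lt_neqAle {2}/nrm /= subr_le0 t1 andbT; apply/eqP; rewrite /nrm /= => E.
  have h1 : 0 <= - ((T I0).1 - (T I1).1) * (T I0).2.
    by move: h; rewrite /sd /dt /dif /nrm /= E; lra.
  have h2 : 0 <= - ((T I0).1 - (T I1).1) by rewrite -(pmulr_lge0 _ t0).
  have h3 : ar T = - ((T I0).1 - (T I1).1) * ((T I2).2 - (T I0).2).
    by rewrite /ar /cr /dif /= E; ring.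
  by move: aT; rewrite h3 ltNge mulr_ge0_le0 // subr_le0.
rewrite lt_def {2}/nrm /= subr_ge0 t2 andbT; apply/eqP; rewrite /nrm /= => E.
have h1 : 0 <= - ((T I2).1 - (T I0).1) * (T I2).2.
  by move: h; rewrite /sd /dt /dif /nrm /= E; lra.
have T2 : (T I2).2 = (T I0).2 by lra.
have h2 : 0 <= - ((T I2).1 - (T I0).1) by rewrite T2 in h1; rewrite -(pmulr_lge0 _ t0).
have h3 : ar T = - ((T I2).1 - (T I0).1) * ((T I1).2 - (T I0).2).
  by rewrite /ar /cr /dif /= T2; ring.
by move: aT; rewrite h3 ltNge mulr_ge0_le0 // subr_le0.
Qed.

(** Inverting two consecutive sides would make the segments cross. Inverting the two outer sides is
    impossible by itself: their lines meet at the apex above the axis, so axis points beyond the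
    right side lie to the right of those beyond the left side. *)
Lemma sides_ordered T j j' c c' w v : 0 < ar T -> above T -> topped T -> c < c' ->
  relint T j w -> relint T j' v -> 0 <= sd T j (c, 0) -> 0 <= sd T j' (c', 0) ->
  (forall s t, 0 <= s <= 1 -> 0 <= t <= 1 ->
    mv (c, 0) (dif w (c, 0)) s <> mv (c', 0) (dif v (c', 0)) t) ->
  (rk j <= rk j')%N.
Proof.
move=> aT hT tT cc rw rv sw sv nc.
have t0 := top_gt0 aT hT tT.
have w0 := above_inn aT hT (rel_inn rw); have v0 := above_inn aT hT (rel_inn rv).
have T10 : j = I1 -> j' = I0 -> False.
  move=> Ej Ej'; subst j j'.
  have n0 := (top_sees c' aT hT tT).1 sv.
  have c0 := cr_nrm T I0; rewrite /= /cr in c0.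
  have vy := rel_side_gt0 aT hT tT (i := I0) (fun E => match E with end) rv.
  have [|||||||s [t [hs ht e1 e2]]] := @cross_scalar (nrm T I0).1 (nrm T I0).2
    (dt (nrm T I0) (T I0)) (nrm T I1).1 (nrm T I1).2 (dt (nrm T I1) (T I1))
    c c' w.1 w.2 v.1 v.2 n0 _ cc _ _ _ _ _ _ vy w0.
  - by rewrite c0.
  - by move: sv; rewrite /sd /dt /dif /=; lra.
  - by move: sw; rewrite /sd /dt /dif /=; lra.
  - by case: rv => + _; rewrite /sd /dt /dif /=; lra.
  - by case: rv => _ /(_ I1) /(_ (fun E => match E with end)); rewrite /sd /dt /dif /=; lra.
  - by case: rw => + _; rewrite /sd /dt /dif /=; lra.
  - by case: rw => _ /(_ I0) /(_ (fun E => match E with end)); rewrite /sd /dt /dif /=; lra.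
  apply: (nc s t hs ht); rewrite /mv /dif /=; congr (_, _) => //.
  by rewrite !subr0 !add0r.
have T21 : j = I2 -> j' = I1 -> False.
  move=> Ej Ej'; subst j j'.
  have n0 := (top_sees c aT hT tT).2 sw.
  have c0 := cr_nrm T I1; rewrite /= /cr in c0.
  have wy := rel_side_gt0 aT hT tT (i := I2) (fun E => match E with end) rw.
  have n0' : - (nrm T I2).1 < 0 by rewrite oppr_lt0.
  have cc' : - c' < - c by rewrite ltrN2.
  (* Reflection in the vertical axis exchanges the two segments and reduces this case to the
     previous one. *)
  have [|||||||s [t [hs ht e1 e2]]] := @cross_scalar (- (nrm T I2).1) (nrm T I2).2
    (dt (nrm T I2) (T I2)) (- (nrm T I1).1) (nrm T I1).2 (dt (nrm T I1) (T I1))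
    (- c') (- c) (- v.1) v.2 (- w.1) w.2 n0' _ cc' _ _ _ _ _ _ wy v0.
  - by move: aT; rewrite -c0; lra.
  - by move: sw; rewrite /sd /dt /dif /=; lra.
  - by move: sv; rewrite /sd /dt /dif /=; lra.
  - by case: rw => + _; rewrite /sd /dt /dif /=; lra.
  - by case: rw => _ /(_ I1) /(_ (fun E => match E with end)); rewrite /sd /dt /dif /=; lra.
  - by case: rv => + _; rewrite /sd /dt /dif /=; lra.
  - by case: rv => _ /(_ I2) /(_ (fun E => match E with end)); rewrite /sd /dt /dif /=; lra.
  apply: (nc t s ht hs); rewrite /mv /dif /=; congr (_, _); last by rewrite !subr0 !add0r.
  lra.
have T20 : j = I2 -> j' = I0 -> False.
  move=> Ej Ej'; subst j j'.
  have n0 := (top_sees c aT hT tT).2 sw.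
  have n1 := (top_sees c' aT hT tT).1 sv.
  have c0 := cr_nrm T I2; rewrite /= /cr in c0.
  have e1 : sd T I0 (c', 0) = (nrm T I0).1 * (c' - (T I0).1) - (nrm T I0).2 * (T I0).2.
    by rewrite /sd /dt /dif /=; ring.
  have e2 : sd T I2 (c, 0) = (nrm T I2).1 * (c - (T I0).1) - (nrm T I2).2 * (T I0).2.
    by rewrite /sd /dt /dif /nrm /=; ring.
  have : 0 <= (nrm T I2).1 * sd T I0 (c', 0) - (nrm T I0).1 * sd T I2 (c, 0).
    by have := mulr_ge0 (ltW n0) sv; have := mulr_le0_ge0 (ltW n1) sw; lra.
  have -> : (nrm T I2).1 * sd T I0 (c', 0) - (nrm T I0).1 * sd T I2 (c, 0) =
    (nrm T I2).1 * (nrm T I0).1 * (c' - c) - (T I0).2 * ar T by rewrite e1 e2 -c0; ring.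
  have : 0 < (T I0).2 * ar T by rewrite mulr_gt0.
  have : (nrm T I2).1 * (nrm T I0).1 * (c' - c) < 0.
    by rewrite nmulr_rlt0 ?subr_gt0 // pmulr_rlt0.
  lra.
by move: T10 T21 T20; case: (j); case: (j') => // a1 a2 a3; exfalso;
  [apply: a1|apply: a3|apply: a2].
Qed.

End Order.

Section Comparison.
Variable R : realFieldType.
Implicit Types (p q u v g x w z : R * R) (s t e : R) (i j a b l : idx).
Implicit Types T X Y A B C : tri R.

(** A half turn keeps the orientation and hence the values of [sd]; it turns a triangle below the
    axis into one above it and exchanges left and right. *)
Definition opp T : tri R := fun i => (- (T i).1, - (T i).2).
Definition np p : R * R := (- p.1, - p.2).

Lemma sd_opp T i p : sd (opp T) i (np p) = sd T i p.
Proof. rewrite /sd /dt /dif /nrm /opp /np /=; ring. Qed.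

Lemma rel_opp_tri T i p : relint T i p -> relint (opp T) i (np p).
Proof. by move=> [h0 h]; split=> [|k hk]; rewrite sd_opp ?h0 //; apply: h. Qed.

Lemma ar_opp T : ar (opp T) = ar T.
Proof. rewrite /ar /cr /dif /opp /=; ring. Qed.

Definition botT T := topped (opp T) /\ above (opp T).
Definition topT T := topped T /\ above T.

Lemma bot_inn T p : 0 < ar T -> botT T -> inn T p -> p.2 <= 0.
Proof.
move=> aT [_ hT] hp; rewrite -oppr_ge0.
have -> : - p.2 = (np p).2 by [].
apply: (above_inn (T := opp T)) => //; first by rewrite ar_opp.
by move=> i; rewrite sd_opp.
Qed.

(** In [bary] the three products have the same sign, so each of them vanishes at height 0, and both
    corners of the side [i] lie on the axis. *)
Lemma axis_nrm T i p : 0 < ar T -> above T -> relint T i p -> p.2 = 0 ->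
  (nrm T i).1 = 0.
Proof.
move=> aT hT hr p0; have := bary T p; rewrite p0 mulr0 => /esym/eqP.
rewrite oppr_eq0 => /eqP; have hi := rel_inn hr; have [h0 h] := hr.
have k i1 i2 : sd T i1 p * (T i2).2 <= 0 by rewrite mulr_le0_ge0.
have k1 := k I1 I0; have k2 := k I2 I1; have k3 := k I0 I2 => e.
have z i1 i2 : i1 <> i -> sd T i1 p * (T i2).2 = 0 -> (T i2).2 = 0.
  by move=> /h hn /eqP; rewrite mulf_eq0 lt_eqF //= => /eqP.
have e1 : sd T I1 p * (T I0).2 = 0 by lra.
have e2 : sd T I2 p * (T I1).2 = 0 by lra.
have e3 : sd T I0 p * (T I2).2 = 0 by lra.
have y0 : I1 <> i -> (T I0).2 = 0 by move=> /z; apply; exact: e1.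
have y1 : I2 <> i -> (T I1).2 = 0 by move=> /z; apply; exact: e2.
have y2 : I0 <> i -> (T I2).2 = 0 by move=> /z; apply; exact: e3.
rewrite /nrm /=; case: i y0 y1 y2 {z h0 h hr} => /= y0 y1 y2.
- by rewrite y0 // y1 // subrr.
- by rewrite y1 // y2 // subrr.
- by rewrite y0 // y2 // subrr.
Qed.

Lemma nrm_opp T i : nrm (opp T) i = np (nrm T i).
Proof. by rewrite /nrm /opp /np /=; congr (_, _); ring. Qed.

(** Otherwise both touched sides lie in the axis, so [C] meets them with a single side, and [X] and
    [Y] would be on the same side of the axis. *)
Lemma cn_rise X Y C i j a b x w : 0 < ar X -> 0 < ar Y -> 0 < ar C ->
  botT X -> topT Y -> cn X Y C i j a b x w -> x.2 <= 0 /\ 0 <= w.2 /\ x.2 < w.2.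
Proof.
move=> aX aY aC bX [tY hY] [h1 h2].
have [x0 xa _] := h1; have [w0 wb _] := h2.
have xle := bot_inn aX bX (rel_inn x0).
have wge := above_inn aY hY (rel_inn w0).
split=> //; split=> //; rewrite lt_neqAle (le_trans xle wge) andbT; apply/eqP => e.
have xz : x.2 = 0 by lra.
have wz : w.2 = 0 by lra.
have nX : (nrm X i).1 = 0.
  have := @axis_nrm (opp X) i (np x); rewrite ar_opp nrm_opp /= xz oppr0.
  move=> /(_ aX bX.2 (rel_opp_tri x0) erefl) /eqP.
  by rewrite oppr_eq0 => /eqP.
have nY := axis_nrm aY hY w0 wz.
have [x0e _] := x0; have [w0e _] := w0.
have sXw : sd X i w = 0.
  have := dt_dif X i x w; rewrite x0e subr0 => <-.
  by rewrite /dt nX /dif /= wz xz; ring.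
have ab : a = b.
  case: (idx_dec a b) => // ab.
  have : 0 < sd X i w by apply: (nbr_pos h1); case: wb => _; apply.
  by rewrite sXw ltxx.
rewrite -ab in h2; have [m m0 hm] := flat_same h1 h2.
have [n1 n2] := prp_nrm hm.
have gX := nrm2_gt0 i aX; rewrite /dt nX in gX.
have [g hg] := inn_has_int aX; have [f hf] := inn_has_int aY.
have g2 := bot_inn aX bX (int_inn hg); have f2 := above_inn aY hY (int_inn hf).
have e1 := dt_dif X i x g; have e2 := dt_dif Y j w f.
rewrite /dt nX nY n2 x0e w0e /dif /= xz wz in e1 e2; have := hg i; have := hf j => k1 k2.
have k3 : (nrm X i).2 * g.2 < 0 by move: e1; rewrite !subr0 mul0r add0r => ->.
have k4 : m * (nrm X i).2 * f.2 < 0 by move: e2; rewrite !subr0 mul0r add0r => ->.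
have n0 : 0 <= (nrm X i).2.
  by rewrite leNgt; apply/negP => n0; have := mulr_le0 (ltW n0) g2; lra.
by have := mulr_ge0 (mulr_ge0 (ltW m0) n0) f2; lra.
Qed.

(* Where the segment between the two contact points meets the axis. *)
Definition axis x w : R := x.1 - x.2 / (w.2 - x.2) * (w.1 - x.1).

Lemma axisP x w : x.2 <= 0 -> 0 <= w.2 -> x.2 < w.2 ->
  exists2 k, 0 <= k <= 1 & (axis x w, 0) = mv x (dif w x) k.
Proof.
move=> h1 h2 h3; have d0 : 0 < w.2 - x.2 by rewrite subr_gt0.
exists (- x.2 / (w.2 - x.2)).
  apply/andP; split; first by apply: divr_ge0; lra.
  by rewrite ler_pdivrMr //; lra.
rewrite /axis /mv /dif /=; congr (_, _); first by ring.
by rewrite divfK ?gt_eqF // subrr.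
Qed.

(** [sides_ordered] is applied to the parts of the contact segments above the axis for [Y], and to
    the parts below it, after a half turn, for [X]; the half turn reverses the inequality between
    [i] and [i']. *)
Lemma cn_order X Y C C' i j a b x w i' j' a' b' x' w' :
  0 < ar X -> 0 < ar Y -> 0 < ar C -> 0 < ar C' -> botT X -> topT Y ->
  cn X Y C i j a b x w -> cn X Y C' i' j' a' b' x' w' ->
  (forall s t, 0 <= s <= 1 -> 0 <= t <= 1 ->
    mv x (dif w x) s <> mv x' (dif w' x') t) ->
  axis x w < axis x' w' -> (rk j <= rk j')%N /\ (rk i' <= rk i)%N.
Proof.
move=> aX aY aC aC' bX tY h h' nc cc.
have [x0 [w0 xw]] := cn_rise aX aY aC bX tY h.
have [x0' [w0' xw']] := cn_rise aX aY aC' bX tY h'.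
have [k hk e] := axisP x0 w0 xw; have [k' hk' e'] := axisP x0' w0' xw'.
set c := axis x w in cc e; set c' := axis x' w' in cc e'.
have [[hx1 hx2 hx3] [hw1 hw2 hw3]] := h; have [[hx1' hx2' hx3'] [hw1' hw2' hw3']] := h'.
have inC : inn C (c, 0) by rewrite e; apply: inn_seg => //; apply: rel_inn; eauto.
have inC' : inn C' (c', 0) by rewrite e'; apply: inn_seg => //; apply: rel_inn; eauto.
have [/(nbr_out (q := (c, 0))) o1 /(nbr_out (q := (c, 0))) o2] := h.
have [/(nbr_out (q := (c', 0))) o1' /(nbr_out (q := (c', 0))) o2'] := h'.
have sub1 (y y' : R * R) k0 s (d : R) : (d, 0) = mv y (dif y' y) k0 ->
    mv (d, 0) (dif y' (d, 0)) s = mv y (dif y' y) (k0 + s * (1 - k0)).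
  by case=> E1 E2; rewrite /mv /dif /= E1 {1 2}E2; congr (_, _); ring.
have sub2 (y y' : R * R) k0 s (d : R) : (d, 0) = mv y (dif y' y) k0 ->
    mv (d, 0) (dif y (d, 0)) s = mv y (dif y' y) (k0 * (1 - s)).
  by case=> E1 E2; rewrite /mv /dif /= E1 {1 2}E2; congr (_, _); ring.
split.
  apply: (sides_ordered aY tY.2 tY.1 cc hw1 hw1' (o2 (inC _)) (o2' (inC' _))).
  move=> s t hs ht; rewrite (sub1 _ _ _ _ _ e) (sub1 _ _ _ _ _ e').
  by apply: nc; apply/andP; split; nra.
have cc' : - c' < - c by rewrite ltrN2.
have aX' : 0 < ar (opp X) by rewrite ar_opp.
have E d : (- d, 0) = np (d, 0) by rewrite /np /= oppr0.
have EE (y : R * R) d s : mv (- d, 0) (dif (np y) (- d, 0)) s = np (mv (d, 0) (dif y (d, 0)) s).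
  by rewrite /np /mv /dif /=; congr (_, _); ring.
have := sides_ordered aX' bX.2 bX.1 cc' (rel_opp_tri hx1') (rel_opp_tri hx1).
rewrite !E !sd_opp; apply.
- exact: o1' (inC' _).
- exact: o1 (inC _).
move=> s t hs ht; rewrite -!E !EE => /(congr1 np).
have npK (y : R * R) : np (np y) = y by rewrite /np /= !opprK; case: y.
rewrite !npK (sub2 _ _ _ _ _ e) (sub2 _ _ _ _ _ e') => /esym.
by apply: nc; apply/andP; split; nra.
Qed.

Lemma cn_comparable X Y C C' i j a b x w i' j' a' b' x' w' :
  0 < ar X -> 0 < ar Y -> 0 < ar C -> 0 < ar C' -> botT X -> topT Y ->
  disj X C -> disj Y C -> disj X C' -> disj Y C' -> disj C C' -> disj C' C ->
  cn X Y C i j a b x w -> cn X Y C' i' j' a' b' x' w' -> a <> b \/ a' <> b' ->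
  (rk j <= rk j')%N /\ (rk i' <= rk i)%N \/ (rk j' <= rk j)%N /\ (rk i <= rk i')%N.
Proof.
move=> aX aY aC aC' bX tY d1 d2 d3 d4 d5 d6 h h' nf.
have [[hx1 hx2 hx3] [hw1 hw2 hw3]] := h; have [[hx1' hx2' hx3'] [hw1' hw2' hw3']] := h'.
have nc s t : 0 <= s <= 1 -> 0 <= t <= 1 -> mv x (dif w x) s <> mv x' (dif w' x') t.
  move=> hs ht E; case: nf => nf.
    apply: (noncross aX aY aC aC' d1 d2 d3 d4 d5 h nf hs).
    by rewrite E; apply: inn_seg => //; apply: rel_inn; eauto.
  apply: (noncross aX aY aC' aC d3 d4 d1 d2 d6 h' nf ht).
  by rewrite -E; apply: inn_seg => //; apply: rel_inn; eauto.
case: (ltrgtP (axis x w) (axis x' w')) => cc.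
- by left; apply: (cn_order aX aY aC aC' bX tY h h').
- right; apply: (cn_order aX aY aC' aC bX tY h' h _ cc) => s t hs ht /esym.
  exact: nc.
have [x0 [w0 xw]] := cn_rise aX aY aC bX tY h.
have [x0' [w0' xw']] := cn_rise aX aY aC' bX tY h'.
have [k hk e] := axisP x0 w0 xw; have [k' hk' e'] := axisP x0' w0' xw'.
by exfalso; apply: (nc k k' hk hk'); rewrite -e -e' cc.
Qed.

End Comparison.

(** * Angles of the normals *)

Section Angle.
Variable R : realType.
Implicit Types (u v : R * R) (U V x : R).

(* [V] is an angle of [v], measured counterclockwise from [(0, 1)]; angles are
   only determined up to multiples of [2 * pi]. *)
Definition lift v V := exists r, [/\ 0 < r, v.1 = - (r * sin V) & v.2 = r * cos V].

Lemma lift_cr u v U V : lift u U -> lift v V ->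
  exists2 r, 0 < r & cr u v = r * sin (V - U).
Proof.
move=> [r [r0 h1 h2]] [s [s0 h3 h4]]; exists (r * s); first exact: mulr_gt0.
by rewrite sinB /cr h1 h2 h3 h4; ring.
Qed.

Lemma cmp3 x U : [\/ x < U, U < x | x = U].
Proof. by case: (ltrgtP x U); [constructor 1|constructor 2|constructor 3]. Qed.

Lemma sin_lt0_2pi x : pi < x < 2 * pi -> sin x < 0.
Proof.
move=> /andP[h1 h2]; have -> : x = (x - pi) + pi by ring.
by rewrite sinDpi oppr_lt0 sin_gt0_pi // subr_gt0 h1 /=; lra.
Qed.

Lemma sin_gt0E x : - (2 * pi) <= x <= 2 * pi -> 0 < sin x ->
  0 < x < pi \/ - (2 * pi) < x < - pi.
Proof.
move=> /andP[h1 h2] h; have p0 := pi_gt0 R.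
have s0 : sin (0 : R) = 0 := sin0 R.
have sp : sin (pi : R) = 0 := sinpi R.
have s2p : sin (2 * pi : R) = 0.
  by rewrite mulr_natl; exact: sin2pi.
case: (cmp3 x 0) => x0; last by move: h; rewrite x0 s0; lra.
  right; case: (cmp3 x (- (2 * pi))) => y; first lra.
    case: (cmp3 x (- pi)) => z; first lra.
      by have := @sin_gt0_pi R (- x); rewrite sinN => H; have : 0 < - sin x by [apply: H; lra]; lra.
    by move: h; rewrite z sinN sp; lra.
  by move: h; rewrite y sinN s2p; lra.
left; case: (cmp3 x pi) => y; first lra.
  case: (cmp3 x (2 * pi)) => z; [|lra|by move: h; rewrite z s2p; lra].
  by have : sin x < 0 by [apply: sin_lt0_2pi; lra]; lra.
by move: h; rewrite y sp; lra.
Qed.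

Lemma lift_gt0 u v U V : lift u U -> lift v V -> - (2 * pi) <= V - U <= 2 * pi ->
  0 < cr u v -> 0 < V - U < pi \/ - (2 * pi) < V - U < - pi.
Proof.
move=> hu hv r; have [a a0 ->] := lift_cr hu hv.
by rewrite pmulr_rgt0 //; apply: sin_gt0E.
Qed.

Lemma crC u v : cr u v = - cr v u. Proof. rewrite /cr; ring. Qed.

Lemma lift_lt0 u v U V : lift u U -> lift v V -> - (2 * pi) <= V - U <= 2 * pi ->
  cr u v < 0 -> - pi < V - U < 0 \/ pi < V - U < 2 * pi.
Proof.
move=> hu hv r; rewrite crC oppr_lt0 => h.
have r' : - (2 * pi) <= U - V <= 2 * pi by lra.
by case: (lift_gt0 hv hu r' h) => ?; [left; lra|right; lra].
Qed.

Lemma cr_lift_gt0 u v U V : lift u U -> lift v V -> 0 < V - U < pi -> 0 < cr u v.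
Proof.
move=> hu hv r; have [a a0 ->] := lift_cr hu hv.
by rewrite pmulr_rgt0 //; apply: sin_gt0_pi.
Qed.

Lemma cr_lift_lt0 u v U V : lift u U -> lift v V -> pi < V - U < 2 * pi -> cr u v < 0.
Proof.
move=> hu hv r; have [a a0 ->] := lift_cr hu hv.
by rewrite pmulr_rlt0 //; apply: sin_lt0_2pi.
Qed.

Lemma lift_scale u v U k : 0 < k -> v.1 = k * u.1 /\ v.2 = k * u.2 ->
  lift u U -> lift v U.
Proof.
move=> k0 [h1 h2] [r [r0 h3 h4]]; exists (k * r).
by split; [apply: mulr_gt0|rewrite h1 h3; ring|rewrite h2 h4; ring].
Qed.

Lemma lift_opp u v U k : k < 0 -> v.1 = k * u.1 /\ v.2 = k * u.2 ->
  lift u U -> lift v (U + pi).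
Proof.
move=> k0 [h1 h2] [r [r0 h3 h4]]; exists (- k * r).
split; [by apply: mulr_gt0 => //; rewrite oppr_gt0| |];
  by rewrite ?sinDpi ?cosDpi ?h1 ?h2 ?h3 ?h4; ring.
Qed.

Lemma lift_2pi u U : lift u U -> lift u (U + 2 * pi).
Proof.
move=> h.
have h1 : lift (- u.1, - u.2) (U + pi).
  by apply: (lift_opp (k := -1) _ _ h); rewrite ?ltrN10 //=; split; ring.
have -> : U + 2 * pi = U + pi + pi by ring.
by apply: (lift_opp (k := -1) _ _ h1); rewrite ?ltrN10 //=; split; ring.
Qed.

Lemma lift_uniq u U V : lift u U -> lift u V -> - (2 * pi) <= V - U <= 2 * pi ->
  [\/ V = U, V = U + 2 * pi | V = U - 2 * pi].
Proof.
move=> [r [r0 h1 h2]] [s [s0 h3 h4]] hr.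
have p0 := pi_gt0 R.
have hs : r * s * sin (V - U) = 0.
  rewrite sinB.
  have -> : r * s * (sin V * cos U - cos V * sin U) =
            - (- (s * sin V)) * (r * cos U) + (s * cos V) * - (r * sin U) by ring.
  by rewrite -h1 -h2 -h3 -h4; ring.
have hc : 0 < cos (V - U).
  have : 0 < r * s * cos (V - U).
    rewrite cosB.
    have -> : r * s * (cos V * cos U + sin V * sin U) =
            (- (s * sin V)) * (- (r * sin U)) + (s * cos V) * (r * cos U) by ring.
    rewrite -h1 -h2 -h3 -h4.
    have e : u.1 * u.1 + u.2 * u.2 = r * r.
      rewrite h1 h2; have := cos2Dsin2 U; rewrite !expr2 => e.
      by rewrite -[RHS]mulr1 -e; ring.
    by rewrite e mulr_gt0.
  by rewrite pmulr_rgt0 // mulr_gt0.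
have s00 : sin (V - U) = 0.
  by move/eqP: hs; rewrite mulf_eq0 gt_eqF ?mulr_gt0 //= => /eqP.
set x := V - U in hr s00 hc.
suff : [\/ x = 0, x = 2 * pi | x = - (2 * pi)].
  by case=> e; rewrite /x in e; [constructor 1|constructor 2|constructor 3]; lra.
have cp : cos (pi : R) = -1 := cospi R.
case: (cmp3 x 0) => x0; last by constructor 1.
  constructor 3; case: (cmp3 x (- pi)) => y.
  - case: (cmp3 x (- (2 * pi))) => z //; first lra.
    by have := @sin_lt0_2pi (- x); rewrite sinN s00 oppr0 => H;
      suff : 0 < 0 :> R by [rewrite ltxx]; apply: H; lra.
  - by have := @sin_gt0_pi R (- x); rewrite sinN s00 oppr0 => H;
      suff : 0 < 0 :> R by [rewrite ltxx]; apply: H; lra.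
  - by move: hc; rewrite y cosN cp; lra.
constructor 2; case: (cmp3 x pi) => y.
- by have := @sin_gt0_pi R x; rewrite s00 => H;
      suff : 0 < 0 :> R by [rewrite ltxx]; apply: H; lra.
- case: (cmp3 x (2 * pi)) => z //; last lra.
  by have := @sin_lt0_2pi x; rewrite s00 => H;
      suff : 0 < 0 :> R by [rewrite ltxx]; apply: H; lra.
- by move: hc; rewrite y cp; lra.
Qed.

Lemma lift_uniq4 u U V : lift u U -> lift u V -> - (4 * pi) <= V - U <= 4 * pi ->
  [\/ V = U, V = U + 2 * pi | V = U - 2 * pi] \/ V = U + 4 * pi \/ V = U - 4 * pi.
Proof.
move=> hU hV hr; have p0 := pi_gt0 R.
have [h|h] := lerP (V - U) (2 * pi).
  have [h'|h'] := lerP (- (2 * pi)) (V - U).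
    by left; apply: (lift_uniq hU hV); lra.
  have hr' : - (2 * pi) <= V + 2 * pi - U <= 2 * pi by lra.
  have [] := lift_uniq hU (lift_2pi hV) hr'.
  - by move=> e; left; constructor 3; lra.
  - by move=> e; exfalso; lra.
  - by move=> e; right; right; lra.
have hr' : - (2 * pi) <= V - (U + 2 * pi) <= 2 * pi by lra.
have [] := lift_uniq (lift_2pi hU) hV hr'.
- by move=> e; left; constructor 2; lra.
- by move=> e; right; left; lra.
- by move=> e; exfalso; lra.
Qed.

Lemma lift_ex0 v : v.1 != 0 \/ v.2 != 0 -> exists2 V, 0 <= V < 2 * pi & lift v V.
Proof.
move=> h; have p0 := pi_gt0 R.
set q := v.1 * v.1 + v.2 * v.2.
have q0 : 0 < q.
  rewrite /q -!expr2; case: h => h.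
    by rewrite ltr_pwDl ?sqr_ge0 // lt_def sqr_ge0 sqrf_eq0 h.
  by rewrite ltr_pwDr ?sqr_ge0 // lt_def sqr_ge0 sqrf_eq0 h.
set r := Num.sqrt q.
have r0 : 0 < r by rewrite sqrtr_gt0.
have rr : r * r = q by rewrite -expr2 sqr_sqrtr // ltW.
set c := v.2 / r.
have hc : v.2 = r * c by rewrite /c mulrC divfK ?gt_eqF.
have c2 : c * c <= 1.
  rewrite -(ler_pM2l q0) mulr1 -rr.
  have -> : r * r * (c * c) = (r * c) * (r * c) by ring.
  by rewrite -hc rr /q; have := sqr_ge0 v.1; rewrite expr2; lra.
have c1 : -1 <= c <= 1 by apply/andP; split; nra.
have hs : r * sin (acos c) = `|v.1|.
  rewrite sin_acos //.
  have -> : `|v.1| = Num.sqrt (v.1 * v.1) by rewrite -expr2 sqrtr_sqr.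
  rewrite /r -sqrtrM ?(ltW q0) //; congr Num.sqrt.
  rewrite mulrBr mulr1 expr2 -{2}rr.
  have -> : r * r * (c * c) = (r * c) * (r * c) by ring.
  by rewrite -hc /q; ring.
have a0 := acos_ge0 c1; have a1 := acos_lepi c1.
have ca : cos (acos c) = c by rewrite acosK // in_itv.
have [x0|x0] := lerP v.1 0.
  exists (acos c); first lra.
  by exists r; split; rewrite ?hs ?ca ?ler0_norm ?opprK.
exists (2 * pi - acos c); last first.
  have e1 : sin (2 * pi - acos c) = - sin (acos c).
    have -> : 2 * pi - acos c = - acos c + pi *+ 2 by rewrite -[pi *+ 2]mulr_natl; ring.
    by rewrite (sinD2pi) sinN.
  have e2 : cos (2 * pi - acos c) = cos (acos c).
    have -> : 2 * pi - acos c = - acos c + pi *+ 2 by rewrite -[pi *+ 2]mulr_natl; ring.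
    by rewrite (cosD2pi) cosN.
  exists r; split; rewrite ?e1 ?e2 ?ca // mulrN opprK hs.
  by rewrite gtr0_norm.
apply/andP; split; first lra.
suff : 0 < acos c by lra.
rewrite lt_def a0 andbT; apply/eqP => e.
by move: hs; rewrite e sin0 mulr0 gtr0_norm //; lra.
Qed.

Lemma lift_ex u U v : lift u U -> v.1 != 0 \/ v.2 != 0 ->
  exists2 V, U <= V < U + 2 * pi & lift v V.
Proof.
move=> [r [r0 h1 h2]] hv.
have cs := cos2Dsin2 U; rewrite !expr2 in cs.
pose w : R * R := (v.1 * cos U + v.2 * sin U, v.2 * cos U - v.1 * sin U).
have e1 : v.1 = w.1 * cos U - w.2 * sin U.
  by rewrite /w /= -[LHS]mulr1 -cs; ring.
have e2 : v.2 = w.2 * cos U + w.1 * sin U.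
  by rewrite /w /= -[LHS]mulr1 -cs; ring.
have [|W hW [s [s0 k1 k2]]] := @lift_ex0 w.
  case: (eqVneq w.1 0) => [a|]; last by left.
  case: (eqVneq w.2 0) => [b|]; last by right.
  by move: hv; rewrite e1 e2 a b !mul0r subrr addr0 eqxx => -[].
exists (U + W); first lra.
by exists s; split=> //; rewrite ?e1 ?e2 k1 k2 ?sinD ?cosD; ring.
Qed.

Lemma cone_lift (u v r : R * R) U V s t : lift u U -> lift v V -> U < V < U + pi ->
  0 < s -> 0 < t -> r.1 = s * u.1 + t * v.1 -> r.2 = s * u.2 + t * v.2 ->
  exists2 W, U < W < V & lift r W.
Proof.
move=> hu hv h s0 t0 e1 e2; have p0 := pi_gt0 R.
have c0 : 0 < cr u v by apply: cr_lift_gt0 hu hv _; lra.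
have c1 : 0 < cr u r.
  have -> : cr u r = t * cr u v by rewrite /cr e1 e2; ring.
  exact: mulr_gt0.
have c2 : 0 < cr r v.
  have -> : cr r v = s * cr u v by rewrite /cr e1 e2; ring.
  exact: mulr_gt0.
have [|W hW hr] := @lift_ex u U r hu.
  case: (eqVneq r.1 0) => [z1|]; last by left.
  case: (eqVneq r.2 0) => [z2|]; last by right.
  by move: c1; rewrite /cr z1 z2; lra.
exists W => //.
have w1 : 0 < W - U < pi by case: (lift_gt0 hu hr _ c1); lra.
by case: (lift_gt0 hr hv _ c2); lra.
Qed.

Lemma nrm_neq0 (T : tri R) i : 0 < ar T -> (nrm T i).1 != 0 \/ (nrm T i).2 != 0.
Proof.
rewrite -(cr_nrm T i) /cr; case: (eqVneq (nrm T i).1 0) => [->|]; last by left.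
by case: (eqVneq (nrm T i).2 0) => [->|]; [rewrite !mul0r subrr ltxx|right].
Qed.

(** Angles start at the upward vertical. The side [I0] descends from the apex, so its normal does
    not point to the right and [N I0] is less than pi; from each side to the next the normal turns
    by less than pi, and [N I2] does not pass 2 pi because the normal of [I2] does not point to the
    left. *)
Lemma tri_lifts (T : tri R) : 0 < ar T -> topped T -> exists N : idx -> R,
  [/\ forall i, lift (nrm T i) (N i),
      0 <= N I0, N I0 < N I1 < N I0 + pi, N I1 < N I2 < N I1 + pi
    & N I0 + pi < N I2 <= 2 * pi].
Proof.
move=> aT [t1 t2]; have p0 := pi_gt0 R.
have [N0 hN0 l0] := lift_ex0 (nrm_neq0 I0 aT).
have N0p : N0 < pi.
  rewrite ltNge; apply/negP => h.
  have [r [r0 k1 k2]] := l0.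
  have s0 : sin N0 <= 0.
    case: (ltrgtP pi N0) => [e|e|<-]; [|lra|by rewrite sinpi].
    by apply/ltW/sin_lt0_2pi; lra.
  have x0 : (nrm T I0).1 = 0.
    apply/eqP; rewrite eq_le k1 -{1}k1 {1}/nrm /= subr_le0 t1 /=.
    by rewrite oppr_ge0 pmulr_rle0.
  have : N0 = pi.
    apply/eqP; rewrite eq_le h andbT leNgt; apply/negP => e.
    have sN : sin N0 < 0 by apply: sin_lt0_2pi; lra.
    by move: k1; rewrite x0; nra.
  move=> e; move: k2; rewrite e cospi mulrN1 => k2.
  move: aT x0 k2; rewrite /ar /cr /dif /nrm /=; nra.
have [N1 hN1 l1] := lift_ex l0 (nrm_neq0 I1 aT).
have [N2 hN2 l2] := lift_ex l1 (nrm_neq0 I2 aT).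
have c0 := cr_nrm T I0; have c1 := cr_nrm T I1; have c2 := cr_nrm T I2.
have g0 : 0 < N1 - N0 < pi.
  by case: (lift_gt0 l0 l1 _ _); rewrite ?[cr _ _]c0 //; lra.
have g1 : 0 < N2 - N1 < pi.
  by case: (lift_gt0 l1 l2 _ _); rewrite ?[cr _ _]c1 //; lra.
have g2 : N0 + pi < N2.
  by case: (lift_gt0 l2 l0 _ _); rewrite ?[cr _ _]c2 //; lra.
exists (fun i => match i with I0 => N0 | I1 => N1 | I2 => N2 end).
split=> //; try (case=> //); try lra.
apply/andP; split=> //; rewrite leNgt; apply/negP => h.
have [r [r0 k1 k2]] := l2.
have : 0 < sin N2.
  have -> : N2 = (N2 - 2 * pi) + pi *+ 2 by rewrite -[pi *+ 2]mulr_natl; ring.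
  rewrite sinD2pi; apply: sin_gt0_pi; lra.
move=> s0; have : 0 < r * sin N2 by rewrite mulr_gt0.
by move: k1; rewrite /nrm /=; lra.
Qed.

End Angle.

Section Lifts.
Variable R : realType.
Implicit Types (p q u v g x w z : R * R) (s t : R) (i j a b l : idx).
Implicit Types T X Y A B C : tri R.

(** What is kept of the normals of a triangle once the numbering is dropped. No two are opposite,
    and since they do not lie in a half-plane, the outer two of three angles in increasing order are
    more than pi apart. *)
Definition spread (N : idx -> R) := [/\ forall i j, N i - N j <> pi,
  forall i j, N i - N j < 2 * pi, forall i j, N i = N j -> i = j
  & forall i j k, N i < N j -> N j < N k -> N i + pi < N k].

Lemma top_lifts T : 0 < ar T -> topT T -> exists N, [/\ forall i, lift (nrm T i) (N i),
  spread N, forall i, 0 <= N i <= 2 * pi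
  & forall i j, (rk i <= rk j)%N -> N i <= N j].
Proof.
move=> aT [tT _]; have p0 := pi_gt0 R.
have [N [hN h0 h1 h2 h3]] := tri_lifts aT tT; exists N; split=> //.
- split.
  + by case; case; lra.
  + by case; case; lra.
  + by case; case=> // e; exfalso; lra.
  + by case; case; case; lra.
- by case; lra.
- by case; case=> // _; lra.
Qed.

Lemma bot_lifts T : 0 < ar T -> botT T -> exists M, [/\ forall i, lift (nrm T i) (M i),
  spread M, forall i, pi <= M i <= 3 * pi
  & forall i j, (rk i <= rk j)%N -> M i <= M j].
Proof.
move=> aT bT; have p0 := pi_gt0 R; rewrite -(ar_opp T) in aT.
have [N [hN [s1 s2 s3 s4] h0 h1]] := top_lifts aT bT.
exists (fun i => N i + pi); split.
- move=> i; apply: (lift_opp (k := -1) _ _ (hN i)); first by rewrite ltrN10.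
  by rewrite nrm_opp /np /=; split; ring.
- split.
  + by move=> i j; have := s1 i j; lra.
  + by move=> i j; have := s2 i j; lra.
  + by move=> i j e; apply: s3; lra.
  + by move=> i j k h h'; have := s4 i j k; lra.
- by move=> i; have := h0 i; lra.
- by move=> i j /h1; lra.
Qed.

(** If [C] is not flat, the vector from [x] to [w] rises, so its quarter turn [e] has an angle [E]
    between 0 and pi. This vector has a negative scalar product with the normal of [Y] and a
    positive one with that of [X]: [N] lies in the half turn after [E], and [M] in the half turn
    after [E + pi]. The value [N + pi] would make two sides of [C] parallel. *)
Lemma cn_lifts X Y C i j a b x w (N M : R) : 0 < ar X -> 0 < ar Y -> 0 < ar C ->
  botT X -> topT Y -> cn X Y C i j a b x w -> lift (nrm Y j) N -> lift (nrm X i) M ->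
  0 <= N <= 2 * pi -> pi <= M <= 3 * pi ->
  (a = b /\ (M = N \/ M = N + 2 * pi)) \/
  (a <> b /\ N < M < N + 2 * pi /\ M <> N + pi).
Proof.
move=> aX aY aC bX tY h lN lM rN rM; have p0 := pi_gt0 R.
have [h1 h2] := h; have [[x0 xo] [xa xb] _] := h1; have [[w0 wo] [wa wb] _] := h2.
case: (idx_dec a b) => ab; [left|right]; split=> //.
  rewrite -ab in h2; have [m m0 hm] := flat_same h1 h2.
  have lN' := lift_scale m0 (prp_nrm hm) lM.
  case: (lerP (M - N) (2 * pi)) => e.
    have r : - (2 * pi) <= M - N <= 2 * pi by lra.
    by case: (lift_uniq lN lN' r) => E; [left|right|exfalso; lra].
  have r : - (2 * pi) <= M - (N + 2 * pi) <= 2 * pi by lra.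
  by case: (lift_uniq (lift_2pi lN) lN' r) => E; [right|exfalso; lra|exfalso; lra].
have [xl [wl xw]] := cn_rise aX aY aC bX tY h.
pose e : R * R := (- (w.2 - x.2), w.1 - x.1).
have [|E hE lE] := @lift_ex0 R e; first by left; rewrite /= oppr_eq0 subr_eq0 gt_eqF.
have Ep : 0 < E < pi.
  have [r [r0 e1 _]] := lE; have se : 0 < sin E.
    have : 0 < r * sin E by move: e1; rewrite /e /=; lra.
    by rewrite pmulr_rgt0.
  by case: (@sin_gt0E R E _ se); lra.
have sxw : 0 < sd X i w by apply: (nbr_pos h1); apply: wb.
have syx : 0 < sd Y j x by apply: (nbr_pos h2); apply: xb => E'; apply: ab.
have c1 : 0 < cr e (nrm Y j).
  have := dt_dif Y j x w; rewrite w0 => d.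
  have -> : cr e (nrm Y j) = - dt (nrm Y j) (dif w x) by rewrite /cr /dt /dif /=; ring.
  by rewrite d; lra.
have c2 : cr e (nrm X i) < 0.
  have := dt_dif X i x w; rewrite x0 => d.
  have -> : cr e (nrm X i) = - dt (nrm X i) (dif w x) by rewrite /cr /dt /dif /=; ring.
  by rewrite d; lra.
have r1 : 0 < N - E < pi by case: (lift_gt0 lE lN _ c1); lra.
have r2 : pi < M - E < 2 * pi.
  case: (lerP (M - E) (2 * pi)) => k; first by case: (lift_lt0 lE lM _ c2); lra.
  by case: (lift_lt0 (lift_2pi lE) lM _ c2); lra.
split; first lra.
move=> eM; apply: ab.
have [kX [kx0 hkX]] : exists kX, kX < 0 /\ prp kX X i C a by case: h1 => _ _ [k ? ?]; exists k.
have [kY [ky0 hkY]] : exists kY, kY < 0 /\ prp kY Y j C b by case: h2 => _ _ [k ? ?]; exists k.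
have [n1 n2] := prp_nrm hkX; have [n3 n4] := prp_nrm hkY.
have c0 : cr (nrm C a) (nrm C b) = 0.
  have [r r0 hr] := lift_cr lN lM.
  have : cr (nrm Y j) (nrm X i) = 0.
    by rewrite hr eM; have -> : N + pi - N = pi :> R by [ring]; rewrite sinpi mulr0.
  move=> z; rewrite crC; have -> : cr (nrm C b) (nrm C a) = kX * kY * cr (nrm Y j) (nrm X i).
    by rewrite /cr n1 n2 n3 n4; ring.
  by rewrite z mulr0 oppr0.
by case: (idx_dec a b) => // /(cr_neq aC); rewrite c0 eqxx.
Qed.

End Lifts.

(** * Edges between common neighbors *)

Section Position.
Variable R : realType.
Implicit Types (p q u v g x w z : R * R) (s t : R) (i j a b l : idx).
Implicit Types T X Y A B C : tri R.

(** The linear relation between three vectors of the plane, paired with [d]; contradictions between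
    signs are read off from it. *)
Lemma dt_expand (r n n' d : R * R) :
  dt r d * cr n n' = dt n d * cr r n' - dt n' d * cr r n.
Proof. rewrite /dt /cr; ring. Qed.

(** [d] leads from one contact point with [Y] to the other: it crosses the line shared by [C] and
    [C'], while both its ends belong to [Y]. *)
Lemma third_pair Y j j' b b' w w' C C' l l' z : nbr Y j C b w -> nbr Y j' C' b' w' ->
  nbr C l C' l' z -> l <> b -> l' <> b' ->
  exists d, [/\ 0 < dt (nrm C l) d, dt (nrm Y j) d <= 0 & 0 <= dt (nrm Y j') d].
Proof.
move=> [w0 wb _] [w0' wb' _] hz lb lb'; exists (dif w' w); rewrite !dt_dif.
have h1 : sd C l w < 0 by case: wb => _; apply.
have h2 : 0 < sd C l w' by apply: (nbr_pos hz); case: wb' => _; apply.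
have h3 := rel_inn w0' j; have h4 := rel_inn w0 j'.
by have [e1 _] := w0; have [e2 _] := w0'; split; lra.
Qed.

(** [d] leads from the contact of [X] with [F] to its contact with [H]. Both points belong to [X],
    and the line of the side [b'] of [H], which is also the line of a side of [Y], separates
    them. *)
Lemma flat_side X Y F H i f l i' j' a' b' x x' w' z :
  nbr X i F f x -> cn X Y H i' j' a' b' x' w' -> nbr F l H b' z -> l <> f -> a' <> b' ->
  exists d, [/\ 0 < dt (nrm Y j') d, dt (nrm X i) d <= 0 & 0 <= dt (nrm X i') d].
Proof.
move=> [x0 xf _] [[x0' xa' _] h2'] hz lf ab'; exists (dif x' x); rewrite !dt_dif.
have h1 : sd F l x < 0 by case: xf => _; apply.
have h2 : 0 < sd Y j' x' by apply: (nbr_pos h2'); case: xa' => _; apply=> E; apply: ab'.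
have h3 : sd Y j' x < 0.
  have [_ _ [k k0 hk]] := h2'; have [_ _ [k1 k10 hk1]] := nbr_sym hz.
  by move: h1; rewrite hk1 hk mulrA pmulr_rlt0 // nmulr_rgt0.
have h4 := rel_inn x0' i; have h5 := rel_inn x0 i'.
by have [e1 _] := x0; have [e2 _] := x0'; split; lra.
Qed.

(* On the line [l] the points of [X] and [Y] lie on both sides of the side of
   [H], whereas they both lie below the common line of [X], [Y] and [F]. *)
Lemma flat_third X Y F H i j f l i' j' a' b' l' x w x' w' z :
  0 < ar H -> cn X Y F i j f f x w -> cn X Y H i' j' a' b' x' w' -> nbr F l H l' z ->
  l <> f -> l' <> a' -> l' <> b' -> a' <> b' -> False.
Proof.
move=> aH [h1 h2] [h3 h4] hz lf la lb ab.
(* A triangle [Z] that touches both [F] and [H] has its contact points on opposite sides of the line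
   of [l'], so it contains a point of that line. *)
have key Z i0 i1 c' y y' : nbr Z i0 F f y -> nbr Z i1 H c' y' -> l' <> c' ->
    exists p, [/\ sd H l' p = 0, 0 <= sd H c' p & sd F f p >= 0].
  move=> [y0 yf [k k0 hk]] [y0' yc' [k' k0' hk']] lc.
  have s1 : 0 < sd H l' y by apply: (nbr_pos (nbr_sym hz)); case: yf => _; apply.
  have s2 : sd H l' y' < 0 by case: yc' => _; apply.
  have d0 : 0 < sd H l' y - sd H l' y' by lra.
  pose t := sd H l' y / (sd H l' y - sd H l' y').
  have t01 : 0 <= t <= 1.
    apply/andP; split; first by apply: divr_ge0; lra.
    by rewrite ler_pdivrMr //; lra.
  have hp := inn_seg t01 (rel_inn y0) (rel_inn y0').
  exists (mv y (dif y' y) t); split.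
  - rewrite sd_seg /t; field; lra.
  - by rewrite hk' nmulr_rge0 //; exact: hp.
  - by rewrite hk nmulr_rge0 //; exact: hp.
have [p [p1 p2 p3]] := key _ _ _ _ _ _ h1 h3 la.
have [q [q1 q2 q3]] := key _ _ _ _ _ _ h2 h4 lb.
have [z0 z1 [k k0 hk]] := hz.
have zf : sd F f z < 0 by case: z0 => _; apply=> E; apply: lf.
have za : sd H a' z < 0 by case: z1 => _; apply=> E; apply: la.
have zb : sd H b' z < 0 by case: z1 => _; apply=> E; apply: lb.
have zl : sd H l' z = 0 by case: z1.
have [c [ca cb hs all3 _]] := third H ab.
have cl : c = l' by case: (all3 l') => [/la|/lb|->].
rewrite cl in hs.
have hsp := hs p; have hsq := hs q; have hsz := hs z.
rewrite p1 in hsp; rewrite q1 in hsq; rewrite zl in hsz.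
have bp : sd H b' p - sd H b' z = - (sd H a' p - sd H a' z) by lra.
have A1 : 0 < sd H a' p - sd H a' z by lra.
have A2 : sd H a' q - sd H a' z < 0 by lra.
(* three collinear points: compare [sd F f] and [sd H a'] along the line *)
have col : (sd F f p - sd F f z) * (sd H a' q - sd H a' z) =
           (sd F f q - sd F f z) * (sd H a' p - sd H a' z).
  have n2 := nrm2_gt0 l' aH.
  have e1 := dt_dif H l' z p; have e2 := dt_dif H l' z q.
  rewrite p1 zl subrr in e1; rewrite q1 zl subrr in e2.
  rewrite -!dt_dif.
  have cpq : cr (dif p z) (dif q z) = 0.
    apply: (mulfI (lt0r_neq0 n2)); rewrite mulr0.
    have -> : dt (nrm H l') (nrm H l') * cr (dif p z) (dif q z) =
      dt (nrm H l') (dif p z) * cr (nrm H l') (dif q z) -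
      dt (nrm H l') (dif q z) * cr (nrm H l') (dif p z) by rewrite /dt /cr; ring.
    by rewrite e1 e2 !mul0r subrr.
  have -> : dt (nrm F f) (dif p z) * dt (nrm H a') (dif q z) =
    dt (nrm F f) (dif q z) * dt (nrm H a') (dif p z) +
    cr (dif p z) (dif q z) * cr (nrm F f) (nrm H a') by rewrite /dt /cr; ring.
  by rewrite cpq mul0r addr0.
have B1 : 0 < sd F f p - sd F f z by lra.
have B2 : 0 < sd F f q - sd F f z by lra.
have := mulr_gt0 B2 A1; rewrite -col.
have : (sd F f p - sd F f z) * (sd H a' q - sd H a' z) < 0 by rewrite pmulr_rlt0.
lra.
Qed.

(* [C1] and [C3] adjacent along the line [L] of the side [a] of [C1]; [C2] would
   have to cross [L] between the corner of [C3] and that of [C1]. *)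
Lemma pinwheel X Y C1 C2 C3 i j i' j' a b a' b' a2 b2 x w x' w' x2 w2 z :
  0 < ar X -> 0 < ar Y -> 0 < ar C1 -> 0 < ar C2 -> 0 < ar C3 ->
  disj X C1 -> disj Y C1 -> disj X C2 -> disj Y C2 -> disj C2 C1 ->
  cn X Y C1 i j a b x w -> cn X Y C3 i' j' a' b' x' w' -> nbr C1 a C3 b' z ->
  i <> i' -> j <> j' -> a <> b -> a' <> b' -> a2 <> b2 ->
  cn X Y C2 i' j a2 b2 x2 w2 -> False.
Proof.
move=> aX aY a1 aC2 a3 d1 d2 d3 d4 d5 h1 h3 hz ij jj ab ab' ab2 h2.
have [h1x h1w] := h1; have [h3x h3w] := h3; have [h2x h2w] := h2.
have [m m0 hm] : exists2 m, m < 0 & prp m X i Y j'.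
  have [_ _ [k k0 hk]] := h1x; have [_ _ [k1 k10 hk1]] := hz.
  have [_ _ [k2 k20 hk2]] := nbr_sym h3w.
  exists (k2 * (k1 * k)); first by rewrite nmulr_rlt0 // nmulr_rgt0.
  exact: prp_trans (prp_trans hk hk1) hk2.
have [x20 x2a _] := h2x; have [w20 w2b _] := h2w.
have [[xe xo] xa _] := h1x; have [[we' wo'] wb' _] := h3w.
have sx : sd X i x2 < 0 by case: x20 => _; apply.
have sw : 0 < sd X i w2.
  have : sd Y j' w2 < 0 by case: w20 => _; apply=> E; apply: jj.
  by rewrite hm nmulr_rlt0.
have dd : 0 < sd X i w2 - sd X i x2 by lra.
pose t := - sd X i x2 / (sd X i w2 - sd X i x2).
have t01 : 0 <= t <= 1.
  apply/andP; split; first by apply: divr_ge0; lra.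
  by rewrite ler_pdivrMr //; lra.
(* [y] is where the contact segment of [C2] meets [L]; the rest shows that [y] belongs to [C1]. *)
pose y := mv x2 (dif w2 x2) t.
apply: (noncross aX aY aC2 a1 d3 d4 d1 d2 d5 h2 ab2 t01); rewrite -/y.
have yL : sd X i y = 0 by rewrite /y sd_seg /t; field; lra.
have yC : inn C2 y by apply: inn_seg => //; apply: rel_inn; eauto.
have yg : 0 <= sd X i' y := nbr_out h2x (yC a2).
have yh : 0 <= sd Y j y := nbr_out h2w (yC b2).
have xg : sd X i' x < 0 by apply: xo => E; apply: ij.
have xh : 0 < sd Y j x by apply: (nbr_pos h1w); case: xa => _; apply=> E; apply: ab.
have wh : sd Y j w' < 0 by apply: wo'.
have wg : 0 < sd X i' w' by apply: (nbr_pos h3x); case: wb' => _; apply.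
have wL : sd X i w' = 0 by move: we'; rewrite hm => /eqP; rewrite mulf_eq0 lt_eqF //= => /eqP.
have col : (sd X i' y - sd X i' x) * (sd Y j w' - sd Y j x) =
           (sd Y j y - sd Y j x) * (sd X i' w' - sd X i' x).
  have n2 := nrm2_gt0 i aX.
  have e1 := dt_dif X i x y; have e2 := dt_dif X i x w'.
  rewrite yL xe subrr in e1; rewrite wL xe subrr in e2.
  rewrite -!dt_dif.
  have cpq : cr (dif y x) (dif w' x) = 0.
    apply: (mulfI (lt0r_neq0 n2)); rewrite mulr0.
    have -> : dt (nrm X i) (nrm X i) * cr (dif y x) (dif w' x) =
      dt (nrm X i) (dif y x) * cr (nrm X i) (dif w' x) -
      dt (nrm X i) (dif w' x) * cr (nrm X i) (dif y x) by rewrite /dt /cr; ring.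
    by rewrite e1 e2 !mul0r subrr.
  have -> : dt (nrm X i') (dif y x) * dt (nrm Y j) (dif w' x) =
    dt (nrm X i') (dif w' x) * dt (nrm Y j) (dif y x) +
    cr (dif y x) (dif w' x) * cr (nrm X i') (nrm Y j) by rewrite /dt /cr; ring.
  by rewrite cpq mul0r addr0 mulrC.
have yx : sd Y j y < sd Y j x.
  have A1 : 0 < sd X i' y - sd X i' x by lra.
  have A2 : sd Y j w' - sd Y j x < 0 by lra.
  have A3 : 0 < sd X i' w' - sd X i' x by lra.
  have := nmulr_llt0 (sd X i' y - sd X i' x) A2; rewrite col A1 pmulr_llt0 //; lra.
have [k k0 hk] : exists2 k, k < 0 & prp k X i C1 a by case: h1x.
have [k1 k10 hk1] : exists2 k, k < 0 & prp k Y j C1 b by case: h1w.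
have ya : sd C1 a y = 0 by rewrite hk yL mulr0.
have yb : sd C1 b y <= 0 by rewrite hk1 nmulr_rle0.
have yb' : sd C1 b x < sd C1 b y by rewrite !hk1 ltr_nM2l.
have [c [ca cb hs all3 _]] := third C1 ab.
have hsy := hs y; have hsx := hs x; rewrite ya in hsy.
have [xa0 xa1] := xa; have := xa1 c ca; rewrite xa0 in hsx => xc.
by move=> l; case: (all3 l) => ->; lra.
Qed.

End Position.

(* A triangle [ct] touching [A] and [B], with a choice of contacts: its side [ca]
   meets the side [ci] of [A] at [cx], its side [cb] meets the side [cj] of [B]
   at [cw]. [N] and [M] are angles of the normals of [B] and of [A]. *)
Record cnb (R : realType) (A B : tri R) (N M : idx -> R) := Cnb {
  ct : tri R; ci : idx; cj : idx; ca : idx; cb : idx; cx : R * R; cw : R * R;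
  car : 0 < ar ct; cdA : disj A ct; cdB : disj B ct;
  cP : cn A B ct ci cj ca cb cx cw;
  crg : (ca = cb /\ (M ci = N cj \/ M ci = N cj + 2 * pi)) \/
        (ca <> cb /\ N cj < M ci < N cj + 2 * pi /\ M ci <> N cj + pi) }.

Arguments cdA {R A B N M} c [p] _ _.
Arguments cdB {R A B N M} c [p] _ _.

Section Edges.
Variable R : realType.
Variables (A B : tri R) (N M : idx -> R).
Hypotheses (aA : 0 < ar A) (aB : 0 < ar B) (dAB : disj A B).
Hypotheses (lB : forall i, lift (nrm B i) (N i)) (lA : forall i, lift (nrm A i) (M i)).
Hypotheses (sN : spread N) (sM : spread M).
Notation cnb := (cnb A B N M).
Implicit Types (c d : cnb) (l : idx) (z : R * R).

Definition angB c := N (cj c).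
Definition angA c := M (ci c).
(* [A] and [B] lean on the same side of [ct c]. *)
Definition flat c := ca c = cb c.
(* [ct c] fills a wedge between its two contact lines, closed by its third side
   on the left or on the right. *)
Definition opens_left c := angB c + pi < angA c.
Definition opens_right c := angA c < angB c + pi.
(** The order of the contacts from left to right, in terms of angles: the normal of [B] turns
    counterclockwise and that of [A] clockwise. *)
Definition before c d := angB c <= angB d /\ angA d <= angA c.
Definition distinct c d := ~ (ci c = ci d /\ cj c = cj d).
Definition isthird c l := l <> ca c /\ l <> cb c.
Definition touching c l d k z := nbr (ct c) l (ct d) k z.

Lemma nonflat_range c : ~ flat c -> angB c < angA c < angB c + 2 * pi /\ (opens_left c \/ opens_right c).
Proof.
move=> h; case: (crg c) => [[//]|[_ [r e]]]; split=> //.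
rewrite /opens_left /opens_right; case: (cmp3 (angA c) (angB c + pi)) => //; by [right|left|].
Qed.

Lemma oppA c : exists2 k, k < 0 & prp k A (ci c) (ct c) (ca c).
Proof. by case: (cP c) => -[]. Qed.

Lemma oppB c : exists2 k, k < 0 & prp k B (cj c) (ct c) (cb c).
Proof. by case: (cP c) => _ []. Qed.

Lemma lift_a c : lift (nrm (ct c) (ca c)) (angA c + pi).
Proof. by have [k k0 h] := oppA c; apply: lift_opp k0 (prp_nrm h) (lA _). Qed.

Lemma lift_b c : lift (nrm (ct c) (cb c)) (angB c + pi).
Proof. by have [k k0 h] := oppB c; apply: lift_opp k0 (prp_nrm h) (lB _). Qed.

(** The normals of [ct c] add up to 0, and those of its contact sides are opposite in direction to
    the normals of [A] and of [B]. *)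
Lemma third_comb c l : ~ flat c -> isthird c l -> exists s t, [/\ 0 < s, 0 < t,
  (nrm (ct c) l).1 = s * (nrm A (ci c)).1 + t * (nrm B (cj c)).1 &
  (nrm (ct c) l).2 = s * (nrm A (ci c)).2 + t * (nrm B (cj c)).2].
Proof.
move=> nf [la lb]; have [k [ka kb _ all3 [e1 e2]]] := third (ct c) nf.
have {k ka kb all3 e1 e2} [e1 e2] : (nrm (ct c) l).1 = - (nrm (ct c) (ca c)).1 - (nrm (ct c) (cb c)).1
   /\ (nrm (ct c) l).2 = - (nrm (ct c) (ca c)).2 - (nrm (ct c) (cb c)).2.
  by case: (all3 l) => [/la|/lb|->].
have [k k0 /prp_nrm[h1 h2]] := oppA c; have [k' k0' /prp_nrm[h3 h4]] := oppB c.
exists (- k), (- k'); rewrite !oppr_gt0; split=> //; rewrite ?e1 ?e2 ?h1 ?h2 ?h3 ?h4; ring.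
Qed.

Lemma lift_t c l : ~ flat c -> isthird c l -> exists2 W, lift (nrm (ct c) l) W &
  (opens_right c /\ angB c < W < angA c) \/ (opens_left c /\ angA c < W < angB c + 2 * pi).
Proof.
move=> nf hl; have [s [t [s0 t0 e1 e2]]] := third_comb nf hl.
have [r sc] := nonflat_range nf; rewrite /opens_left /opens_right in sc *; case: sc => sc.
  have r' : angA c < angB c + 2 * pi < angA c + pi by lra.
  have [W hW lW] := cone_lift (lA (ci c)) (lift_2pi (lB (cj c))) r' s0 t0 e1 e2.
  by exists W => //; right.
have r' : angB c < angA c < angB c + pi by lra.
rewrite addrC in e1; rewrite addrC in e2.
have [W hW lW] := cone_lift (lB (cj c)) (lA (ci c)) r' t0 s0 e1 e2.
by exists W => //; left.
Qed.

Lemma third_uniq c l k : ~ flat c -> isthird c l -> isthird c k -> l = k.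
Proof.
move=> nf [h1 h2] [h3 h4]; have [i [_ _ _ all3 _]] := third (ct c) nf.
have e l' : l' <> ca c -> l' <> cb c -> l' = i by move=> k1 k2; case: (all3 l').
by rewrite (e l h1 h2) (e k h3 h4).
Qed.

Lemma sideP c l : [\/ l = ca c, l = cb c | isthird c l].
Proof.
case: (idx_dec l (ca c)) => [|h]; first by constructor 1.
by case: (idx_dec l (cb c)) => [|h']; [constructor 2|constructor 3].
Qed.

Lemma adj_lift C D l k z L K : nbr C l D k z -> lift (nrm C l) L -> lift (nrm D k) K ->
  - (4 * pi) <= K - (L + pi) <= 4 * pi ->
  [\/ K = L + pi, K = L + pi + 2 * pi | K = L + pi - 2 * pi] \/
     K = L + pi + 4 * pi \/ K = L + pi - 4 * pi.
Proof.
move=> [_ _ [r r0 h]] hL hK; apply: (lift_uniq4 _ hK).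
exact: lift_opp r0 (prp_nrm h) hL.
Qed.

Lemma angB_eq c d : angB c = angB d -> cj c = cj d. Proof. by case: sN => _ _ h _ /h. Qed.
Lemma angA_eq c d : angA c = angA d -> ci c = ci d. Proof. by case: sM => _ _ h _ /h. Qed.
Lemma angB_pi c d : angB c - angB d <> pi. Proof. by case: sN => h _ _ _; exact: h. Qed.
Lemma angA_pi c d : angA c - angA d <> pi. Proof. by case: sM => h _ _ _; exact: h. Qed.
Lemma angB_2pi c d : angB c - angB d < 2 * pi. Proof. by case: sN => _ h _ _; exact: h. Qed.
Lemma angA_2pi c d : angA c - angA d < 2 * pi. Proof. by case: sM => _ h _ _; exact: h. Qed.

(** The angles leave one case: [c] comes first, its third side faces left, and that of [d] faces
    right. The vectors of [third_pair], taken for [A] and for [B], then force both pairs of touched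
    sides to coincide. *)
Lemma third_third c d l k z : ~ flat c -> ~ flat d -> before c d -> distinct c d ->
  touching c l d k z -> isthird c l -> isthird d k -> False.
Proof.
move=> fc fd [bn bm] di ht hl hk; have p0 := pi_gt0 R.
have [rc _] := nonflat_range fc; have [rd _] := nonflat_range fd.
have [W lW hW] := lift_t fc hl; have [V lV hV] := lift_t fd hk.
rewrite /opens_right /opens_left in hW hV.
have hr : - (4 * pi) <= V - (W + pi) <= 4 * pi by lra.
have [hm hp] : angA c < W < angB c + 2 * pi /\ angB d < V < angA d /\
    angA d < angB d + pi /\ angB c + pi < angA c /\ V = W - pi.
  by case: (adj_lift ht lW lV hr) => [[]|[]] e; case: hW => -[]; case: hV => -[]; move=> *; lra.
have [[lc lc'] [ld ld']] := (hl, hk).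
have [hcA hcB] := cP c; have [hdA hdB] := cP d.
have [u [u1 u2 u3]] := third_pair hcB hdB ht lc' ld'.
have [v [v1 v2 v3]] := third_pair hcA hdA ht lc ld.
have c1 : 0 < cr (nrm (ct c) l) (nrm B (cj c)).
  by apply: (cr_lift_gt0 lW (lift_2pi (lB (cj c)))); rewrite -/(angB c); lra.
have c2 : 0 < cr (nrm (ct c) l) (nrm B (cj d)).
  by apply: (cr_lift_gt0 lW (lift_2pi (lB (cj d)))); rewrite -/(angB d); lra.
have c3 : cr (nrm (ct c) l) (nrm A (ci c)) < 0.
  by rewrite crC oppr_lt0; apply: (cr_lift_gt0 (lA (ci c)) lW); rewrite -/(angA c); lra.
have c4 : cr (nrm (ct c) l) (nrm A (ci d)) < 0.
  by rewrite crC oppr_lt0; apply: (cr_lift_gt0 (lA (ci d)) lW); rewrite -/(angA d); lra.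
apply: di; split.
  apply: angA_eq; apply/eqP; rewrite eq_le bm andbT leNgt; apply/negP => lt.
  have : 0 < cr (nrm A (ci d)) (nrm A (ci c)).
    by apply: (cr_lift_gt0 (lA _) (lA _)); rewrite -/(angA c) -/(angA d); lra.
  rewrite crC oppr_gt0 => k1.
  have := dt_expand (nrm (ct c) l) (nrm A (ci c)) (nrm A (ci d)) v.
  have : dt (nrm (ct c) l) v * cr (nrm A (ci c)) (nrm A (ci d)) < 0 by rewrite pmulr_rlt0.
  have := mulr_le0 v2 (ltW c4); have := mulr_ge0_le0 v3 (ltW c3); lra.
apply: angB_eq; apply/eqP; rewrite eq_le bn /= leNgt; apply/negP => lt.
have k1 : 0 < cr (nrm B (cj c)) (nrm B (cj d)).
  by apply: (cr_lift_gt0 (lB _) (lB _)); rewrite -/(angB c) -/(angB d); lra.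
have := dt_expand (nrm (ct c) l) (nrm B (cj c)) (nrm B (cj d)) u.
have : 0 < dt (nrm (ct c) l) u * cr (nrm B (cj c)) (nrm B (cj d)) by rewrite mulr_gt0.
have := mulr_le0_ge0 u2 (ltW c2); have := mulr_ge0 u3 (ltW c1); lra.
Qed.

(** Two sides that both lean on [A], or both on [B], cannot touch each other, since no two normals
    of a triangle are opposite; two third sides are excluded by [third_third]. In the other
    combinations the ranges of the angles decide. *)
Lemma touch_types c d l k z : ~ flat c -> ~ flat d -> before c d -> distinct c d ->
  touching c l d k z ->
  [\/ [/\ opens_left c, opens_left d, isthird d k & l = ca c \/ l = cb c],
      [/\ opens_right c, opens_right d, isthird c l & k = ca d \/ k = cb d]
    | [/\ opens_left c, opens_right d & (l = ca c /\ k = cb d /\ angA c = angB d + pi) \/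
                            (l = cb c /\ k = ca d /\ angA d = angB c + pi)]].
Proof.
move=> fc fd bf di ht; have p0 := pi_gt0 R; have [bn bm] := bf.
have [rc sc] := nonflat_range fc; have [rd sd'] := nonflat_range fd.
have lac := lift_a c; have lbc := lift_b c; have lad := lift_a d; have lbd := lift_b d.
case: (sideP c l) => hl; case: (sideP d k) => hk.
- have ht' := ht; rewrite /touching hl hk in ht'.
  have hr : - (4 * pi) <= angA d + pi - (angA c + pi + pi) <= 4 * pi by lra.
  have hm := @angA_pi c d; have hm' := @angA_2pi c d.
  by case: (adj_lift ht' lac lad hr) => [[]|[]] e; exfalso; clear sc sd'; lra.
- have ht' := ht; rewrite /touching hl hk in ht'.
  have hr : - (4 * pi) <= angB d + pi - (angA c + pi + pi) <= 4 * pi by lra.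
  constructor 3; rewrite /opens_left /opens_right in sc sd' *.
  by case: (adj_lift ht' lac lbd hr) => [[]|[]] e; split; try lra; left; split=> //; split=> //; lra.
- case: sc => sc.
    constructor 1; split=> //; last by left.
    case: sd' => // sd'; exfalso; rewrite /opens_right /opens_left in sc sd'.
    have [W lW hW] := lift_t fd hk; rewrite /opens_right /opens_left in hW.
    have ht' := ht; rewrite /touching hl in ht'.
    have hr : - (4 * pi) <= W - (angA c + pi + pi) <= 4 * pi by lra.
    by case: (adj_lift ht' lac lW hr) => [[]|[]] e; case: hW => hW; lra.
  exfalso; rewrite /opens_right /opens_left in sc sd'.
  have [W lW hW] := lift_t fd hk; rewrite /opens_right /opens_left in hW.
  have ht' := ht; rewrite /touching hl in ht'.
  have hr : - (4 * pi) <= W - (angA c + pi + pi) <= 4 * pi by lra.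
  by case: (adj_lift ht' lac lW hr) => [[]|[]] e; case: hW => hW; lra.
- have ht' := ht; rewrite /touching hl hk in ht'.
  have hr : - (4 * pi) <= angA d + pi - (angB c + pi + pi) <= 4 * pi by lra.
  constructor 3; rewrite /opens_left /opens_right in sc sd' *.
  by case: (adj_lift ht' lbc lad hr) => [[]|[]] e; split; try lra; right; split=> //; split=> //; lra.
- have ht' := ht; rewrite /touching hl hk in ht'.
  have hr : - (4 * pi) <= angB d + pi - (angB c + pi + pi) <= 4 * pi by lra.
  have hn := @angB_pi d c; have hn' := @angB_2pi d c.
  by case: (adj_lift ht' lbc lbd hr) => [[]|[]] e; exfalso; clear sc sd'; lra.
- have [W lW hW] := lift_t fd hk; rewrite /opens_right /opens_left in hW.
  have ht' := ht; rewrite /touching hl in ht'.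
  have hr : - (4 * pi) <= W - (angB c + pi + pi) <= 4 * pi by lra.
  constructor 1; rewrite /opens_right /opens_left in sc sd' *; split=> //; last by right.
    by case: (adj_lift ht' lbc lW hr) => [[]|[]] e; case: hW => hW; lra.
  by case: (adj_lift ht' lbc lW hr) => [[]|[]] e; case: hW => hW; lra.
- have [W lW hW] := lift_t fc hl; rewrite /opens_right /opens_left in hW.
  have ht' := ht; rewrite /touching hk in ht'.
  have hr : - (4 * pi) <= angA d + pi - (W + pi) <= 4 * pi by lra.
  constructor 2; rewrite /opens_right /opens_left in sc sd' *; split=> //; last by left.
    by case: (adj_lift ht' lW lad hr) => [[]|[]] e; case: hW => hW; lra.
  by case: (adj_lift ht' lW lad hr) => [[]|[]] e; case: hW => hW; lra.
- have [W lW hW] := lift_t fc hl; rewrite /opens_right /opens_left in hW.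
  have ht' := ht; rewrite /touching hk in ht'.
  have hr : - (4 * pi) <= angB d + pi - (W + pi) <= 4 * pi by lra.
  constructor 2; rewrite /opens_right /opens_left in sc sd' *; split=> //; last by right.
    by case: (adj_lift ht' lW lbd hr) => [[]|[]] e; case: hW => hW; lra.
  by case: (adj_lift ht' lW lbd hr) => [[]|[]] e; case: hW => hW; lra.
- by exfalso; apply: (third_third fc fd bf di ht hl hk).
Qed.

End Edges.

(** * Three neighbors, none of them flat *)

Section Triples.
Variable R : realType.
Variables (A B : tri R) (N M : idx -> R).
Hypotheses (aA : 0 < ar A) (aB : 0 < ar B) (dAB : disj A B).
Hypotheses (lB : forall i, lift (nrm B i) (N i)) (lA : forall i, lift (nrm A i) (M i)).
Hypotheses (sN : spread N) (sM : spread M).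
Notation cnb := (cnb A B N M).
Implicit Types (c d : cnb) (l : idx) (z : R * R).

Let angB_eq := @angB_eq R A B N M sN.
Let angA_eq := @angA_eq R A B N M sM.

Lemma disjC (X Y : tri R) : disj X Y -> disj Y X.
Proof. by move=> h p h1 h2; apply: (h p). Qed.

(** A contact side that also meets [l'] puts [l'] on the line of a side of [A] or of [B]. If it is
    the same triangle for [c] and [d], that triangle and [D] form with them the configuration of
    [flat_uniq]; if not, an angle of [A] and one of [B] would be congruent, against their ranges. *)
Lemma same_support c d (D : tri R) l k l' z z' : ~ flat c -> ~ flat d ->
  before c d \/ before d c -> distinct c d -> disj (ct c) (ct d) ->
  0 < ar D -> disj A D -> disj B D ->
  nbr (ct c) l D l' z -> nbr (ct d) k D l' z' ->
  l = ca c \/ l = cb c -> k = ca d \/ k = cb d -> False.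
Proof.
move=> fc fd bf di dcd aD dA dB hz hz' hl hk; have p0 := pi_gt0 R.
have [rc _] := nonflat_range fc; have [rd _] := nonflat_range fd.
have [hcA hcB] := cP c; have [hdA hdB] := cP d.
case: hl => hl; case: hk => hk; rewrite hl in hz; rewrite hk in hz'.
- have [m1 m10 h1] := flat_same hcA (nbr_sym hz); have [m2 m20 h2] := flat_same hdA (nbr_sym hz').
  have e : ci c = ci d.
    by apply: (prp_same_idx aA (prp_trans h1 (prp_sym (lt0r_neq0 m20) h2))).
  rewrite -e in hdA.
  exact: (flat_uniq aA aD (car c) dA dcd (conj hcA (nbr_sym hz)) (conj hdA (nbr_sym hz'))).
- have [m1 m10 h1] := flat_same hcA (nbr_sym hz); have [m2 m20 h2] := flat_same hdB (nbr_sym hz').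
  have L1 := lift_scale m10 (prp_nrm h1) (lA _); have L2 := lift_scale m20 (prp_nrm h2) (lB _).
  rewrite -/(angA c) in L1; rewrite -/(angB d) in L2.
  have r : - (4 * pi) <= angB d - angA c <= 4 * pi by case: bf => -[]; lra.
  by case: (lift_uniq4 L1 L2 r) => [[]|[]] E; case: bf => -[]; lra.
- have [m1 m10 h1] := flat_same hcB (nbr_sym hz); have [m2 m20 h2] := flat_same hdA (nbr_sym hz').
  have L1 := lift_scale m10 (prp_nrm h1) (lB _); have L2 := lift_scale m20 (prp_nrm h2) (lA _).
  rewrite -/(angB c) in L1; rewrite -/(angA d) in L2.
  have r : - (4 * pi) <= angA d - angB c <= 4 * pi by case: bf => -[]; lra.
  by case: (lift_uniq4 L1 L2 r) => [[]|[]] E; case: bf => -[]; lra.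
- have [m1 m10 h1] := flat_same hcB (nbr_sym hz); have [m2 m20 h2] := flat_same hdB (nbr_sym hz').
  have e : cj c = cj d.
    by apply: (prp_same_idx aB (prp_trans h1 (prp_sym (lt0r_neq0 m20) h2))).
  rewrite -e in hdB.
  exact: (flat_uniq aB aD (car c) dB dcd (conj hcB (nbr_sym hz)) (conj hdB (nbr_sym hz'))).
Qed.

Definition adjacent c d := exists l k z, touching c l d k z.

Lemma adjacent_sym c d : adjacent c d -> adjacent d c.
Proof. by move=> [l [k [z h]]]; exists k, l, z; apply: nbr_sym. Qed.

Lemma sides_uniq c d : disj (ct c) (ct d) -> distinct c d.
Proof.
move=> h [e1 e2]; have := cP d; rewrite -e1 -e2.
exact: (side_uniq aA aB (car c) (car d) dAB h (cP c)).
Qed.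

Lemma types c d l k z : ~ flat c -> ~ flat d -> before c d -> disj (ct c) (ct d) ->
  touching c l d k z ->
  [\/ [/\ opens_left c, opens_left d, isthird d k & l = ca c \/ l = cb c],
      [/\ opens_right c, opens_right d, isthird c l & k = ca d \/ k = cb d]
    | [/\ opens_left c, opens_right d & (l = ca c /\ k = cb d /\ angA c = angB d + pi) \/
                            (l = cb c /\ k = ca d /\ angA d = angB c + pi)]].
Proof.
by move=> fc fd bf di; apply: (touch_types lB lA sN sM fc fd bf (sides_uniq di)).
Qed.

Lemma minus_plus c d l k z : ~ flat c -> ~ flat d -> before c d -> disj (ct c) (ct d) ->
  touching c l d k z -> opens_left c -> opens_right d ->
  (angB c < angB d < angB c + pi /\ angA d < angA c < angA d + pi) /\
  ((l = ca c /\ k = cb d /\ angA c = angB d + pi) \/ (l = cb c /\ k = ca d /\ angA d = angB c + pi)).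
Proof.
move=> fc fd bf di ht mi pl; have [rc _] := nonflat_range fc; have [rd _] := nonflat_range fd.
have h := types fc fd bf di ht; rewrite /opens_left /opens_right in h mi pl *.
have h' : (l = ca c /\ k = cb d /\ angA c = angB d + pi) \/ (l = cb c /\ k = ca d /\ angA d = angB c + pi).
  by case: h => -[] //; lra.
by split=> //; clear h; case: h' => -[_ [_ e]]; split; lra.
Qed.

(** Otherwise the three would use three sides of [B], whose outer normals are more than pi apart. *)
Lemma angB_close (c d e : cnb) : angB c <= angB d -> angB d <= angB e -> angB e < angB c + pi ->
  angB d = angB c \/ angB d = angB e.
Proof.
move=> h1 h2 h3; case: (cmp3 (angB c) (angB d)) => k1; [|lra|by left].
case: (cmp3 (angB d) (angB e)) => k2; [|lra|by right].
by case: sN => _ _ _ /(_ (cj c) (cj d) (cj e)); rewrite -/(angB c) -/(angB d) -/(angB e); lra.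
Qed.

Lemma angA_close (c d e : cnb) : angA e <= angA d -> angA d <= angA c -> angA c < angA e + pi ->
  angA d = angA c \/ angA d = angA e.
Proof.
move=> h1 h2 h3; case: (cmp3 (angA d) (angA c)) => k1; [|lra|by left].
case: (cmp3 (angA e) (angA d)) => k2; [|lra|by right].
by case: sM => _ _ _ /(_ (ci e) (ci d) (ci c)); rewrite -/(angA c) -/(angA d) -/(angA e); lra.
Qed.

(** If the last two open left, [c1] and [c2] lean on the same third side of [c3]; if the first two
    open right, [c2] and [c3] lean on that of [c1]. Otherwise [c1] opens left and [c3] right, and
    the two that open alike are both within less than pi of the other one, so they use the same
    sides. *)
Lemma no_triangle c1 c2 c3 : ~ flat c1 -> ~ flat c2 -> ~ flat c3 ->
  before c1 c2 -> before c2 c3 ->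
  disj (ct c1) (ct c2) -> disj (ct c1) (ct c3) -> disj (ct c2) (ct c3) ->
  adjacent c1 c2 -> adjacent c1 c3 -> adjacent c2 c3 -> False.
Proof.
move=> f1 f2 f3 b12 b23 d12 d13 d23 [l12 [k12 [z12 h12]]] [l13 [k13 [z13 h13]]] [l23 [k23 [z23 h23]]].
have b13 : before c1 c3 by case: b12; case: b23; rewrite /before; lra.
have t12 := types f1 f2 b12 d12 h12; have t13 := types f1 f3 b13 d13 h13.
have t23 := types f2 f3 b23 d23 h23.
have np c : opens_left c -> opens_right c -> False by rewrite /opens_left /opens_right; lra.
have mm : opens_left c2 -> opens_left c3 -> False.
  move=> m2 m3.
  case: t13 => [[mi _ th hl]|[_ p3 _ _]|[_ p3 _]]; try by apply: (np c3).
  case: t23 => [[_ _ th' hl']|[p2 _ _ _]|[_ p3 _]]; try by [apply: (np c2)|apply: (np c3)].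
  have e := third_uniq f3 th th'; subst k23.
  exact: (same_support f1 f2 (or_introl b12) (sides_uniq d12) d12 (car c3) (cdA c3) (cdB c3)
    h13 h23 hl hl').
have pp : opens_right c1 -> opens_right c2 -> False.
  move=> m1 m2.
  case: t12 => [[m1' _ _ _]|[_ _ th hl]|[m1' _ _]]; try by apply: (np c1).
  case: t13 => [[m1' _ _ _]|[_ _ th' hl']|[m1' _ _]]; try by apply: (np c1).
  have e := third_uniq f1 th th'; subst l13.
  exact: (same_support f2 f3 (or_introl b23) (sides_uniq d23) d23 (car c1) (cdA c1) (cdB c1)
    (nbr_sym h12) (nbr_sym h13) hl hl').
case: t23 => [[m2 m3 _ _]|[p2 p3 th hl]|[m2 p3 _]]; first exact: mm.
  have m1 : opens_left c1 by have [_ [//|p1]] := nonflat_range f1; case: (pp p1 p2).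
  have [[r1 r2] _] := minus_plus f1 f2 b12 d12 h12 m1 p2.
  have [[r3 r4] _] := minus_plus f1 f3 b13 d13 h13 m1 p3.
  have [b1 b2] := b23.
  have n23 : angB c2 = angB c3 by case: (@angB_close c1 c2 c3) => //; lra.
  have m23 : angA c2 = angA c3 by case: (@angA_close c1 c2 c3) => //; lra.
  by apply: (sides_uniq d23); split; [apply: angA_eq|apply: angB_eq].
have m1 : opens_left c1 by case: t12 => [[]|[_ /(np _ m2)]|[]].
have [[r1 r2] _] := minus_plus f1 f3 b13 d13 h13 m1 p3.
have [[r3 r4] _] := minus_plus f2 f3 b23 d23 h23 m2 p3.
have [b1 b2] := b12.
have n12 : angB c2 = angB c1 by case: (@angB_close c1 c2 c3) => //; lra.
have m12 : angA c2 = angA c1 by case: (@angA_close c1 c2 c3) => //; lra.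
by apply: (sides_uniq d12); split; [apply: angA_eq|apply: angB_eq].
Qed.

Lemma no_opposite (X Y C : tri R) i j a b x w k : 0 < ar C -> cn X Y C i j a b x w ->
  k < 0 -> prp k X i Y j -> False.
Proof.
move=> aC [h1 h2] k0 hk; have [g hg] := inn_has_int aC.
have := nbr_pos h1 (hg a); have := nbr_pos h2 (hg b); rewrite hk => s1 s2.
by move: s1; rewrite nmulr_rgt0 //; lra.
Qed.

(** Within less than pi there is no room for a new side, so each side touched by [c2] is also
    touched by [c1] or [c3], and not both by the same one. Either [c2] touches the two sides on the
    line shared by [c1] and [c3], where [A] and [B] lie opposite each other, or it touches the other
    two, which is the case of [pinwheel]. *)
Lemma no_between c1 c2 c3 : ~ flat c1 -> ~ flat c2 -> ~ flat c3 ->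
  before c1 c2 -> before c2 c3 ->
  disj (ct c1) (ct c2) -> disj (ct c1) (ct c3) -> disj (ct c2) (ct c3) ->
  opens_left c1 -> opens_right c3 -> adjacent c1 c3 -> False.
Proof.
move=> f1 f2 f3 b12 b23 d12 d13 d23 mi pl [l [k [z ht]]].
have b13 : before c1 c3 by case: b12; case: b23; rewrite /before; lra.
have [[r1 r2] e] := minus_plus f1 f3 b13 d13 ht mi pl.
have [b1 b2] := b12; have [b3 b4] := b23.
have h2 := cP c2; have [h1A h1B] := cP c1; have [h3A h3B] := cP c3.
have ij : ci c1 <> ci c3 by move=> E; move: r2; rewrite /angA E; lra.
have jj : cj c1 <> cj c3 by move=> E; move: r1; rewrite /angB E; lra.
have opp (X Y : tri R) i j a b x w z' : nbr X i (ct c1) a x -> nbr Y j (ct c3) b w ->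
    nbr (ct c1) a (ct c3) b z' -> exists2 k, k < 0 & prp k X i Y j.
  move=> [_ _ [q q0 hq]] h [_ _ [q1 q10 hq1]]; have [_ _ [q2 q20 hq2]] := nbr_sym h.
  exists (q2 * (q1 * q)); first by rewrite nmulr_rlt0 // nmulr_rgt0.
  exact: prp_trans (prp_trans hq hq1) hq2.
have [n2|n2] : angB c2 = angB c1 \/ angB c2 = angB c3 by apply: angB_close; lra.
  have [m2|m2] : angA c2 = angA c1 \/ angA c2 = angA c3 by apply: angA_close; lra.
    by apply: (sides_uniq d12); split; [apply: angA_eq|apply: angB_eq].
  rewrite (angB_eq n2) (angA_eq m2) in h2.
  case: e => -[el [ek _]]; rewrite /touching el ek in ht.
    exact: (pinwheel aA aB (car c1) (car c2) (car c3) (cdA c1) (cdB c1) (cdA c2) (cdB c2)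
      (disjC d12) (cP c1) (cP c3) ht ij jj f1 f3 f2 h2).
  have [q q0 hq] := opp _ _ _ _ _ _ _ _ _ h1B h3A ht.
  exact: (no_opposite (car c2) (conj h2.2 h2.1) q0 hq).
have [m2|m2] : angA c2 = angA c1 \/ angA c2 = angA c3 by apply: angA_close; lra.
  rewrite (angB_eq n2) (angA_eq m2) in h2.
  case: e => -[el [ek _]]; rewrite /touching el ek in ht.
    have [q q0 hq] := opp _ _ _ _ _ _ _ _ _ h1A h3B ht.
    exact: (no_opposite (car c2) h2 q0 hq).
  exact: (pinwheel aB aA (car c1) (car c2) (car c3) (cdB c1) (cdA c1) (cdB c2) (cdA c2)
      (disjC d12) (conj h1B h1A) (conj h3B h3A) ht jj ij (fun E => f1 (esym E))
      (fun E => f3 (esym E)) (fun E => f2 (esym E)) (conj h2.2 h2.1)).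
by apply: (sides_uniq d23); split; [apply: angA_eq|apply: angB_eq].
Qed.

End Triples.

(** * Flat neighbors *)

Lemma flat_other (R : realFieldType) (X Y F C : tri R) i j f x w i' j' a' b' x' w' :
  nbr X i F f x -> nbr Y j F f w -> cn X Y C i' j' a' b' x' w' -> i' = i -> j' = j.
Proof.
move=> h1 h2 [h3 h4] e; subst i'; have [m m0 hm] := flat_same h1 h2.
(* As a point of [C], [w'] is not strictly inside the line common to [i] and [j], whereas a point
   interior to another side of [Y] would be. *)
have [w0 wb _] := h4; have s1 := nbr_out h3 (rel_inn wb a').
have s2 := rel_inn w0 j; case: (idx_dec j' j) => // jj.
have [_ /(_ j) h] := w0; by have := h (fun E => jj (esym E)); rewrite hm pmulr_rlt0 // ltNge s1.
Qed.

Lemma lift_sub2pi (R : realType) (u : R * R) U : lift u U -> lift u (U - 2 * pi).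
Proof.
have e : U = (U - 2 * pi) + pi *+ 2 by rewrite -[pi *+ 2]mulr_natl; ring.
move=> [r [r0 h1 h2]]; exists r; split=> //.
  by rewrite h1 {1}e sinD2pi.
by rewrite h2 {1}e cosD2pi.
Qed.

Section Flat.
Variable R : realType.
Variables (A B : tri R) (N M : idx -> R).
Hypotheses (aA : 0 < ar A) (aB : 0 < ar B) (dAB : disj A B).
Hypotheses (lB : forall i, lift (nrm B i) (N i)) (lA : forall i, lift (nrm A i) (M i)).
Hypotheses (sN : spread N) (sM : spread M).
Notation cnb := (cnb A B N M).
Implicit Types (c d F G H : cnb) (l : idx) (z : R * R).

Lemma flat_neq F c : flat F -> disj (ct F) (ct c) -> ci c <> ci F /\ cj c <> cj F.
Proof.
move=> fF d; have [h1 h2] := cP F; rewrite -[cb F]fF in h2.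
have ne := sides_uniq aA aB dAB d.
split=> e; apply: ne; split=> //; symmetry => //.
  exact: flat_other h1 h2 (cP c) e.
by have [h3 h4] := cP c; apply: flat_other h2 h1 (conj h4 h3) e.
Qed.

(** Each flat neighbor puts a side of [A] and a side of [B] on one line, with both triangles on the
    same side. The two lines meet in a common corner of [A] and [B], where these overlap. *)
Lemma one_flat F G : disj (ct F) (ct G) -> flat F -> flat G -> False.
Proof.
move=> d fF fG; have [ni nj] := flat_neq fF d.
have [h1 h2] := cP F; rewrite -[cb F]fF in h2; have [h3 h4] := cP G; rewrite -[cb G]fG in h4.
have [m m0 hm] := flat_same h1 h2; have [k k0 hk] := flat_same h3 h4.
have [P [P1 P2 P3]] := corner aA ni.
have [g hg] := inn_has_int aA.
have s1 : sd B (cj F) P = 0 by rewrite hm P2 mulr0.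
have s2 : sd B (cj G) P = 0 by rewrite hk P1 mulr0.
have t1 : sd B (cj F) g < 0 by rewrite hm pmulr_rlt0.
have t2 : sd B (cj G) g < 0 by rewrite hk pmulr_rlt0.
apply: (enters_disj (p := P) (u := dif g P) dAB).
  apply: inn_enters => // i.
  case: (idx_dec i (ci G)) => [->|e]; first by rewrite P1.
  by case: (idx_dec i (ci F)) => [->|e']; [rewrite P2|apply/ltW/P3].
move=> i; rewrite dt_dif.
case: (idx_dec i (cj G)) => [->|e]; first by right; rewrite s2 subr0.
case: (idx_dec i (cj F)) => [->|e']; first by right; rewrite s1 subr0.
left; have [j [_ _ hs all3 _]] := third B nj; have hP := hs P; rewrite s1 s2 !add0r in hP.
by case: (all3 i) => [/e|/e'|->] //; rewrite hP oppr_lt0.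
Qed.

(** The equation on the angles places [F] first in the order. On the flat side the angles decide; on
    another side of [F], [flat_side] excludes a contact side of an [H] opening left, and
    [flat_third] excludes the third side of [H]. *)
Lemma flat_touch F H l k z : flat F -> angA F = angB F + 2 * pi -> ~ flat H ->
  angB F < angB H -> angA H < angA F -> touching F l H k z ->
  (opens_left H /\ l = ca F /\ isthird H k) \/
  (opens_right H /\ l <> ca F /\ (k = ca H \/ k = cb H)).
Proof.
move=> fF mF fH nFH mFH ht; have p0 := pi_gt0 R.
have [rH sH] := nonflat_range fH; have lF := lift_a lA F.
have h := cP H; have [hA hB] := h.
have [f1 f2] := cP F; rewrite -[cb F]fF in f2.
case: (idx_dec l (ca F)) => hl; case: (sideP H k) => hk.
- have ht' := ht; rewrite /touching hl hk in ht'.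
  have hm : angA F - angA H <> pi by exact: (@angA_pi R A B N M sM F H).
  have hm' := angA_2pi sM F H.
  have hr : - (4 * pi) <= angA H + pi - (angA F + pi + pi) <= 4 * pi by lra.
  by case: (adj_lift ht' lF (lift_a lA H) hr) => [[]|[]] e; exfalso; clear sH; lra.
- have ht' := ht; rewrite /touching hl hk in ht'.
  have hm : angB H - angB F <> pi by exact: (@angB_pi R A B N M sN H F).
  have hm' := angB_2pi sN H F.
  have hr : - (4 * pi) <= angB H + pi - (angA F + pi + pi) <= 4 * pi by lra.
  by case: (adj_lift ht' lF (lift_b lB H) hr) => [[]|[]] e; exfalso; clear sH; lra.
- have [W lW hW] := lift_t lB lA fH hk.
  have ht' := ht; rewrite /touching hl in ht'.
  have hr : - (4 * pi) <= W - (angA F + pi + pi) <= 4 * pi by case: hW => -[_]; lra.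
  case: hW => -[s hW]; last by left.
  by exfalso; case: (adj_lift ht' lF lW hr) => [[]|[]] e; lra.
- case: sH => sH; last by right; split=> //; split=> //; left.
  exfalso; rewrite /opens_left in sH; have ht' := ht; rewrite /touching hk in ht'.
  have [d [d1 d2 d3]] := flat_side f2 (conj hB hA) ht' hl (fun E => fH (esym E)).
  have := dt_expand (nrm A (ci H)) (nrm B (cj F)) (nrm B (cj H)) d.
  have k1 : 0 < cr (nrm B (cj F)) (nrm B (cj H)).
    by apply: (cr_lift_gt0 (lB _) (lB _)); rewrite -/(angB F) -/(angB H); lra.
  have k2 : 0 < cr (nrm A (ci H)) (nrm B (cj H)).
    by rewrite crC oppr_gt0; apply: (cr_lift_lt0 (lB _) (lA _)); rewrite -/(angB H) -/(angA H); lra.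
  have k3 : 0 < cr (nrm A (ci H)) (nrm B (cj F)).
    by apply: (cr_lift_gt0 (lA _) (lift_2pi (lB _))); rewrite -/(angB F) -/(angA H); lra.
  have := mulr_gt0 d1 k1; have := mulr_le0_ge0 d2 (ltW k2); have := mulr_ge0 d3 (ltW k3); lra.
- case: sH => sH; last by right; split=> //; split=> //; right.
  exfalso; rewrite /opens_left in sH; have ht' := ht; rewrite /touching hk in ht'.
  have [d [d1 d2 d3]] := flat_side f1 h ht' hl fH.
  have := dt_expand (nrm B (cj H)) (nrm A (ci F)) (nrm A (ci H)) d.
  have k1 : cr (nrm A (ci F)) (nrm A (ci H)) < 0.
    by rewrite crC oppr_lt0; apply: (cr_lift_gt0 (lA _) (lA _)); rewrite -/(angA F) -/(angA H); lra.
  have k2 : cr (nrm B (cj H)) (nrm A (ci H)) < 0.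
    by apply: (cr_lift_lt0 (lB _) (lA _)); rewrite -/(angB H) -/(angA H); lra.
  have k3 : cr (nrm B (cj H)) (nrm A (ci F)) < 0.
    by apply: (cr_lift_lt0 (lB _) (lA _)); rewrite -/(angB H) -/(angA F); lra.
  have : dt (nrm B (cj H)) d * cr (nrm A (ci F)) (nrm A (ci H)) < 0 by rewrite pmulr_rlt0.
  have := mulr_le0 d2 (ltW k2); have := mulr_ge0_le0 d3 (ltW k3); lra.
- case: hk => ka kb.
  by exfalso; apply: (flat_third (car H) (conj f1 f2) h ht hl ka kb fH).
Qed.

(** If [G] and [H] open left, the third side of [H] forces [G] onto a side touched by [F]. If both
    open right, they lean on one free side of [F], against [same_support], or on two, and then the
    normal of [A] at [F] falls strictly between two angles of their contacts. If [G] opens left and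
    [H] right, the turns of more than pi from [F] to [H] leave no room for [H]. *)
Lemma flat_triangle F G H : flat F -> angA F = angB F + 2 * pi -> ~ flat G -> ~ flat H ->
  angB F < angB G -> angA G < angA F -> angB F < angB H -> angA H < angA F -> before G H ->
  disj (ct F) (ct G) -> disj (ct F) (ct H) -> disj (ct G) (ct H) ->
  adjacent F G -> adjacent F H -> adjacent G H -> False.
Proof.
move=> fF mF fG fH nG mG nH mH bGH dFG dFH dGH [l1 [k1 [z1 h1]]] [l2 [k2 [z2 h2]]] [l [k [z h]]].
have p0 := pi_gt0 R.
have [rG _] := nonflat_range fG; have [rH _] := nonflat_range fH; have [b1 b2] := bGH.
have np c : opens_left c -> opens_right c -> False by rewrite /opens_left /opens_right; lra.
have [f1 f2] := cP F; rewrite -[cb F]fF in f2.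
have [gA gB] := cP G.
have t1 := flat_touch fF mF fG nG mG h1; have t2 := flat_touch fF mF fH nH mH h2.
case: (types aA aB dAB lB lA sN sM fG fH bGH dGH h) => [[mG' mH' th hl]|[pG pH _ _]|[mG' pH' _]].
- case: t2 => [[_ [el th']]|[/(np _ mH') //]].
  have e := third_uniq fH th th'; subst k2; rewrite el in h2.
  case: hl => el'; rewrite el' in h.
    have [a a0 ha] := flat_same gA (nbr_sym h); have [b b0 hb] := flat_same f1 (nbr_sym h2).
    have e := prp_same_idx aA (prp_trans ha (prp_sym (lt0r_neq0 b0) hb)).
    by move: mG; rewrite /angA e ltxx.
  have [a a0 ha] := flat_same gB (nbr_sym h); have [b b0 hb] := flat_same f2 (nbr_sym h2).
  have e := prp_same_idx aB (prp_trans ha (prp_sym (lt0r_neq0 b0) hb)).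
  by move: nG; rewrite /angB e ltxx.
- case: t1 => [[/np /(_ pG) //]|[_ [e1 g1]]].
  case: t2 => [[/np /(_ pH) //]|[_ [e2 g2]]].
  case: (idx_dec l1 l2) => e.
    subst l2; exact: (same_support aA aB lB lA fG fH (or_introl bGH)
      (sides_uniq aA aB dAB dGH) dGH (car F) (cdA F) (cdB F) (nbr_sym h1) (nbr_sym h2) g1 g2).
  have base C l' k' z' : touching F l' C k' z' -> k' = ca C \/ k' = cb C ->
      exists s u U, [/\ 0 < s, (nrm (ct F) l').1 = s * u.1, (nrm (ct F) l').2 = s * u.2,
        lift u U & U = angA C \/ U = angB C].
    move=> ht [] ek; rewrite /touching ek in ht; have [hA hB] := cP C.
      have [s s0 /prp_nrm[q1 q2]] := flat_same hA (nbr_sym (nbr_sym ht)).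
      by exists s, (nrm A (ci C)), (angA C); split=> //; left.
    have [s s0 /prp_nrm[q1 q2]] := flat_same hB (nbr_sym (nbr_sym ht)).
    by exists s, (nrm B (cj C)), (angB C); split=> //; right.
  have [s [u [U [s0 u1 u2 lU hU]]]] := base _ _ _ _ h1 g1.
  have [t [v [V [t0 v1 v2 lV hV]]]] := base _ _ _ _ h2 g2.
  have [f [_ _ _ all3 [q1 q2]]] := third (ct F) e.
  have ef : f = ca F by case: (all3 (ca F)) => // E; [case: e1|case: e2].
  rewrite ef u1 u2 v1 v2 in q1 q2.
  have [r r0 /prp_nrm[r1 r2]] := oppA F.
  have rr : 0 < - r^-1 by rewrite oppr_gt0 invr_lt0.
  have rK : r^-1 * r = 1 by rewrite mulVf // lt_eqF.
  pose s' := - r^-1 * s; pose t' := - r^-1 * t.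
  have s'0 : 0 < s' by rewrite mulr_gt0.
  have t'0 : 0 < t' by rewrite mulr_gt0.
  have w1 : (nrm A (ci F)).1 = s' * u.1 + t' * v.1.
    by rewrite -[LHS]mul1r -rK -mulrA -r1 q1 /s' /t'; ring.
  have w2 : (nrm A (ci F)).2 = s' * u.2 + t' * v.2.
    by rewrite -[LHS]mul1r -rK -mulrA -r2 q2 /s' /t'; ring.
  rewrite /opens_right in pG pH.
  have rU : angB G <= U <= angA G by clear hV g1 g2 all3; case: hU => ->; lra.
  have rV : angB G <= V <= angA G by clear hU g1 g2 all3; case: hV => ->; lra.
  clear hU hV g1 g2 all3.
  have cF := cr_neq (car F) e; have lF := lA (ci F); rewrite -/(angA F) in lF.
  (* [angB F] and [angA F] are consecutive values of the angle of this normal, and the range of [G]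
     lies strictly between them. *)
  have no W : angB G < W < angA G -> lift (nrm A (ci F)) W -> False.
    move=> hW lW; have hr : - (2 * pi) <= W - angA F <= 2 * pi by lra.
    by case: (lift_uniq lF lW hr) => E; lra.
  case: (cmp3 U V) => UV.
  + have hr : U < V < U + pi by lra.
    have [W hW lW] := cone_lift lU lV hr s'0 t'0 w1 w2.
    by apply: (no W) => //; lra.
  + have hr : V < U < V + pi by lra.
    have w1' := w1; have w2' := w2; rewrite addrC in w1'; rewrite addrC in w2'.
    have [W hW lW] := cone_lift lV lU hr t'0 s'0 w1' w2'.
    by apply: (no W) => //; lra.
  + have [r' r'0 hr] := lift_cr lU lV.
    move: cF; rewrite /cr u1 u2 v1 v2.
    have -> : s * u.1 * (t * v.2) - s * u.2 * (t * v.1) = s * t * cr u v by rewrite /cr; ring.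
    by rewrite hr UV subrr sin0 !mulr0 eqxx.
- have [[c1 c2] _] := minus_plus aA aB dAB lB lA sN sM fG fH bGH dGH h mG' pH'.
  have w1 : angB F + pi < angB H.
    by case: sN => _ _ _ /(_ (cj F) (cj G) (cj H)); rewrite -/(angB F) -/(angB G) -/(angB H); lra.
  have w2 : angA H + pi < angA F.
    by case: sM => _ _ _ /(_ (ci H) (ci G) (ci F)); rewrite -/(angA F) -/(angA G) -/(angA H); lra.
  by have := rH; lra.
Qed.

Lemma before_flat F c : flat F -> angA F = angB F + 2 * pi -> ~ flat c ->
  before F c \/ before c F -> disj (ct F) (ct c) -> angB F < angB c /\ angA c < angA F.
Proof.
move=> fF mF fc bf d; have [r _] := nonflat_range fc; have [ni nj] := flat_neq fF d.
have [b1 b2] : before F c by case: bf => // -[]; rewrite /before; lra.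
split; rewrite lt_neqAle ?b1 ?b2 andbT; apply/eqP => e.
  by apply: nj; apply: (angB_eq sN); rewrite e.
by apply: ni; apply: (angA_eq sM).
Qed.

Lemma flat_first_triangle F G H : flat F -> angA F = angB F + 2 * pi -> ~ flat G -> ~ flat H ->
  before F G \/ before G F -> before F H \/ before H F -> before G H \/ before H G ->
  disj (ct F) (ct G) -> disj (ct F) (ct H) -> disj (ct G) (ct H) ->
  adjacent F G -> adjacent F H -> adjacent G H -> False.
Proof.
move=> fF mF fG fH b1 b2 b3 d1 d2 d3 t1 t2 t3.
have [r1 r2] := before_flat fF mF fG b1 d1; have [r3 r4] := before_flat fF mF fH b2 d2.
case: b3 => b3; first exact: (flat_triangle fF mF fG fH r1 r2 r3 r4 b3 d1 d2 d3 t1 t2 t3).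
exact: (flat_triangle fF mF fH fG r3 r4 r1 r2 b3 d2 d1 (disjC d3) t2 t1 (adjacent_sym t3)).
Qed.

Lemma nonflat_triangle c1 c2 c3 : ~ flat c1 -> ~ flat c2 -> ~ flat c3 ->
  before c1 c2 \/ before c2 c1 -> before c1 c3 \/ before c3 c1 ->
  before c2 c3 \/ before c3 c2 ->
  disj (ct c1) (ct c2) -> disj (ct c1) (ct c3) -> disj (ct c2) (ct c3) ->
  adjacent c1 c2 -> adjacent c1 c3 -> adjacent c2 c3 -> False.
Proof.
move=> f1 f2 f3 b12 b13 b23 d12 d13 d23 t12 t13 t23.
have d21 := disjC d12; have d31 := disjC d13; have d32 := disjC d23.
have t21 := adjacent_sym t12; have t31 := adjacent_sym t13; have t32 := adjacent_sym t23.
have no := no_triangle aA aB dAB lB lA sN sM.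
case: b12 => b12; case: b23 => b23.
- exact: (no c1 c2 c3).
- by case: b13 => b13; [exact: (no c1 c3 c2)|exact: (no c3 c1 c2)].
- by case: b13 => b13; [exact: (no c2 c1 c3)|exact: (no c2 c3 c1)].
- exact: (no c3 c2 c1).
Qed.

End Flat.

(** * Exchanging the two triangles *)

Section Swap.
Variable R : realType.
Variables (A B : tri R) (N M : idx -> R).

Lemma swap_crg (c : cnb A B N M) : (cb c = ca c /\
    (N (cj c) = M (ci c) - 2 * pi \/ N (cj c) = M (ci c) - 2 * pi + 2 * pi)) \/
  (cb c <> ca c /\ M (ci c) - 2 * pi < N (cj c) < M (ci c) - 2 * pi + 2 * pi /\
    N (cj c) <> M (ci c) - 2 * pi + pi).
Proof.
case: (crg c) => [[e h]|[e [h1 h2]]]; [left|right]; split.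
- by [].
- by case: h => ->; [right|left]; ring.
- by move=> E; apply: e.
- by split; [lra|move=> E; apply: h2; lra].
Qed.

(** Together with the shift by a full turn the exchange reverses the order, so that a flat neighbor
    in last place becomes one in first place. *)
Definition swap (c : cnb A B N M) : cnb B A (fun i => M i - 2 * pi) N :=
  Cnb (car c) (@cdB _ _ _ _ _ c) (@cdA _ _ _ _ _ c) (conj (proj2 (cP c)) (proj1 (cP c)))
    (swap_crg c).

Lemma swap_before (c d : cnb A B N M) : before c d -> before (swap d) (swap c).
Proof. by rewrite /before /angB /angA /=; lra. Qed.

Hypotheses (aA : 0 < ar A) (aB : 0 < ar B) (dAB : disj A B).
Hypotheses (lB : forall i, lift (nrm B i) (N i)) (lA : forall i, lift (nrm A i) (M i)).
Hypotheses (sN : spread N) (sM : spread M).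

Lemma flat_one_triangle (F G H : cnb A B N M) : flat F -> ~ flat G -> ~ flat H ->
  before F G \/ before G F -> before F H \/ before H F -> before G H \/ before H G ->
  disj (ct F) (ct G) -> disj (ct F) (ct H) -> disj (ct G) (ct H) ->
  adjacent F G -> adjacent F H -> adjacent G H -> False.
Proof.
move=> fF fG fH b1 b2 b3 d1 d2 d3 t1 t2 t3; have p0 := pi_gt0 R.
case: (crg F) => [[_ [mF|mF]]|[/(_ fF) //]]; last first.
  exact: (flat_first_triangle aA aB dAB lB lA sN sM fF mF fG fH b1 b2 b3 d1 d2 d3 t1 t2 t3).
have sw (c d : cnb A B N M) : before c d \/ before d c ->
    before (swap c) (swap d) \/ before (swap d) (swap c).
  by case=> /swap_before; [right|left].
have lA' i : lift (nrm A i) (M i - 2 * pi) by apply: lift_sub2pi.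
have sM' : spread (fun i => M i - 2 * pi).
  case: sM => s1 s2 s3 s4; split.
  - by move=> i j; have := s1 i j; lra.
  - by move=> i j; have := s2 i j; lra.
  - by move=> i j e; apply: s3; lra.
  - by move=> i j k h h'; have := s4 i j k; lra.
have fF' : flat (swap F) := esym fF.
have fG' : ~ flat (swap G) by move=> E; apply: fG; exact: (esym E).
have fH' : ~ flat (swap H) by move=> E; apply: fH; exact: (esym E).
have mF' : angA (swap F) = angB (swap F) + 2 * pi by move: mF; rewrite /angB /angA /= => ->; ring.
exact: (flat_first_triangle aB aA (disjC dAB) lA' lB sM' sN fF' mF' fG' fH'
  (sw _ _ b1) (sw _ _ b2) (sw _ _ b3) d1 d2 d3 t1 t2 t3).
Qed.

Lemma no_three (c1 c2 c3 : cnb A B N M) :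
  (~ flat c1 \/ ~ flat c2 -> before c1 c2 \/ before c2 c1) ->
  (~ flat c1 \/ ~ flat c3 -> before c1 c3 \/ before c3 c1) ->
  (~ flat c2 \/ ~ flat c3 -> before c2 c3 \/ before c3 c2) ->
  disj (ct c1) (ct c2) -> disj (ct c1) (ct c3) -> disj (ct c2) (ct c3) ->
  adjacent c1 c2 -> adjacent c1 c3 -> adjacent c2 c3 -> False.
Proof.
move=> b12 b13 b23 d12 d13 d23 t12 t13 t23.
have of1 := one_flat aA aB dAB d12; have of2 := one_flat aA aB dAB d13.
have of3 := one_flat aA aB dAB d23.
have d21 := disjC d12; have d31 := disjC d13; have d32 := disjC d23.
have t21 := adjacent_sym t12; have t31 := adjacent_sym t13; have t32 := adjacent_sym t23.
have or_sym (P Q : Prop) : P \/ Q -> Q \/ P by case=> h; [right|left].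
case: (idx_dec (ca c1) (cb c1)) => f1.
  have f2 := of1 f1; have f3 := of2 f1.
  exact: (flat_one_triangle f1 f2 f3 (b12 (or_intror f2)) (b13 (or_intror f3))
    (b23 (or_introl f2)) d12 d13 d23 t12 t13 t23).
case: (idx_dec (ca c2) (cb c2)) => f2.
  have f3 := of3 f2.
  exact: (flat_one_triangle f2 f1 f3 (or_sym _ _ (b12 (or_introl f1))) (b23 (or_intror f3))
    (b13 (or_introl f1)) d21 d23 d13 t21 t23 t13).
case: (idx_dec (ca c3) (cb c3)) => f3.
  exact: (flat_one_triangle f3 f1 f2 (or_sym _ _ (b13 (or_introl f1)))
    (or_sym _ _ (b23 (or_introl f2))) (b12 (or_introl f1)) d31 d32 d12 t31 t32 t12).
exact: (nonflat_triangle aA aB dAB lB lA sN sM f1 f2 f3 (b12 (or_introl f1))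
  (b13 (or_introl f1)) (b23 (or_introl f2)) d12 d13 d23 t12 t13 t23).
Qed.

End Swap.

(** * Counting *)

Section Pairs.
Variables (V : finType) (e : rel V).

Fixpoint pairs (s : seq V) : seq (V * V) :=
  if s is x :: s' then [seq (x, y) | y <- s'] ++ pairs s' else [::].

Lemma mem_pairs s x y : x \in s -> y \in s -> x != y ->
  ((x, y) \in pairs s) || ((y, x) \in pairs s).
Proof.
elim: s => //= z s IH; rewrite !inE !mem_cat.
case/orP=> [/eqP->|xs]; case/orP=> [/eqP->|ys] xy.
- by rewrite eqxx in xy.
- by rewrite (map_f (fun y => (z, y)) ys).
- by rewrite (map_f (fun y => (z, y)) xs) orbT.
- by case/orP: (IH xs ys xy) => ->; rewrite !orbT.
Qed.

Lemma card_common_edges (u v : V) (s : seq V) : symmetric e -> irreflexive e ->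
  common_neighbors e u v =i s ->
  (#|common_edges e u v| <= count (fun p => e p.1 p.2) (pairs s))%N.
Proof.
move=> es ei hs; rewrite -size_filter -(size_map (fun p : V * V => [set p.1; p.2]%SET)).
apply: leq_trans (card_size _); apply/subset_leq_card/fintype.subsetP => f.
rewrite inE => /andP[/imset2P[x y _]]; rewrite inE /= => exy -> /fintype.subsetP sub.
have xs : x \in s by rewrite -hs; apply: sub; rewrite !inE eqxx.
have ys : y \in s by rewrite -hs; apply: sub; rewrite !inE eqxx orbT.
have xy : x != y by apply: contraTneq exy => ->; rewrite ei.
case/orP: (mem_pairs xs ys xy) => h.
  by apply/mapP; exists (x, y) => //; rewrite mem_filter exy.
apply/mapP; exists (y, x); first by rewrite mem_filter /= es exy.
by rewrite /= finset.setUC.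
Qed.

End Pairs.

Lemma spread02 (R : realType) (L : idx -> R) : spread L ->
  (forall i j, (rk i <= rk j)%N -> L i <= L j) -> L I0 + pi < L I2.
Proof.
by move=> [_ _ s3 s4] o; apply: (s4 I0 I1 I2); rewrite lt_neqAle o // andbT; apply/eqP => /s3.
Qed.

Lemma rk_step (R : realType) (L : idx -> R) i j : spread L ->
  (forall i j, (rk i <= rk j)%N -> L i <= L j) ->
  L i < L j < L i + pi -> rk j = (rk i).+1.
Proof.
move=> sL o /andP[h1 h2]; have hs := spread02 sL o.
have ij : (rk i < rk j)%N by rewrite ltnNge; apply/negP => /o; rewrite leNgt h1.
case: i h1 h2 ij => /=; case: j => //= h1 h2 _.
by have := lt_trans hs h2; rewrite ltxx.
Qed.

(* The only facts about the four values of [kap] needed to count the edges: no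
   value is at distance at least 2 from all others, there is no isolated gap of
   length 2, and some two values differ by exactly 3. *)
Definition far (x y : nat) := (x + 2 <= y)%N || (y + 2 <= x)%N.

Definition four_values (l : seq nat) :=
  [&& all (fun x => ~~ all (fun y => (y == x) || far x y) l) l,
      all (fun x => (x.+2 \in l) ==> (x.+1 \in l)) l
    & has (fun x => (x + 3)%N \in l) l].

Lemma four_valuesP (a b c d : nat) (l := [:: a; b; c; d]) :
  all (fun x => x <= 4)%N l -> uniq l -> ~~ ((0%N \in l) && (4%N \in l)) -> four_values l.
Proof.
have H : all (fun a => all (fun b => all (fun c => all (fun d => let l := [:: a; b; c; d] in
    uniq l ==> ~~ ((0%N \in l) && (4%N \in l)) ==> four_values l)
    (iota 0 5)) (iota 0 5)) (iota 0 5)) (iota 0 5) by vm_compute.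
have mem x : (x <= 4)%N -> x \in iota 0 5 by rewrite mem_iota.
move=> ha' h1 h2; have /and5P[/mem ha /mem hb /mem hc /mem hd _] := ha'.
move/allP: H => /(_ _ ha) /allP /(_ _ hb) /allP /(_ _ hc) /allP /(_ _ hd).
by move=> /implyP /(_ h1) /implyP /(_ h2).
Qed.

(** * The bounds in normalized position *)

Section Core.
Variables (R : realType) (V : finType) (e : rel V) (T : V -> tri R) (u v : V).
Hypotheses (e_sym : symmetric e) (e_irr : irreflexive e) (neq_uv : u <> v).
Hypothesis aT : forall x, 0 < ar (T x).
Hypothesis dT : forall x y, x <> y -> disj (T x) (T y).
Hypothesis cT : forall x y, x <> y -> e x y ->
  exists i j p, relint (T x) i p /\ relint (T y) j p.
Hypotheses (bu : botT (T u)) (tv : topT (T v)).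
Variables (N M : idx -> R).
Hypothesis lB : forall i, lift (nrm (T v) i) (N i).
Hypothesis lA : forall i, lift (nrm (T u) i) (M i).
Hypotheses (sN : spread N) (sM : spread M).
Hypothesis rN : forall i, 0 <= N i <= 2 * pi.
Hypothesis rM : forall i, pi <= M i <= 3 * pi.
Hypothesis oN : forall i j, (rk i <= rk j)%N -> N i <= N j.
Hypothesis oM : forall i j, (rk i <= rk j)%N -> M i <= M j.
Notation cnb := (cnb (T u) (T v) N M).
Local Notation S := (common_neighbors e u v).

Lemma rk_inj i j : rk i = rk j -> i = j.
Proof. by case: i; case: j. Qed.

Lemma cnb_ex x : x \in S -> exists c : cnb, ct c = T x.
Proof.
rewrite !inE => /andP[eu ev].
have ux : u <> x by move=> E; move: eu; rewrite E e_irr.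
have vx : v <> x by move=> E; move: ev; rewrite E e_irr.
have [i [a [p [p1 p2]]]] := cT ux eu; have [j [b [q [q1 q2]]]] := cT vx ev.
have h : cn (T u) (T v) (T x) i j a b p q.
  by split; [apply: (nbrI (aT u) (aT x) (dT ux))|apply: (nbrI (aT v) (aT x) (dT vx))].
have r := cn_lifts (aT u) (aT v) (aT x) bu tv h (lB j) (lA i) (rN j) (rM i).
by exists (Cnb (aT x) (dT ux) (dT vx) h r).
Qed.

Variable K : V -> cnb.
Hypothesis KT : forall x, x \in S -> ct (K x) = T x.

(* Along the order of the contacts the side of [v] moves up and the side of [u]
   moves down, never both staying put, so [kap] is injective on [S]. *)
Definition kap (x : V) : nat := rk (cj (K x)) + (2 - rk (ci (K x))).

Lemma rk_le2 i : (rk i <= 2)%N. Proof. by case: i. Qed.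

Lemma kap_le4 x : (kap x <= 4)%N.
Proof. by have := rk_le2 (cj (K x)); rewrite /kap; lia. Qed.

Lemma K_disj x y : x \in S -> y \in S -> x <> y -> disj (ct (K x)) (ct (K y)).
Proof. by move=> /KT-> /KT-> /dT. Qed.

Lemma K_distinct x y : x \in S -> y \in S -> x <> y -> distinct (K x) (K y).
Proof.
by move=> hx hy xy; apply: (sides_uniq (aT u) (aT v) (dT neq_uv)); apply: K_disj.
Qed.

Lemma K_nonflat x y : x \in S -> y \in S -> x <> y -> ~ flat (K x) \/ ~ flat (K y).
Proof.
move=> hx hy xy; case: (idx_dec (ca (K x)) (cb (K x))) => h; last by left.
by right; apply: (one_flat (aT u) (aT v) (dT neq_uv) (K_disj hx hy xy) h).
Qed.

Definition rk_before x y := (rk (cj (K x)) <= rk (cj (K y)))%N /\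
  (rk (ci (K y)) <= rk (ci (K x)))%N.

Lemma K_cmp x y : x \in S -> y \in S -> x <> y -> rk_before x y \/ rk_before y x.
Proof.
move=> hx hy xy.
apply: (cn_comparable (aT u) (aT v) (car (K x)) (car (K y)) bu tv
  (@cdA _ _ _ _ _ (K x)) (@cdB _ _ _ _ _ (K x)) (@cdA _ _ _ _ _ (K y)) (@cdB _ _ _ _ _ (K y))
  (K_disj hx hy xy) (K_disj hy hx (fun E => xy (esym E))) (cP (K x)) (cP (K y))).
exact: K_nonflat.
Qed.

Lemma rk_beforeW x y : rk_before x y -> before (K x) (K y).
Proof. by move=> [/oN h1 /oM h2]; split. Qed.

Lemma kap_neq x y : x \in S -> y \in S -> x <> y -> kap x <> kap y.
Proof.
move=> hx hy xy E; apply: (K_distinct hx hy xy).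
have l1 := rk_le2 (ci (K x)); have l2 := rk_le2 (ci (K y)).
by case: (K_cmp hx hy xy) => -[h1 h2]; rewrite /kap in E; split; apply: rk_inj; lia.
Qed.

Lemma kap_before x y : x \in S -> y \in S -> (kap x < kap y)%N -> rk_before x y.
Proof.
move=> hx hy lt; have xy : x <> y by move=> E; move: lt; rewrite E ltnn.
case: (K_cmp hx hy xy) => // -[h1 h2]; exfalso; move: lt; rewrite /kap; lia.
Qed.

Lemma K_range x : N (cj (K x)) <= M (ci (K x)) <= N (cj (K x)) + 2 * pi.
Proof.
have p0 := pi_gt0 R; case: (crg (K x)) => [[_ [->|->]]|[_ [h _]]]; lra.
Qed.

(** The extreme values stand for the sides [I0] of [v] and [I2] of [u], and for [I2] of [v] and [I0]
    of [u]. From one to the other [N] grows and [M] drops by more than pi each, but [M - N] stays in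
    [0, 2 pi]. *)
Lemma kap04 x y : kap x = 0%N -> kap y = 4%N -> False.
Proof.
rewrite /kap => k1 k2; have p0 := pi_gt0 R.
have l1 := rk_le2 (ci (K x)); have l2 := rk_le2 (cj (K y)).
have e1 : cj (K x) = I0 by apply: rk_inj; rewrite /=; lia.
have e2 : ci (K x) = I2 by apply: rk_inj; rewrite /=; lia.
have e3 : cj (K y) = I2 by apply: rk_inj; rewrite /=; lia.
have e4 : ci (K y) = I0 by apply: rk_inj; rewrite /=; lia.
have := K_range x; have := K_range y; rewrite e1 e2 e3 e4 => h1 h2.
by have := spread02 sN oN; have := spread02 sM oM; lra.
Qed.

Lemma card_le4 : (#|S| <= 4)%N.
Proof.
pose f x : 'I_5 := inord (kap x).
have fE x : f x = kap x :> nat by rewrite inordK // ltnS kap_le4.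
have inj : {in S &, injective f}.
  move=> x y hx hy E; apply/eqP/negPn/negP => /eqP xy; apply: (kap_neq hx hy xy).
  by rewrite -!fE E.
rewrite -(card_in_imset inj) -ltnS ltn_neqAle; apply/andP; split; last first.
  by rewrite -[X in (_ <= X)%N](card_ord 5); apply: max_card.
apply/negP => /eqP E.
have full : [set f x | x in S]%SET = [set: 'I_5]%SET.
  by apply/eqP; rewrite eqEcard finset.subsetT /= cardsT card_ord E.
have /imsetP[x hx ex] : ord0 \in [set f x | x in S]%SET by rewrite full inE.
have /imsetP[y hy ey] : ord_max \in [set f x | x in S]%SET by rewrite full inE.
by apply: (@kap04 x y); rewrite -fE -?ex -?ey.
Qed.

Lemma K_touch x y : x \in S -> y \in S -> e x y -> adjacent (K x) (K y).
Proof.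
move=> hx hy exy; have xy : x <> y by move=> E; move: exy; rewrite E e_irr.
have [i [j [p [p1 p2]]]] := cT xy exy; exists i, j, p.
by rewrite /touching !KT //; apply: (nbrI (aT x) (aT y) (dT xy)).
Qed.

Lemma K_triangle x y z : x \in S -> y \in S -> z \in S ->
  x <> y -> x <> z -> y <> z -> e x y -> e x z -> e y z -> False.
Proof.
move=> hx hy hz xy xz yz exy exz eyz.
have cmp a b : a \in S -> b \in S -> a <> b -> before (K a) (K b) \/ before (K b) (K a).
  by move=> ha hb ab; case: (K_cmp ha hb ab) => /rk_beforeW; [left|right].
exact: (no_three (aT u) (aT v) (dT neq_uv) lB lA sN sM
  (fun _ => cmp _ _ hx hy xy) (fun _ => cmp _ _ hx hz xz) (fun _ => cmp _ _ hy hz yz)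
  (K_disj hx hy xy) (K_disj hx hz xz) (K_disj hy hz yz)
  (K_touch hx hy exy) (K_touch hx hz exz) (K_touch hy hz eyz)).
Qed.

(** No other neighbor touches either of the two sides touched by a flat one, so both ranks
    change. *)
Lemma flat_gap x y : x \in S -> y \in S -> x <> y -> flat (K x) ->
  (kap x + 2 <= kap y)%N \/ (kap y + 2 <= kap x)%N.
Proof.
move=> hx hy xy fx.
have [n1 n2] := flat_neq (aT u) (aT v) (dT neq_uv) fx (K_disj hx hy xy).
have r1 : rk (ci (K y)) <> rk (ci (K x)) by move=> /rk_inj.
have r2 : rk (cj (K y)) <> rk (cj (K x)) by move=> /rk_inj.
have l1 := rk_le2 (ci (K x)); have l2 := rk_le2 (ci (K y)).
by case: (K_cmp hx hy xy) => -[h1 h2]; rewrite /kap; [left|right]; lia.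
Qed.

(** Both angles change by less than pi, hence each of the two ranks by exactly one. *)
Lemma cross_sign x y : x \in S -> y \in S -> x <> y -> ~ flat (K x) -> ~ flat (K y) ->
  (kap x < kap y)%N -> e x y -> opens_left (K x) -> opens_right (K y) -> kap y = (kap x).+2.
Proof.
move=> hx hy xy fx fy lt exy mx py.
have [l [k [z h]]] := K_touch hx hy exy.
have b := rk_beforeW (kap_before hx hy lt).
have [[r1 r2] _] := minus_plus (aT u) (aT v) (dT neq_uv) lB lA sN sM fx fy b
  (K_disj hx hy xy) h mx py.
have := rk_step sN oN r1; have := rk_step sM oM r2.
have l1 := rk_le2 (ci (K x)); have l2 := rk_le2 (ci (K y)).
rewrite /kap; lia.
Qed.

Lemma same_sign x y z : x \in S -> y \in S -> z \in S ->
  ~ flat (K x) -> ~ flat (K y) -> ~ flat (K z) ->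
  (kap x < kap z)%N -> (kap z < kap y)%N -> e x y -> opens_left (K x) -> opens_right (K y) -> False.
Proof.
move=> hx hy hz fx fy fz l1 l2 exy mx py.
have xz : x <> z by move=> E; move: l1; rewrite E ltnn.
have zy : z <> y by move=> E; move: l2; rewrite E ltnn.
have xy : x <> y by move=> E; move: (ltn_trans l1 l2); rewrite E ltnn.
exact: (no_between (aT u) (aT v) (dT neq_uv) lB lA sN sM fx fz fy
  (rk_beforeW (kap_before hx hz l1)) (rk_beforeW (kap_before hz hy l2))
  (K_disj hx hz xz) (K_disj hx hy xy) (K_disj hz hy zy) mx py (K_touch hx hy exy)).
Qed.

Lemma not_plus_minus x y : x \in S -> y \in S -> ~ flat (K x) -> ~ flat (K y) ->
  (kap x < kap y)%N -> e x y -> opens_right (K x) -> opens_left (K y) -> False.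
Proof.
move=> hx hy fx fy lt exy px my.
have [b1 b2] := rk_beforeW (kap_before hx hy lt).
have [r1 _] := nonflat_range fx; have [r2 _] := nonflat_range fy.
by rewrite /opens_right /opens_left in px my; lra.
Qed.

(** A gap of 3 makes one of the two ranks run from one end to the other, a turn of more than pi. *)
Lemma far_signs x y : x \in S -> y \in S -> ~ flat (K x) -> ~ flat (K y) ->
  kap y = (kap x + 3)%N -> opens_left (K x) /\ opens_right (K y).
Proof.
move=> hx hy fx fy E.
have lt : (kap x < kap y)%N by rewrite E; lia.
have [q1 q2] := kap_before hx hy lt; have [b1 b2] := rk_beforeW (conj q1 q2).
have [r1 _] := nonflat_range fx; have [r2 _] := nonflat_range fy.
have [[e1 e2]|[e1 e2]] : (rk (cj (K x)) = 0%N /\ rk (cj (K y)) = 2) \/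
    (rk (ci (K x)) = 2 /\ rk (ci (K y)) = 0%N).
- have l1 := rk_le2 (ci (K x)); have l2 := rk_le2 (ci (K y)).
  have l3 := rk_le2 (cj (K x)); have l4 := rk_le2 (cj (K y)).
  by rewrite /kap in E; lia.
- have k1 : cj (K x) = I0 by apply: rk_inj.
  have k2 : cj (K y) = I2 by apply: rk_inj.
  have := spread02 sN oN; rewrite -k1 -k2 -/(angB (K x)) -/(angB (K y)) => h.
  rewrite /opens_left /opens_right; lra.
- have k1 : ci (K x) = I2 by apply: rk_inj.
  have k2 : ci (K y) = I0 by apply: rk_inj.
  have := spread02 sM oM; rewrite -k1 -k2 -/(angA (K x)) -/(angA (K y)) => h.
  rewrite /opens_left /opens_right; lra.
Qed.

Lemma edge_le3 (s : seq V) : S =i s -> uniq s -> (size s <= 3)%N ->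
  (count (fun p => e p.1 p.2) (pairs s) <= 2)%N.
Proof.
case: s => [|a [|b [|c [|//]]]] // hs; first by rewrite /= addn0; case: (e a b).
rewrite /= !inE !negb_or !addn0 andbT => /andP[/andP[ab ac] bc] _.
have [Sa Sb Sc] : [/\ a \in S, b \in S & c \in S] by rewrite !hs !inE !eqxx !orbT.
have := @K_triangle a b c Sa Sb Sc (elimN eqP ab) (elimN eqP ac) (elimN eqP bc).
by case: (e a b); case: (e a c); case: (e b c) => // /(_ isT isT isT).
Qed.

Lemma edge_le4 (a b c d : V) : S =i [:: a; b; c; d] -> uniq [:: a; b; c; d] ->
  (count (fun p => e p.1 p.2) (pairs [:: a; b; c; d]) <= 2)%N.
Proof.
move=> hs; rewrite /= !inE !negb_or andbT => /and3P[/and3P[ab ac ad] /andP[bc bd] cd].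
have [Sa Sb Sc Sd] : [/\ a \in S, b \in S, c \in S & d \in S].
  by rewrite !hs !inE !eqxx !orbT.
have kn x y : x \in S -> y \in S -> x != y -> kap x != kap y.
  by move=> hx hy /eqP xy; apply/eqP; apply: kap_neq.
pose l := [:: kap a; kap b; kap c; kap d].
have /and3P[/allP v1 /allP v2 v3] : four_values l.
  apply: four_valuesP; first by rewrite /= !kap_le4.
    by rewrite /= !inE !negb_or !kn.
  apply/negP => /andP[/(@mapP _ _ kap [:: a; b; c; d])[x _ /esym k0]].
  by move=> /(@mapP _ _ kap [:: a; b; c; d])[y _ /esym k4]; apply: (kap04 k0 k4).
have lS x : x \in S -> kap x \in l.
  by rewrite hs => hx; rewrite -[l]/(map kap [:: a; b; c; d]) map_f.
have Sl k : k \in l -> exists2 x, x \in S & kap x = k.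
  rewrite -[l]/(map kap [:: a; b; c; d]) => /mapP[x hx ->].
  by exists x => //; rewrite hs.
have S4 x : x \in S -> [\/ x = a, x = b, x = c | x = d].
  by rewrite hs !inE => /or4P[]/eqP->; [constructor 1|constructor 2|constructor 3|constructor 4].
(* By [flat_gap] the value of a flat neighbor would be at distance at least 2 from all the
   others. *)
have nf x : x \in S -> ~ flat (K x).
  move=> hx f; move/negP: (v1 _ (lS x hx)); apply; apply/allP => _ /Sl[y hy <-].
  case: (eqVneq (kap y) (kap x)) => //= ne.
  have xy : x <> y by move=> E; move: ne; rewrite E eqxx.
  by apply/orP; apply: (flat_gap hx hy xy f).
pose sg x := `[< opens_left (K x) >].
have sgP x : x \in S -> sg x = false -> opens_right (K x).
  by move=> /nf/nonflat_range[_ [h|//]] /asboolP.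
have btw x y : x \in S -> y \in S -> kap y = (kap x).+2 ->
    exists2 z, z \in S & kap z = (kap x).+1.
  move=> hx hy E; apply: Sl; apply: (implyP (v2 _ (lS x hx))).
  by rewrite -E; apply: lS.
(* An edge between opposite openings would join values at distance 2 with no value between them,
   which is an isolated gap. *)
have mix x y : x \in S -> y \in S -> (kap x < kap y)%N -> e x y -> sg x = sg y.
  move=> hx hy lt exy; have xy : x <> y by move=> E; move: lt; rewrite E ltnn.
  case Ex: (sg x); case Ey: (sg y) => //; exfalso.
    have mx : opens_left (K x) by apply/asboolP.
    have E := cross_sign hx hy xy (nf x hx) (nf y hy) lt exy mx (sgP y hy Ey).
    have [z hz Ez] := btw x y hx hy E.
    by apply: (same_sign hx hy hz (nf x hx) (nf y hy) (nf z hz) _ _ exy mx (sgP y hy Ey)); rewrite ?E Ez.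
  have my : opens_left (K y) by apply/asboolP.
  exact: (not_plus_minus hx hy (nf x hx) (nf y hy) lt exy (sgP x hx Ex) my).
have mono x y : x \in S -> y \in S -> x != y -> e x y ==> (sg x == sg y).
  move=> hx hy /eqP xy; apply/implyP => exy; apply/eqP.
  have := kap_neq hx hy xy; case: (ltngtP (kap x) (kap y)) => // h _; first exact: mix.
  by symmetry; apply: mix => //; rewrite e_sym.
have two : [|| sg a != sg b, sg a != sg c | sg a != sg d].
  have [x [y [hx hy E]]] : exists x y, [/\ x \in S, y \in S & kap y = (kap x + 3)%N].
    by case/hasP: v3 => _ /Sl[x hx <-] /Sl[y hy Ey]; exists x, y.
  have [mx py] := far_signs hx hy (nf x hx) (nf y hy) E.
  have sx : sg x = true by apply/asboolP.
  have sy : sg y = false by apply/asboolP; move: py; rewrite /opens_left /opens_right; lra.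
  apply/negPn/negP; rewrite !negb_or !negbK => /and3P[/eqP eb /eqP ec /eqP ed].
  have al z : z \in S -> sg z = sg a by move=> /S4[]->.
  by move: sx; rewrite al // -(al y) // sy.
have tri x y z : x \in S -> y \in S -> z \in S -> x != y -> x != z -> y != z ->
    ~~ [&& e x y, e x z & e y z].
  move=> hx hy hz /eqP xy /eqP xz /eqP yz; apply/negP => /and3P[h1 h2 h3].
  exact: (K_triangle hx hy hz xy xz yz h1 h2 h3).
have t1 := tri a b c Sa Sb Sc ab ac bc; have t2 := tri a b d Sa Sb Sd ab ad bd.
have t3 := tri a c d Sa Sc Sd ac ad cd; have t4 := tri b c d Sb Sc Sd bc bd cd.
have m1 := mono a b Sa Sb ab; have m2 := mono a c Sa Sc ac; have m3 := mono a d Sa Sd ad.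
have m4 := mono b c Sb Sc bc; have m5 := mono b d Sb Sd bd; have m6 := mono c d Sc Sd cd.
rewrite /= !addn0.
move: t1 t2 t3 t4 m1 m2 m3 m4 m5 m6 two.
by case: (sg a); case: (sg b); case: (sg c); case: (sg d); case: (e a b); case: (e a c);
  case: (e a d); case: (e b c); case: (e b d); case: (e c d).
Qed.

Lemma core_edges : (#|common_edges e u v| <= 2)%N.
Proof.
have hs : S =i enum S by move=> x; rewrite mem_enum.
have us := enum_uniq (mem S); have sz : (size (enum S) <= 4)%N by rewrite -cardE card_le4.
apply: leq_trans (card_common_edges e_sym e_irr hs) _.
move: (enum S) hs us sz => s; case: (leqP (size s) 3) => [le3 hs us _|lt3 hs us sz].
  exact: edge_le3.
by case: s lt3 hs us sz => [|a [|b [|c [|d [|]]]]] // _ hs us _; apply: edge_le4.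
Qed.

End Core.

(** * Separating two triangles *)

Section Elimination.
Variable R : realFieldType.

Lemma seq_max (s : seq R) : s <> [::] -> exists2 a, a \in s & forall b, b \in s -> b <= a.
Proof.
elim: s => // x s IH _; case: s IH => [|y s] IH.
  by exists x; [rewrite inE|move=> b; rewrite inE => /eqP->].
have [//|a ha h] := IH; exists (Num.max x a).
  by rewrite inE; case: (leP x a) => _; rewrite ?ha ?orbT // eqxx.
by move=> b; rewrite inE le_max => /orP[/eqP->|/h ->]; rewrite ?lexx ?orbT.
Qed.

Lemma seq_sep (s t : seq R) : (forall a b, a \in s -> b \in t -> a < b) ->
  exists y, (forall a, a \in s -> a < y) /\ (forall b, b \in t -> y < b).
Proof.
move=> h.
have tm : t <> [::] -> exists2 a, a \in t & forall b, b \in t -> a <= b.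
  move=> tn; have [|a] := @seq_max [seq - x | x <- t]; first by case: (t) tn.
  move=> /mapP[x hx ->] k; exists x => // b hb.
  by rewrite -lerN2; apply: k; apply: map_f.
case: (eqVneq s [::]) => [->|/eqP/seq_max[a ha ka]]; case: (eqVneq t [::]) => [->|/eqP/tm[b hb kb]].
- by exists 0; split.
- by exists (b - 1); split=> // c /kb; lra.
- by exists (a + 1); split=> // c /ka; lra.
- exists ((a + b) / 2); have := h _ _ ha hb; split=> c.
    by move/ka; lra.
  by move/kb; lra.
Qed.

(** A negative leading coefficient bounds [y] from below and a positive one from above; the second
    hypothesis says that every lower bound is less than every upper bound. *)
Lemma elim1 (s : seq (R * R)) : (forall p, p \in s -> p.1 = 0 -> p.2 < 0) ->
  (forall p q, p \in s -> q \in s -> 0 < p.1 -> q.1 < 0 -> p.1 * q.2 - q.1 * p.2 < 0) ->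
  exists y, forall p, p \in s -> p.1 * y + p.2 < 0.
Proof.
move=> h0 h.
have [|y [hy1 hy2]] := @seq_sep [seq - q.2 / q.1 | q <- s & q.1 < 0]
    [seq - p.2 / p.1 | p <- s & 0 < p.1].
  move=> a b /mapP[q + ->] /mapP[p + ->]; rewrite !mem_filter => /andP[q0 qs] /andP[p0 ps].
  have := h p q ps qs p0 q0 => k.
  rewrite ltr_pdivlMr // mulrAC ltr_ndivrMr //; lra.
exists y => p ps; case: (ltrgtP p.1 0) => e.
- have /hy1 : - p.2 / p.1 \in [seq - q.2 / q.1 | q <- s & q.1 < 0].
    by apply/mapP; exists p => //; rewrite mem_filter e.
  by rewrite ltr_ndivrMr //; lra.
- have /hy2 : - p.2 / p.1 \in [seq - p.2 / p.1 | p <- s & 0 < p.1].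
    by apply/mapP; exists p => //; rewrite mem_filter e.
  by rewrite ltr_pdivlMr //; lra.
- by rewrite e mul0r add0r h0.
Qed.

(* [((a, b), c)] stands for the affine map (x, y) |-> a x + b y + c. *)
Definition aff := (R * R * R)%type.
Definition ev (f : aff) (p : R * R) := f.1.1 * p.1 + f.1.2 * p.2 + f.2.
Definition mix (k l : R) (f g : aff) : aff :=
  (k * f.1.1 + l * g.1.1, k * f.1.2 + l * g.1.2, k * f.2 + l * g.2).

(* Fourier-Motzkin elimination of the two variables; [P] keeps track of the
   constraints that were combined into the contradictory constant [h]. *)
Lemma motzkin (P : aff -> Prop) (s : seq aff) :
  (forall k l f g, 0 < k -> 0 < l -> P f -> P g -> P (mix k l f g)) ->
  (forall f, f \in s -> P f) ->
  (exists p, forall f, f \in s -> ev f p < 0) \/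
  (exists h, [/\ P h, h.1.1 = 0, h.1.2 = 0 & 0 <= h.2]).
Proof.
move=> Pm Ps.
(* The system left for the first unknown: the constraints free of the second one, and a combination
   for each pair with opposite signs there. *)
pose s1 := [seq (f.1.1, f.2) | f <- s & f.1.2 == 0] ++
  [seq (fg.1.1.2 * fg.2.1.1 - fg.2.1.2 * fg.1.1.1, fg.1.1.2 * fg.2.2 - fg.2.1.2 * fg.1.2)
    | fg <- [seq (f, g) | f <- [seq f <- s | 0 < f.1.2], g <- [seq g <- s | g.1.2 < 0]]].
have P1 p : p \in s1 -> P (p.1, 0, p.2).
  rewrite mem_cat => /orP[/mapP[f + ->]|/mapP[fg + ->]].
    rewrite mem_filter => /andP[/eqP e /Ps]; case: f e => -[a b] c /= -> //.
  move=> /allpairsP[[f g] [/= + + ->]] /=; rewrite !mem_filter => /andP[f0 /Ps hf] /andP[g0 /Ps hg].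
  have := Pm (f.1.2) (- g.1.2) g f f0 _ hg hf; rewrite oppr_gt0 => /(_ g0); rewrite /mix.
  have -> : f.1.2 * g.1.2 + - g.1.2 * f.1.2 = 0 by ring.
  by rewrite !mulNr.
have [bad|good0] := boolP (has (fun p => (p.1 == 0) && (0 <= p.2)) s1).
  right; move/hasP: bad => [p /P1 hp /andP[/eqP e k]].
  by exists (p.1, 0, p.2).
have [bad|good1] := boolP (has (fun pq => [&& 0 < pq.1.1, pq.2.1 < 0 &
    0 <= pq.1.1 * pq.2.2 - pq.2.1 * pq.1.2]) [seq (p, q) | p <- s1, q <- s1]).
  right; move/hasP: bad => [_ /allpairsP[[p q] [/= hp hq ->]] /and3P[/= p0 q0 k]].
  have q0' : 0 < - q.1 by rewrite oppr_gt0.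
  exists (mix p.1 (- q.1) (q.1, 0, q.2) (p.1, 0, p.2)); split.
  - exact: Pm (P1 _ hq) (P1 _ hp).
  - by rewrite /=; ring.
  - by rewrite /=; ring.
  - by rewrite /=; lra.
left; have [||x hx] := @elim1 s1.
- move=> p ps e; rewrite ltNge; apply/negP => k.
  by move/hasPn: good0 => /(_ _ ps); rewrite e eqxx k.
- move=> p q ps qs p0 q0; rewrite ltNge; apply/negP => k.
  move/hasPn: good1 => /(_ (p, q)); rewrite allpairs_f //= p0 q0 k => /(_ isT) //.
have [||y hy] := @elim1 [seq (f.1.2, f.1.1 * x + f.2) | f <- s].
- move=> _ /mapP[f fs ->] /= e.
  have /hx : (f.1.1, f.2) \in s1 by rewrite mem_cat (map_f (fun f : aff => (f.1.1, f.2))) // mem_filter e eqxx.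
  by [].
- move=> _ _ /mapP[f fs ->] /mapP[g gs ->] /= f0 g0.
  have /hx : (f.1.2 * g.1.1 - g.1.2 * f.1.1, f.1.2 * g.2 - g.1.2 * f.2) \in s1.
    rewrite mem_cat; apply/orP; right; apply/mapP; exists (f, g) => //.
    by apply: allpairs_f; rewrite mem_filter ?f0 ?g0.
  rewrite /=; lra.
exists (x, y) => f fs; have /hy : (f.1.2, f.1.1 * x + f.2) \in [seq (f.1.2, f.1.1 * x + f.2) | f <- s].
  exact: (map_f (fun f : aff => (f.1.2, f.1.1 * x + f.2))).
rewrite /ev /=; lra.
Qed.

Implicit Types A B T : tri R.

Definition sda T i : aff := (nrm T i, - dt (nrm T i) (T i)).

Lemma ev_sda T i p : ev (sda T i) p = sd T i p.
Proof. by rewrite /ev /sda /sd /dt /dif /=; ring. Qed.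

(* The side conditions in [P] exclude the trivial combination 0 = 0 + 0. *)
Lemma separation A B : 0 < ar A -> 0 < ar B -> disj A B -> exists f : aff,
  [/\ 0 < f.1.1 * f.1.1 + f.1.2 * f.1.2, forall p, inn A p -> ev f p <= 0
    & forall p, inn B p -> 0 <= ev f p].
Proof.
move=> aA aB d.
(* What is retained of a nonnegative combination of the functions [sd T i]. *)
pose Q T (f : aff) := (forall p, inn T p -> ev f p <= 0) /\
  ((forall p, ev f p = 0) \/ forall p, inner T p -> ev f p < 0).
pose P h := exists f g, [/\ forall p, ev h p = ev f p + ev g p, Q A f, Q B g &
  ~ ((forall p, ev f p = 0) /\ (forall p, ev g p = 0))].
have z0 p : ev (0, 0, 0) p = 0 by rewrite /ev /=; ring.
have evm k l f g p : ev (mix k l f g) p = k * ev f p + l * ev g p by rewrite /ev /mix /=; ring.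
have Q0 T : Q T (0, 0, 0) by split=> [p _|]; [rewrite z0|left].
have Qs T i : Q T (sda T i) by split=> [p h|]; [rewrite ev_sda|right=> p h; rewrite ev_sda].
have sdn T i : 0 < ar T -> ~ (forall p, ev (sda T i) p = 0).
  by move=> /inn_has_int[g hg] /(_ g); rewrite ev_sda => e; have := hg i; rewrite e ltxx.
have Qm T k l f g : 0 < ar T -> 0 < k -> 0 < l -> Q T f -> Q T g -> Q T (mix k l f g) /\
    ((forall p, ev (mix k l f g) p = 0) -> (forall p, ev f p = 0) /\ forall p, ev g p = 0).
  move=> aT k0 l0 [f1 f2] [g1 g2]; have [q hq] := inn_has_int aT.
  have hqi := int_inn hq; split; first split.
  - move=> p h; rewrite evm.
    by have := mulr_ge0_le0 (ltW k0) (f1 p h); have := mulr_ge0_le0 (ltW l0) (g1 p h); lra.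
  - case: f2 => f2; [case: g2 => g2; [left=> p; rewrite evm f2 g2; ring|right=> p h]|right=> p h]; rewrite evm.
      by rewrite f2 mulr0 add0r pmulr_rlt0 //; apply: g2.
    have := mulr_ge0_le0 (ltW l0) (g1 p (int_inn h)).
    have : k * ev f p < 0 by rewrite pmulr_rlt0 //; apply: f2.
    by lra.
  - move=> z; have := z q; rewrite evm => e.
    have e1 := mulr_ge0_le0 (ltW l0) (g1 q hqi); have e2 := mulr_ge0_le0 (ltW k0) (f1 q hqi).
    split.
      case: f2 => // /(_ q hq) f2; have : k * ev f q < 0 by rewrite pmulr_rlt0.
      lra.
    case: g2 => // /(_ q hq) g2; have : l * ev g q < 0 by rewrite pmulr_rlt0.
    lra.
have Pm k l h h' : 0 < k -> 0 < l -> P h -> P h' -> P (mix k l h h').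
  move=> k0 l0 [f [g [e qf qg ne]]] [f' [g' [e' qf' qg' ne']]].
  exists (mix k l f f'), (mix k l g g').
  have [r1 r2] := Qm A k l f f' aA k0 l0 qf qf'; have [r3 r4] := Qm B k l g g' aB k0 l0 qg qg'.
  split=> // [p|[/r2[z1 _] /r4[z2 _]]]; first by rewrite !evm e e'; ring.
  by apply: ne.
have PA i : P (sda A i).
  exists (sda A i), (0, 0, 0); split=> // [p|[/sdn]]; first by rewrite z0 addr0.
  exact.
have PB i : P (sda B i).
  exists (0, 0, 0), (sda B i); split=> // [p|[_ /sdn]]; first by rewrite z0 add0r.
  exact.
have [|[p hp]|[h [[f [g [e [f1 f2] [g1 g2] ne]]] h1 h2 h3]]] := @motzkin P
  [:: sda A I0; sda A I1; sda A I2; sda B I0; sda B I1; sda B I2] Pm.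
- by move=> f; rewrite !inE => /or4P[/eqP->|/eqP->|/eqP->|/or3P[]/eqP->].
- exfalso; apply: (d p) => i; rewrite -ev_sda; apply: hp.
    by case: i; rewrite !inE eqxx ?orbT.
  by case: i; rewrite !inE eqxx ?orbT.
(* The two parts add up to a nonnegative constant, so [f] is nonnegative on [B], where [g] is not
   positive. *)
have ec p : ev f p + ev g p = h.2 by rewrite -e /ev h1 h2; ring.
have [q hq] := inn_has_int aA; have [r hr] := inn_has_int aB.
have fA : ev f q < 0.
  case: f2 => [z|/(_ q hq) //]; exfalso; case: g2 => [z'|/(_ r hr) gr]; first exact: ne.
  by have := ec r; rewrite z add0r => E; rewrite E in gr; lra.
exists f; split=> // [|p hp]; last by have := ec p; have := g1 p hp; lra.
rewrite lt_neqAle addr_ge0 ?andbT -?expr2 ?sqr_ge0 // eq_sym paddr_eq0 ?sqr_ge0 //.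
rewrite !sqrf_eq0; apply/negP => /andP[/eqP a0 /eqP b0].
have := ec r; have := g1 r (int_inn hr).
have -> : ev f r = ev f q by rewrite /ev a0 b0; ring.
lra.
Qed.

End Elimination.

(** * Moving the separating line to the axis *)

Section Normalize.
Variable R : realType.
Implicit Types (T : tri R) (p : R * R).

Definition sim (T T' : tri R) := [/\ ar T' = ar T, forall p, inner T' p -> inner T p,
  forall i p, relint T i p -> exists i', relint T' i' p & forall i, exists i', T' i = T i'].

Lemma sim_refl T : sim T T.
Proof. by split=> // [i p h|i]; exists i. Qed.

(** Cyclic renumbering puts the largest corner first and keeps the orientation. *)
Lemma rotate T (h : R * R -> R) : exists T', [/\ sim T T', h (T' I1) <= h (T' I0) &
  h (T' I2) <= h (T' I0)].
Proof.
have H1 : sim T (fun i => T (nxt i)).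
  have e i p : sd (fun i => T (nxt i)) i p = sd T (nxt i) p by case: i.
  split.
  - by rewrite /ar /cr /dif /=; ring.
  - by move=> p hp; case; [have := hp I2|have := hp I0|have := hp I1]; rewrite e.
  - move=> i p [h0 hi]; exists (nxt (nxt i)); split; first by rewrite e; case: i h0 {hi}.
    by move=> k hk; rewrite e; apply: hi => E; apply: hk; rewrite -E; case: (k).
  - by move=> i; exists (nxt i).
have H2 : sim T (fun i => T (nxt (nxt i))).
  have e i p : sd (fun i => T (nxt (nxt i))) i p = sd T (nxt (nxt i)) p by case: i.
  split.
  - by rewrite /ar /cr /dif /=; ring.
  - by move=> p hp; case; [have := hp I1|have := hp I2|have := hp I0]; rewrite e.
  - move=> i p [h0 hi]; exists (nxt i); split; first by rewrite e; case: i h0 {hi}.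
    by move=> k hk; rewrite e; apply: hi => E; apply: hk; rewrite -E; case: (k).
  - by move=> i; exists (nxt (nxt i)).
have [a|a] := lerP (h (T I1)) (h (T I0)).
  have [b|b] := lerP (h (T I2)) (h (T I0)).
    by exists T; split=> //; apply: sim_refl.
  by exists (fun i => T (nxt (nxt i))); split=> //=; rewrite ?(ltW b) // (le_trans a) // ltW.
have [b|b] := lerP (h (T I2)) (h (T I1)).
  by exists (fun i => T (nxt i)); split=> //=; rewrite ltW.
by exists (fun i => T (nxt (nxt i))); split=> //=; rewrite ltW // (lt_trans a).
Qed.

Lemma vertex_inn T i : 0 < ar T -> inn T (T i).
Proof.
move=> aT k.
have : sd T k (T i) = 0 \/ sd T k (T i) = - ar T.
  by case: k; case: i; rewrite /sd /ar /cr /dt /dif /nrm /=; (left; ring) || (right; ring).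
by case=> ->; rewrite ?lexx // oppr_le0 ltW.
Qed.

Section Plane.
Variables (V : finType) (e : rel V).
Hypotheses (e_sym : symmetric e) (e_irr : irreflexive e).

Definition config (T : V -> tri R) := [/\ forall x, 0 < ar (T x),
  forall x y, x <> y -> disj (T x) (T y) &
  forall x y, x <> y -> e x y -> exists i j p, relint (T x) i p /\ relint (T y) j p].

Lemma config_sim (T T' : V -> tri R) : config T -> (forall x, sim (T x) (T' x)) -> config T'.
Proof.
move=> [h1 h2 h3] hs; split.
- by move=> x; have [-> _ _ _] := hs x.
- move=> x y xy p; have [_ k1 _ _] := hs x; have [_ k2 _ _] := hs y.
  by move=> /k1 q1 /k2 q2; apply: (h2 x y xy p).
- move=> x y xy exy; have [i [j [p [p1 p2]]]] := h3 x y xy exy.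
  have [_ _ k1 _] := hs x; have [_ _ k2 _] := hs y.
  by have [i' r1] := k1 _ _ p1; have [j' r2] := k2 _ _ p2; exists i', j', p.
Qed.

Lemma normalized_bounds (T : V -> tri R) u v : config T -> u <> v -> botT (T u) -> topT (T v) ->
  (#|common_neighbors e u v| <= 4)%N /\ (#|common_edges e u v| <= 2)%N.
Proof.
move=> [aT dT cT] uv bu tv.
have [N [lN sN rN oN]] := top_lifts (aT v) tv.
have [M [lM sM rM oM]] := bot_lifts (aT u) bu.
case: (pickP (mem (common_neighbors e u v))) => [x0 hx0|h0]; last first.
  split; first by rewrite (eq_card0 h0).
  have hs : common_neighbors e u v =i [::] by move=> x; have := h0 x.
  exact: leq_trans (card_common_edges e_sym e_irr hs) _.
have ex := cnb_ex e_irr aT dT cT bu tv lN lM rN rM.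
(* [c0] is the default value of [K] outside the common neighbors. *)
have [c0 _] := ex x0 hx0.
have /choice[K hK] : forall x, exists c : cnb (T u) (T v) N M,
    x \in common_neighbors e u v -> ct c = T x.
  move=> x; case: (boolP (x \in common_neighbors e u v)) => [/ex[c hc]|_]; last by exists c0.
  by exists c.
split.
  exact: (card_le4 uv aT dT bu tv sN sM oN oM hK).
exact: (core_edges e_sym e_irr uv aT dT cT bu tv lN lM sN sM oN oM hK).
Qed.

Lemma plane_bounds (T : V -> tri R) u v : config T -> u <> v ->
  (#|common_neighbors e u v| <= 4)%N /\ (#|common_edges e u v| <= 2)%N.
Proof.
move=> cT uv; have [aT dT hT] := cT.
have [f [f0 fu fv]] := separation (aT u) (aT v) (dT u v uv).
set a := f.1.1 in f0; set b := f.1.2 in f0; set D := a * a + b * b in f0.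
(* A direct similarity, multiplying areas by [D], that takes the separating line to the horizontal
   axis; [Psi] is its inverse. *)
pose Phi p : R * R := (b * p.1 - a * p.2, ev f p).
pose Psi p : R * R := ((b * p.1 + a * (p.2 - f.2)) / D, (b * (p.2 - f.2) - a * p.1) / D).
have PhiK p : Phi (Psi p) = p.
  rewrite [RHS]surjective_pairing /Phi /Psi /ev /= -/a -/b; congr (_, _).
    have -> : b * ((b * p.1 + a * (p.2 - f.2)) / D) - a * ((b * (p.2 - f.2) - a * p.1) / D) =
      p.1 * (D / D) by rewrite {3}/D; ring.
    by rewrite divff ?gt_eqF // mulr1.
  have -> : a * ((b * p.1 + a * (p.2 - f.2)) / D) + b * ((b * (p.2 - f.2) - a * p.1) / D) + f.2 =
      (p.2 - f.2) * (D / D) + f.2 by rewrite {3}/D; ring.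
  by rewrite divff ?gt_eqF // mulr1 subrK.
pose T1 x : tri R := fun i => Phi (T x i).
have sd1 x i p : sd (T1 x) i (Phi p) = D * sd (T x) i p.
  by rewrite /T1 /Phi /ev /sd /dt /dif /nrm /= -/a -/b /D; ring.
have c1 : config T1.
  split.
  - move=> x; have -> : ar (T1 x) = D * ar (T x).
      by rewrite /T1 /Phi /ev /ar /cr /dif /= -/a -/b /D; ring.
    exact: mulr_gt0.
  - move=> x y xy p h1 h2; apply: (dT x y xy (Psi p)) => i.
      by have := h1 i; rewrite -[p in X in X -> _]PhiK sd1 pmulr_rlt0.
    by have := h2 i; rewrite -[p in X in X -> _]PhiK sd1 pmulr_rlt0.
  - move=> x y xy /(hT x y xy)[i [j [p [[p1 p2] [q1 q2]]]]]; exists i, j, (Phi p).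
    split; split; rewrite ?sd1 ?p1 ?q1 ?mulr0 // => k hk; rewrite sd1 pmulr_rlt0 //.
      exact: p2.
    exact: q2.
have yu i : (T1 u i).2 <= 0 by apply: fu; apply: vertex_inn.
have yv i : 0 <= (T1 v i).2 by apply: fv; apply: vertex_inn.
have [A [sA A1 A2]] := rotate (T1 u) (fun p => - p.2).
have [B [sB B1 B2]] := rotate (T1 v) (fun p => p.2).
pose T2 x := if x == u then A else if x == v then B else T1 x.
have vu : (v == u) = false by apply/eqP => E; apply: uv.
have c2 : config T2.
  apply: (config_sim c1) => x; rewrite /T2.
  case: eqP => [->//|_]; case: eqP => [->//|_]; exact: sim_refl.
apply: (normalized_bounds c2 uv); rewrite /T2 ?vu eqxx.
  split; first by split.
  by move=> i; have [_ _ _ /(_ i)[i' E]] := sA; rewrite /opp /= E oppr_ge0.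
split; first by split.
by move=> i; have [_ _ _ /(_ i)[i' ->]] := sB.
Qed.

End Plane.
End Normalize.

(** * From point sets to triangles *)

Section Bridge.
Local Open Scope classical_set_scope.
Local Open Scope ring_scope.
Variable R : realType.
Implicit Types (T : tri R) (p q : R * R) (x y a b c : 'rV[R]_2).

Definition pr x : R * R := (x 0 0, x 0 1).
Definition rp p : 'rV[R]_2 := \row_(j < 2) (if j == 0 then p.1 else p.2).

Lemma rpK p : pr (rp p) = p.
Proof. by rewrite /pr !mxE /=; case: p. Qed.

Lemma pr_inj x y : pr x = pr y -> x = y.
Proof.
move=> [h0 h1]; apply/rowP => -[[|[|//]] lt].
  by rewrite (_ : Ordinal lt = 0) //; apply: val_inj.
by rewrite (_ : Ordinal lt = 1) //; apply: val_inj.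
Qed.

Lemma inn_conv T a b c : 0 < ar T -> T I0 = pr a -> T I1 = pr b -> T I2 = pr c ->
  forall x, conv3 a b c x <-> inn T (pr x).
Proof.
move=> aT e0 e1 e2 x; split.
  move=> [r [s [t [r0 s0 t0 rst ->]]]] i.
  have [h0 h1 h2] : [/\ sd T I0 (pr (r *: a + s *: b + t *: c)) = - (t * ar T),
      sd T I1 (pr (r *: a + s *: b + t *: c)) = - (r * ar T) &
      sd T I2 (pr (r *: a + s *: b + t *: c)) = - (s * ar T)].
    have -> : r = 1 - s - t by lra.
    rewrite /sd /ar /cr /dt /dif /nrm /= e0 e1 e2 /pr !mxE /=; split; ring.
  by case: i; rewrite ?h0 ?h1 ?h2 oppr_le0 mulr_ge0 // ltW.
move=> h; have hs := sd_sum T (pr x).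
(* The weight of a corner comes from the side opposite to it. *)
exists (- sd T I1 (pr x) / ar T), (- sd T I2 (pr x) / ar T), (- sd T I0 (pr x) / ar T).
have nn i : 0 <= - sd T i (pr x) / ar T by rewrite divr_ge0 ?oppr_ge0 // ltW.
split=> //.
  by rewrite -!mulrDl; apply: (canLR (mulfK (lt0r_neq0 aT))); rewrite mul1r; lra.
have D0 := lt0r_neq0 aT; apply: pr_inj; rewrite /pr !mxE /=; congr (_, _).
  rewrite !(mulrAC _ (ar T)^-1) -!mulrDl; apply: (canRL (mulfK D0)).
  have -> : a 0 0 = (T I0).1 by rewrite e0.
  have -> : b 0 0 = (T I1).1 by rewrite e1.
  have -> : c 0 0 = (T I2).1 by rewrite e2.
  by rewrite /sd /ar /cr /dt /dif /nrm /=; ring.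
rewrite !(mulrAC _ (ar T)^-1) -!mulrDl; apply: (canRL (mulfK D0)).
have -> : a 0 1 = (T I0).2 by rewrite e0.
have -> : b 0 1 = (T I1).2 by rewrite e1.
have -> : c 0 1 = (T I2).2 by rewrite e2.
by rewrite /sd /ar /cr /dt /dif /nrm /=; ring.
Qed.

Lemma row_free_cr (x y : 'rV[R]_2) : row_free (col_mx x y) -> cr (pr x) (pr y) != 0.
Proof.
move=> /row_free_inj inj; apply/eqP; rewrite /cr /pr /= => h.
have key s t : s *: x + t *: y = 0 -> s = 0 /\ t = 0.
  move=> e; have := inj 1%N (row_mx s%:M t%:M) 0.
  rewrite mul_row_col !mul_scalar_mx mul0mx => /(_ e) E.
  have [E1 E2] : s%:M = 0 :> 'rV[R]_1 /\ t%:M = 0 :> 'rV[R]_1.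
    by apply: eq_row_mx; rewrite E row_mx0.
  by have := congr1 (fun A : 'M[R]_1 => A 0 0) E1; have := congr1 (fun A : 'M[R]_1 => A 0 0) E2;
    rewrite !mxE /= !mulr1n.
(* If the determinant vanishes, the entries of a column give a vanishing combination of [x] and
   [y]. *)
have [k1 k2] : y 0 1 = 0 /\ - x 0 1 = 0.
  by apply: key; apply: pr_inj; rewrite /pr !mxE /=; congr (_, _); lra.
have [k3 k4] : y 0 0 = 0 /\ - x 0 0 = 0.
  by apply: key; apply: pr_inj; rewrite /pr !mxE /=; congr (_, _); lra.
have [] : 1 = 0 :> R /\ 0 = 0 :> R.
  by apply: key; apply: pr_inj; rewrite /pr !mxE /=; congr (_, _); lra.
by move=> /eqP; rewrite oner_eq0.
Qed.

Lemma tri_of (A : set 'rV[R]_2) : is_triangle A ->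
  exists2 T, 0 < ar T & forall x, A x <-> inn T (pr x).
Proof.
move=> [a [b [c [/row_free_cr rf ->]]]].
pose mk (p q r : R * R) : tri R := fun i => match i with I0 => p | I1 => q | I2 => r end.
have e1 : ar (mk (pr a) (pr b) (pr c)) = cr (pr (b - a)) (pr (c - a)).
  by rewrite /ar /cr /dif /pr /= !mxE.
have e2 : ar (mk (pr a) (pr c) (pr b)) = - cr (pr (b - a)) (pr (c - a)).
  by rewrite /ar /cr /dif /pr /= !mxE; ring.
case: (ltrgtP (cr (pr (b - a)) (pr (c - a))) 0) rf => // h _; last first.
  exists (mk (pr a) (pr b) (pr c)); first by rewrite e1.
  by apply: inn_conv => //; rewrite e1.
(* Clockwise corners: exchanging two of them restores the orientation. *)
exists (mk (pr a) (pr c) (pr b)); first by rewrite e2 oppr_gt0.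
have aT : 0 < ar (mk (pr a) (pr c) (pr b)) by rewrite e2 oppr_gt0.
move=> x; rewrite -(inn_conv aT erefl erefl erefl).
by split=> -[r [s [t [h1 h2 h3 h4 h5]]]]; exists r, t, s; split=> //;
  rewrite ?h5; [lra|rewrite addrAC|lra|rewrite addrAC].
Qed.

Lemma sd_continuous T i : continuous (fun x : 'rV[R]_2 => sd T i (pr x)).
Proof.
have h (k : 'I_2) (r s : R) : continuous (fun x : 'rV[R]_2 => r * (x 0 k - s)).
  move=> x; have F : Filter (nbhs x) by exact: _.
  have h0 : (fun y : 'rV[R]_2 => y 0 k) @ nbhs x --> x 0 k.
    exact: (@coord_continuous R 1 2 0 k x).
  have h1 := @cvgB _ _ _ _ F _ _ _ _ h0 (cvg_cst s).
  exact: (@cvgM _ _ _ F _ _ _ _ (@cvg_cst _ r _ _ F) (h1 F)).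
move=> x; have F : Filter (nbhs x) by exact: _.
by apply: (@cvgD _ _ _ _ F); apply: h.
Qed.

Lemma inner_interior (A : set 'rV[R]_2) T : (forall x, A x <-> inn T (pr x)) ->
  forall x, inner T (pr x) -> A° x.
Proof.
move=> hA x hx.
have o i : open [set y | sd T i (pr y) < 0].
  exact: (proj1 (continuousP _) (@sd_continuous T i) _ (@open_lt R 0)).
have : nbhs x ([set y | sd T I0 (pr y) < 0] `&` [set y | sd T I1 (pr y) < 0] `&`
    [set y | sd T I2 (pr y) < 0]).
  apply: open_nbhs_nbhs; split; last by split; [split; [exact: hx I0|exact: hx I1]|exact: hx I2].
  by apply: openI; [apply: openI|]; exact: o.
apply: filterS => y [[h0 h1] h2]; apply/hA => i; apply: ltW.
by case: i.
Qed.

Lemma closure_inn (A : set 'rV[R]_2) T : (forall x, A x <-> inn T (pr x)) ->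
  forall x, closure A x -> inn T (pr x).
Proof.
move=> hA x hx i.
have cl : closed [set y | sd T i (pr y) <= 0].
  exact: (proj1 (continuous_closedP _) (@sd_continuous T i) _ (@closed_le R 0)).
have : closure [set y | sd T i (pr y) <= 0] x.
  by apply: closure_subset hx => y /hA; apply.
by rewrite -(proj1 (closure_id _) cl).
Qed.

(** As [sd] is nonpositive at both ends, a side line through the midpoint contains both ends. Two
    such lines have only one point in common, against [p <> q]. *)
Lemma relint_mid T p q : 0 < ar T -> p <> q -> inn T p -> inn T q ->
  ~ inner T (mv p (dif q p) (1 / 2)) -> exists i, relint T i (mv p (dif q p) (1 / 2)).
Proof.
move=> aT pq hp hq hi.
have hm i : sd T i (mv p (dif q p) (1 / 2)) = (sd T i p + sd T i q) / 2.
  by rewrite sd_seg; field.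
have [i hi0] : exists i, sd T i (mv p (dif q p) (1 / 2)) = 0.
  apply: contra_notP hi => h i; rewrite lt_neqAle; apply/andP; split.
    by apply/eqP => E; apply: h; exists i.
  by rewrite hm; have := hp i; have := hq i; lra.
have [ip iq] : sd T i p = 0 /\ sd T i q = 0.
  by move: hi0; rewrite hm; have := hp i; have := hq i; lra.
exists i; split=> // k ki; rewrite hm.
have := hp k; have := hq k => k1 k2.
have [//|h] := ltP ((sd T k p + sd T k q) / 2) 0; exfalso; apply: pq.
have [kp kq] : sd T k p = 0 /\ sd T k q = 0 by lra.
have c0 := cr_neq aT ki.
have d1 := dt_dif T i p q; have d2 := dt_dif T k p q.
rewrite ip iq subrr in d1; rewrite kp kq subrr in d2.
have z (w : R * R) : cr (dif q p) w = 0.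
  apply: (mulIf c0); rewrite mul0r.
  by rewrite dt_cr d1 d2 !mul0r subrr.
have := z (1, 0); have := z (0, 1); rewrite /cr /dif /= => z1 z2.
by rewrite [LHS]surjective_pairing [RHS]surjective_pairing; congr (_, _); lra.
Qed.

Lemma touch_relint (A B : set 'rV[R]_2) T T' : 0 < ar T -> 0 < ar T' ->
  (forall x, A x <-> inn T (pr x)) -> (forall x, B x <-> inn T' (pr x)) ->
  Defs.touch A B -> exists i j p, relint T i p /\ relint T' j p.
Proof.
move=> aT aT' hA hB [a [b [ab sub]]].
have seg (s : R) : 0 <= s <= 1 -> segment a b ((1 - s) *: a + s *: b) by move=> hs; exists s.
have sa : segment a b a by have := seg 0; rewrite subr0 scale1r scale0r addr0; apply; rewrite lexx ler01.
have sb : segment a b b by have := seg 1; rewrite subrr scale1r scale0r add0r; apply; rewrite lexx ler01.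
pose mid := mv (pr a) (dif (pr b) (pr a)) (1 / 2).
have em : pr ((1 - 1 / 2) *: a + (1 / 2) *: b) = mid.
  by rewrite /pr /mid /mv /dif /= !mxE; congr (_, _); field.
have sm : segment a b ((1 - 1 / 2) *: a + (1 / 2) *: b) by apply: seg; lra.
have pab : pr a <> pr b by move=> /pr_inj E; move: ab; rewrite E eqxx.
have [[ca _] [ca' _]] := sub _ sa; have [[cb _] [cb' _]] := sub _ sb.
have [[_ im] [_ im']] := sub _ sm.
have [|i ri] := relint_mid aT pab (closure_inn hA ca) (closure_inn hA cb).
  by rewrite -/mid -em => h; apply: im; apply: inner_interior hA _ h.
have [|j rj] := relint_mid aT' pab (closure_inn hB ca') (closure_inn hB cb').
  by rewrite -/mid -em => h; apply: im'; apply: inner_interior hB _ h.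
by exists i, j, mid.
Qed.

End Bridge.

Local Close Scope ring_scope.

Theorem theorem5 (R : realType) (V : finType) (e : rel V)
    (e_sym : symmetric e) (e_irr : irreflexive e)
    (rep : has_touching_triangles_rep R e)
    (u v : V) (neq_uv : u != v) :
  #|common_neighbors e u v| <= 4 /\ #|common_edges e u v| <= 2.
Proof.
have [D [_ ht hd he]] := rep.
have [T hT] : exists T : V -> tri R, forall x, (0 < ar (T x))%R /\
    forall y, D x y <-> inn (T x) (pr y).
  have /choice[T hT] : forall x, exists T, (0 < ar T)%R /\ forall y, D x y <-> inn T (pr y).
    by move=> x; have [T aT h] := tri_of (ht x); exists T.
  by exists T.
apply: (@plane_bounds R V e e_sym e_irr T); last by apply/eqP.
split.
- by move=> x; case: (hT x).
- move=> x y /eqP xy p hx hy; have := hd x y xy.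
  apply/eqP/set0P; exists (rp p); split.
    by apply: (inner_interior (proj2 (hT x))); rewrite rpK.
  by apply: (inner_interior (proj2 (hT y))); rewrite rpK.
- move=> x y /eqP xy /(he x y xy); apply: touch_relint.
  + by case: (hT x).
  + by case: (hT y).
  + by case: (hT x).
  + by case: (hT y).
Qed.
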